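(* Let $M<L\le K$. For each $\gamma>1$ let $h_\gamma>0$ be such that $\mathsf{E}_\infty[S_{L-M}(h_\gamma)]=\gamma$. Then $T_L(h_\gamma)\in\mathcal{C}_\gamma$. If also $|\mathcal{B}|\ge L$, then as $\gamma\to\infty$ $$\mathcal{J}_{\mathcal{B}}\left[T_L(h_\gamma)\right]\sim\frac{\log\gamma}{(L-M)\,\mathcal{I}}.$$
   Context: Setting. There are $K$ sensors, indexed by $[K]=\{1,\ldots,K\}$; $\mathbb{N}=\{1,2,\ldots\}$; $M\ge 0$ is an integer with $M<K$. An arbitrary fixed subset $\mathcal{N}\subseteq[K]$ of size $|\mathcal{N}|=K-M$ consists of honest sensors; the remaining $M$ sensors are corrupt. $X_t^k$ is the observation of sensor $k$ at time $t\in\mathbb{N}$. $f,g$ are known densities with respect to a $\sigma$-finite measure $\lambda$, with $0<\mathcal{I}:=\int \log(g/f)\,g\,d\lambda<\infty$. The change occurs at a deterministic time $\nu\in\{0,1,\ldots\}$ in a subset $\mathcal{B}\subseteq\mathcal{N}$: the variables $X_t^k$, $k\in\mathcal{N}$, $t\in\mathbb{N}$, are independent, and $X_t^k$ has density $g$ if $k\in\mathcal{B}$ and $t>\nu$, and density $f$ otherwise. Adversary. A strategy is a family $\pi=\{\pi_t\}_{t\in\mathbb{N}}$ of deterministic Borel functions (which may depend on $\mathcal{N},\nu,\mathcal{B}$) such that the corrupt observations at time $t$ are $(X_t^k)_{k\notin\mathcal{N}}=\pi_t\big((X_s^j)_{j\in\mathcal{N},\,1\le s\le t}\big)$. $\mathsf{P}_\nu^{\mathcal{B},\pi}$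 is the resulting probability measure, and $\mathsf{P}_\infty^{\pi}$ is the measure when no change ever occurs in the honest sensors; expectations are $\mathsf{E}_\nu^{\mathcal{B},\pi}$, $\mathsf{E}_\infty^\pi$. The superscript $\pi$ is dropped for quantities depending only on honest observations. Criteria. $\mathcal{F}_t=\sigma(X_s^k:1\le s\le t,\,k\in[K])$. A detection rule is an $\{\mathcal{F}_t\}$-stopping time $T$. $$\mathcal{J}_{\mathcal{B}}[T]=\sup_{\nu,\pi}\ \operatorname{ess\,sup}\ \mathsf{E}_\nu^{\mathcal{B},\pi}[(T-\nu)^+\mid\mathcal{F}_\nu],\qquad \mathcal{A}[T]=\inf_\pi \mathsf{E}_\infty^\pi[T],\qquad \mathcal{C}_\gamma=\{T:\mathcal{A}[T]\ge\gamma\}.$$ Voting rules. $\ell_t^k=\log\big(g(X_t^k)/f(X_t^k)\big)$, $Y_0^k=0$, $Y_t^k=(Y_{t-1}^k+\ell_t^k)^+$ for $k\in[K]$. $Y_t^{(1)}\le\cdots\le Y_t^{(K)}$ are the ordered values over all sensors, and $W_t^{(1)}\le\cdots\le W_t^{(|\mathcal{N}|)}$ are the ordered values of $Y_t^k$ over the honest sensors $k\in\mathcal{N}$ only. $T_L(h)=\inf\{t\in\mathbb{N}:Y_t^{(K-L+1)}\ge h\}$ and $S_L(h)=\inf\{t\in\mathbb{N}:W_t^{(|\mathcal{N}|-L+1)}\ge h\}$. $x\sim y$ means $x/y\to1$. *)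

(* Defs.v *)
From HB Require Import structures.
From mathcomp Require Import all_boot all_order all_algebra finmap.
From mathcomp Require Import all_classical all_reals all_analysis.
From mathcomp Require Import measurable_realfun ess_sup_inf.

Set Implicit Arguments.
Unset Strict Implicit.
Unset Printing Implicit Defensive.

Import Order.TTheory GRing.Theory Num.Theory.
Import numFieldNormedType.Exports.

Local Open Scope classical_set_scope.
Local Open Scope ring_scope.
Local Open Scope ereal_scope.

(* Observation arrays of K sensors: x t k is the observation of sensor k at
   time t.  Time starts at 1; the values x 0 k are never used. *)
Definition obs_array (K : nat) (E : Type) : Type := nat -> 'I_K -> E.

Definition is_density (d : measure_display) (E : measurableType d)
    (R : realType) (lambda : {measure set E -> \bar R}) (p : E -> R) : Prop :=
  [/\ measurable_fun setT p, (forall x, (0 <= p x)%R)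
    & \int[lambda]_x (p x)%:E = 1].

(* Extended-real valued: +oo where f = 0 < g and -oo where g = 0.  The value -oo
   where f = g = 0 is a convention which only matters for corrupt sensors. *)
Definition llr (E : Type) (R : realType) (f g : E -> R) (x : E) : \bar R :=
  lne ((g x)%:E / (f x)%:E).

Definition kullback (d : measure_display) (E : measurableType d)
    (R : realType) (lambda : {measure set E -> \bar R}) (f g : E -> R) :
    \bar R :=
  \int[lambda]_x (llr f g x * (g x)%:E).

Definition has_density (d dO : measure_display) (E : measurableType d)
    (Om : measurableType dO) (R : realType)
    (lambda : {measure set E -> \bar R}) (P : probability Om R)
    (Z : Om -> E) (p : E -> R) : Prop :=
  forall A, measurable A -> P (Z @^-1` A) = \int[lambda]_(x in A) (p x)%:E.

Definition mutually_independent (d dO : measure_display) (E : measurableType d)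
    (Om : measurableType dO) (R : realType) (P : probability Om R)
    (I : choiceType) (D : set I) (Z : I -> Om -> E) : Prop :=
  forall (J : {fset I}) (A : I -> set E),
    (forall i, i \in J -> D i) -> (forall i, measurable (A i)) ->
    P (\bigcap_(i in [set` J]) (Z i @^-1` A i)) =
    \prod_(i <- J) P (Z i @^-1` A i).

(* Under P the honest observations X w t k (k in N, t >= 1) are independent
   random variables, X w t k having density p t k.  The entries X w t k with
   k \notin N are placeholders, see [observed]. *)
Definition honest_law (d dO : measure_display) (E : measurableType d)
    (Om : measurableType dO) (R : realType) (K : nat)
    (lambda : {measure set E -> \bar R}) (N : {set 'I_K})
    (X : Om -> obs_array K E) (P : probability Om R)
    (p : nat -> 'I_K -> E -> R) : Prop :=
  [/\ forall t k, (0 < t)%N -> k \in N ->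
        measurable_fun setT (fun w => X w t k),
      forall t k, (0 < t)%N -> k \in N ->
        has_density lambda P (fun w => X w t k) (p t k)
    & mutually_independent P [set i : nat * 'I_K | (0 < i.1)%N /\ i.2 \in N]
        (fun i w => X w i.1 i.2)].

Definition change_density (E : Type) (R : realType) (K : nat) (f g : E -> R)
    (B : {set 'I_K}) (nu : nat) (t : nat) (k : 'I_K) : E -> R :=
  if (k \in B) && (nu < t)%N then g else f.

(* sigma(X_s^k : 1 <= s <= t, k in A) *)
Definition history (d : measure_display) (E : measurableType d) (U : Type)
    (K : nat) (A : {set 'I_K}) (X : U -> obs_array K E) (t : nat) :
    set (set U) :=
  <<s [set C | exists s k D, [/\ (0 < s <= t)%N, k \in A, measurable D
                              & C = (fun u => X u s k) @^-1` D]] >>.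

(* pi t x k is the value reported at time t by the corrupt sensor k.  The two
   conditions say that, for k \notin N, it is a measurable function of
   (x s j)_(1 <= s <= t, j in N). *)
Definition is_strategy (d : measure_display) (E : measurableType d) (K : nat)
    (N : {set 'I_K}) (pi : nat -> obs_array K E -> 'I_K -> E) : Prop :=
  forall t k, (0 < t)%N -> k \notin N ->
    (forall x y : obs_array K E,
       (forall s j, (0 < s <= t)%N -> j \in N -> x s j = y s j) ->
       pi t x k = pi t y k) /\
    (forall A, measurable A ->
       history N (fun x : obs_array K E => x) t ((fun x => pi t x k) @^-1` A)).

(* The law of [observed N pi (X w)] under P is the measure P^pi. *)
Definition observed (E : Type) (K : nat) (N : {set 'I_K})
    (pi : nat -> obs_array K E -> 'I_K -> E) (x : obs_array K E) :
    obs_array K E :=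
  fun t k => if k \in N then x t k else pi t x k.

(* A detection rule is a functional of the observation array, with values in
   {1, 2, ...} or +oo, which is a stopping time of the coordinate filtration. *)
Definition is_stopping_time (d : measure_display) (E : measurableType d)
    (R : realType) (K : nat) (T : obs_array K E -> \bar R) : Prop :=
  (forall x, T x = +oo \/ exists2 n : nat, (0 < n)%N & T x = n%:R%:E) /\
  (forall n : nat,
     history [set: 'I_K] (fun x : obs_array K E => x) n
       [set x | T x <= n%:R%:E]).

(* Z is a version of E[Y | G], for Y >= 0 possibly taking the value +oo. *)
Definition is_cond_expectation (dO : measure_display) (Om : measurableType dO)
    (R : realType) (P : probability Om R) (G : set (set Om))
    (Y Z : Om -> \bar R) : Prop :=
  [/\ (forall w, 0 <= Z w),
      (forall A : set (\bar R), measurable A -> G (Z @^-1` A))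
    & (forall A, G A -> \int[P]_(w in A) Z w = \int[P]_(w in A) Y w)].

(* P nu is the law of the honest observations when the change in B
   occurs at time nu. *)
Definition worst_delay (d dO : measure_display) (E : measurableType d)
    (Om : measurableType dO) (R : realType) (K : nat) (N : {set 'I_K})
    (X : Om -> obs_array K E) (P : nat -> probability Om R)
    (T : obs_array K E -> \bar R) : \bar R :=
  ereal_sup [set v | exists nu pi Z,
    [/\ is_strategy N pi,
        is_cond_expectation (P nu)
          (history [set: 'I_K] (fun w => observed N pi (X w)) nu)
          (fun w => maxe (T (observed N pi (X w)) - nu%:R%:E) 0) Z
      & v = ess_sup (P nu) Z]].

Definition worst_false_alarm (d dO : measure_display) (E : measurableType d)
    (Om : measurableType dO) (R : realType) (K : nat) (N : {set 'I_K})
    (X : Om -> obs_array K E) (Pinf : probability Om R)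
    (T : obs_array K E -> \bar R) : \bar R :=
  ereal_inf [set \int[Pinf]_w T (observed N pi (X w)) | pi in is_strategy N].

Definition detection_class (d dO : measure_display) (E : measurableType d)
    (Om : measurableType dO) (R : realType) (K : nat) (N : {set 'I_K})
    (X : Om -> obs_array K E) (Pinf : probability Om R) (gamma : R) :
    set (obs_array K E -> \bar R) :=
  [set T | is_stopping_time T /\ gamma%:E <= worst_false_alarm N X Pinf T].

Fixpoint cusum (E : Type) (R : realType) (K : nat) (f g : E -> R)
    (x : obs_array K E) (t : nat) (k : 'I_K) : \bar R :=
  if t is s.+1 then maxe (cusum f g x s k + llr f g (x s.+1 k)) 0 else 0.

(* The j-th smallest (1 <= j <= #|A|) of the values y k, k in A. *)
Definition order_stat (R : realType) (K : nat) (A : {set 'I_K})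
    (y : 'I_K -> \bar R) (j : nat) : \bar R :=
  nth -oo (sort <=%O [seq y k | k <- enum A]) j.-1.

(* T_L(h) for A the set of all sensors, S_L(h) for A the set of honest ones. *)
Definition voting_time (E : Type) (R : realType) (K : nat) (f g : E -> R)
    (A : {set 'I_K}) (L : nat) (h : R) (x : obs_array K E) : \bar R :=
  ereal_inf [set t%:R%:E | t in [set t : nat | (0 < t)%N /\
    h%:E <= order_stat A (cusum f g x t) (#|A| - L + 1)]].

Definition asymp_equiv (R : realType) (F : set_system R) (u v : R -> \bar R) :
    Prop :=
  u x / v x @[x --> F] --> (1 : \bar R).

(* Main.v *)
Require Import Defs.
From HB Require Import structures.
From mathcomp Require Import all_boot all_order all_algebra finmap.
From mathcomp Require Import all_classical all_reals all_analysis.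
From mathcomp Require Import measurable_realfun ess_sup_inf.
From mathcomp Require Import ring lra zify.
Import Order.TTheory GRing.Theory Num.Theory.
Import numFieldNormedType.Exports.
Local Open Scope classical_set_scope.
Local Open Scope ring_scope.
Local Open Scope ereal_scope.
Set Implicit Arguments.
Unset Strict Implicit.
Unset Printing Implicit Defensive.

(** Why the theorem holds.  Write I for the divergence [kullback lambda f g]
    and m for L - M.

    False alarms.  Corrupt sensors contribute at most M votes, so as soon as L
    of all the sensors vote, at least m honest ones do: T_L(h) >= S_m(h) on
    every path and for every strategy ([voting_time_observed]).  Hence a
    threshold calibrated for S_m is conservative for T_L.

    Delay: the worst delay of T_L(h) is (1 + o(1)) h / I as h grows.
    - [delay_upper].  The statistic of a sensor of B is at least the sum of its
      log-likelihood ratios since the change.  The sum over n observations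
      stays below h with a probability that decays exponentially once
      n > (1 + eps) h / I, and it is independent of everything observed up to
      the change, so the bound survives the conditioning on the past and does
      not involve the strategy.
    - [delay_lower].  At nu = 0 the past is trivial and T_L(h) >= S_m(h), so it
      suffices that no honest sensor is likely to vote before
      n = (1 - eps) h / I.  For a sensor outside B, Y_t >= h has
      probability of order exp(- (1 - th) h) ([prechange_tail]).  For a sensor
      of B, a vote before n forces the whole sum over n observations to
      exceed its mean by a fraction, unless the sum goes far below zero
      somewhere ([early_cusum_path]); both are rare.

    Calibration: E[S_m(h)] = gamma forces log gamma = (1 + o(1)) m h.
    - [threshold_upper].  Before the change the m votes at one time come from
      independent sensors, so they cost exp(- (1 - th) m h) up to a constant,
      and a union bound over times gives a lower bound on gamma.
    - [threshold_lower].  Changing the measure on m sensors of B over a block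
      of n = (1 + o(1)) h / I times shows that all of them vote at the end of
      the block with probability at least exp(- (1 + o(1)) m h) / 2.  Disjoint
      blocks are independent, so S_m(h) is dominated by n times a geometric
      variable.

    The four bounds hold up to additive constants, which log gamma absorbs
    ([asymp_equiv_log]).  Finiteness of I is the only moment assumption: it
    yields exponential moments of - log (g / f) under g that are almost
    exp(- th I) for small th ([chernoff]), hence exponential lower tails of the
    sums, and their upper tails then follow from Markov's inequality in L^1
    ([llsum_upper_tail]). *)

(** * The log-likelihood ratio *)

Definition both_positive (E : Type) (R : realType) (f g : E -> R) (x : E) : bool :=
  (0 < f x)%R && (0 < g x)%R.

(** Agrees with [llr] where [both_positive] holds and vanishes elsewhere. *)
Definition rllr (E : Type) (R : realType) (f g : E -> R) (x : E) : R :=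
  fine (llr f g x).

(** The a-th power of the likelihood ratio g / f, cut to 0 where it is
    degenerate: [tilt f g 1] is the density of the law g with respect to the
    law f, see [integral_tilt1]. *)
Definition tilt (E : Type) (R : realType) (f g : E -> R) (a : R) (x : E) : R :=
  if both_positive f g x then expR (a * rllr f g x)%R else 0%R.

Section llr_pointwise.
Context (E : Type) (R : realType) (f g : E -> R).
Hypotheses (f0 : forall x, (0 <= f x)%R) (g0 : forall x, (0 <= g x)%R).

Lemma llr_positive x : both_positive f g x -> llr f g x = (ln (g x / f x))%:E.
Proof.
move=> /andP[fx gx]; rewrite /llr inver gt_eqF// -EFinM lne_EFin//.
exact: divr_gt0.
Qed.

Lemma rllr_positive x : both_positive f g x -> rllr f g x = ln (g x / f x).
Proof. by move=> gx; rewrite /rllr llr_positive. Qed.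

Lemma expR_rllr x : both_positive f g x -> (expR (rllr f g x) * f x = g x)%R.
Proof.
move=> gx; rewrite rllr_positive//; move: gx => /andP[fx gx].
by rewrite lnK ?posrE ?divr_gt0// divfK// gt_eqF.
Qed.

Lemma llr_fE x : (0 < f x)%R -> ~~ both_positive f g x -> llr f g x = -oo.
Proof.
move=> fx; rewrite /both_positive fx/= -leNgt => gx.
have g00 : g x = 0%R by apply/eqP; rewrite eq_le gx g0.
by rewrite /llr g00 mul0e le0_lneNy.
Qed.

Lemma rllr_bad x : ~~ both_positive f g x -> rllr f g x = 0%R.
Proof.
have [fx|fx] := ltP 0%R (f x); first by move=> /llr_fE; rewrite /rllr => ->.
have fx0 : f x = 0%R by apply/eqP; rewrite eq_le fx f0.
have [gx|gx] := ltP 0%R (g x).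
  by rewrite /rllr /llr fx0 inve0 gt0_muley ?lte_fin.
have gx0 : g x = 0%R by apply/eqP; rewrite eq_le gx g0.
by rewrite /rllr /llr gx0 mul0e le0_lneNy.
Qed.

(** Where both densities are positive, exp (- r) g is f. *)
Lemma expRN_rllr_le x : (expR (- rllr f g x) * g x <= f x + g x)%R.
Proof.
have [gx|bx] := boolP (both_positive f g x).
  by rewrite -[X in (_ * X)%R]expR_rllr// mulrA -expRD addNr expR0 mul1r lerDl.
by rewrite rllr_bad// oppr0 expR0 mul1r lerDr.
Qed.

Lemma llr_pinfty x : (0 < g x)%R -> f x = 0%R -> llr f g x = +oo.
Proof. by move=> gx fx; rewrite /llr fx inve0 gt0_muley// lte_fin. Qed.

End llr_pointwise.

Section exp_quotient.
Context (R : realType).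
Implicit Types r : R.

Lemma bernoulli_ineq (a : R) n : (0 <= a)%R -> (n%:R * (a - 1) <= a ^+ n - 1)%R.
Proof.
move=> a0; elim: n => [|n ih]; first by rewrite mul0r expr0 subrr.
rewrite exprS -natr1 mulrDl mul1r.
have := ler_wpM2l a0 ih; have : (0 <= n%:R * (a - 1) ^+ 2)%R by rewrite mulr_ge0 ?sqr_ge0.
rewrite expr2; nra.
Qed.

(** The difference quotients at 0 of th |-> - exp (- th r) along
    th = 1 / (n + 1); they converge to r. *)
Definition expq n r : R := (n.+1%:R * (1 - expR (- (n.+1%:R^-1 * r))))%R.

Lemma expq_le n r : (expq n r <= r)%R.
Proof.
rewrite /expq mulrC -ler_pdivlMr// mulrC lerBlDr -lerBlDl.
exact: expR_ge1Dx.
Qed.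

(** The difference quotients of a concave function decrease with the step, so
    the one with step 1, that is 1 - exp (- r), is the smallest.  Between the
    steps 1 / (n + 1) and 1 this is Bernoulli's inequality. *)
Lemma expq_ge n r : (- expR (- r) <= expq n r)%R.
Proof.
have := @bernoulli_ineq (expR (- (n.+1%:R^-1 * r))) n.+1 (expR_ge0 _).
rewrite -expRM_natl mulrN mulrA divff ?pnatr_eq0// mul1r /expq.
by have := expR_gt0 (- r)%R; lra.
Qed.

Lemma cvg_expq r : expq n r @[n --> \oo] --> r.
Proof.
have h0 : (n.+1%:R^-1 * r)%R @[n --> \oo] --> (0:R)%R.
  by rewrite -(mul0r r); apply: cvgMl; exact: cvg_harmonic.
have h1 : (1 + n.+1%:R^-1 * r)%R @[n --> \oo] --> (1:R)%R.
  by rewrite -[X in _ --> X]addr0; apply: cvgD => //; exact: cvg_cst.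
apply: (@squeeze_cvgr _ _ _ _ (fun n => r / (1 + n.+1%:R^-1 * r))%R (cst r)).
- near=> n; have : (0 < 1 + n.+1%:R^-1 * r)%R.
    by near: n; exact: (cvgr_gt _ h1 _ ltr01).
  set x := (n.+1%:R^-1 * r)%R => x0; rewrite expq_le andbT.
  have xr : r = (n.+1%:R * x)%R by rewrite /x mulrA divff ?pnatr_eq0 ?mul1r.
  rewrite /expq -/x [X in (X / _ <= _)%R]xr -mulrA ler_pM2l// ler_pdivrMr//.
  have := ler_wpM2l (expR_ge0 (- x)) (expR_ge1Dx x).
  by rewrite -expRD addNr expR0; lra.
- have : (r / (1 + n.+1%:R^-1 * r))%R @[n --> \oo] --> (r / 1)%R.
    by apply: cvgM; [exact: cvg_cst|apply: cvgV => //; exact: oner_neq0].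
  by rewrite divr1.
- exact: cvg_cst.
Unshelve. all: end_near. Qed.

End exp_quotient.

Section densities.
Context (R : realType) (d : measure_display) (E : measurableType d).
Context (lambda : {sigma_finite_measure set E -> \bar R}) (f g : E -> R).
Hypotheses (hf : is_density lambda f) (hg : is_density lambda g).

Let f0 x : (0 <= f x)%R. Proof. by case: hf. Qed.
Let g0 x : (0 <= g x)%R. Proof. by case: hg. Qed.
Let mf : measurable_fun setT f. Proof. by case: hf. Qed.
Let mg : measurable_fun setT g. Proof. by case: hg. Qed.

Lemma measurable_both_positive : measurable_fun setT (both_positive f g).
Proof.
apply: measurable_and; exact: measurable_fun_ltr.
Qed.

Lemma measurable_llr : measurable_fun setT (llr f g).
Proof.
have -> : llr f g = fun x => if both_positive f g x then (ln (g x * (f x)^-1))%:E else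
   if (0 < g x)%R then +oo else -oo.
  apply/funext => x; case: ifPn => [gx|]; [exact: llr_positive|rewrite negb_and -!leNgt].
  case: ltP => [gx|gx _].
    by rewrite orbF => fx; rewrite llr_pinfty//; apply/eqP; rewrite eq_le fx f0.
  have -> : llr f g x = -oo by rewrite /llr (_ : g x = 0%R) ?mul0e ?le0_lneNy//; apply/eqP; rewrite eq_le gx g0.
  by [].
apply: measurable_fun_ifT; first exact: measurable_both_positive.
  apply/measurable_EFinP; apply: (measurableT_comp (@measurable_ln R)).
  apply: measurable_funM => //.
  have -> : (fun x => (f x)^-1)%R = (fun x => powR (f x) (-1))%R.
    by apply/funext => x; rewrite powRN powRr1.
  apply: (measurableT_comp (measurable_powR _)) => //.
by apply: measurable_fun_ifT => //; exact: measurable_fun_ltr.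
Qed.

Lemma measurable_rllr : measurable_fun setT (rllr f g).
Proof. by apply: measurableT_comp => //; exact: measurable_llr. Qed.

Lemma measurable_tilt a : measurable_fun setT (tilt f g a).
Proof.
apply: measurable_fun_ifT => //; first exact: measurable_both_positive.
apply: measurableT_comp; first exact: measurable_expR.
by apply: measurable_funM => //; exact: measurable_rllr.
Qed.

Lemma integrable_density (p : E -> R) : is_density lambda p ->
  lambda.-integrable setT (EFin \o p).
Proof.
move=> [mp p0 p1]; apply/integrableP; split; first exact/measurable_EFinP.
by under eq_integral do rewrite gee0_abs ?lee_fin//; rewrite p1 ltry.
Qed.

Hypothesis hI : 0 < kullback lambda f g < +oo.

Let phi x := llr f g x * (g x)%:E.
Let mphi : measurable_fun setT phi.
Proof. by apply: emeasurable_funM; [exact: measurable_llr|exact/measurable_EFinP]. Qed.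

(** An integral of a signed function is the difference of those of its
    positive and negative parts, with +oo - oo = -oo: a positive finite value
    leaves no room for an infinite part. *)
Lemma integrable_llr : lambda.-integrable setT (fun x => llr f g x * (g x)%:E).
Proof.
move: hI; rewrite /kullback integralE -/phi.
have p0 : 0 <= \int[lambda]_x phi^\+ x by exact: integral_ge0.
have n0 : 0 <= \int[lambda]_x phi^\- x by exact: integral_ge0.
move: p0 n0.
case ep : (\int[lambda]_x phi^\+ x) => [p| |]//; case en : (\int[lambda]_x phi^\- x) => [n| |]// p0 n0 /andP[]//= _ _.
apply/integrableP; split => //.
rewrite -[fun x => _]/(abse \o phi) fune_abse.
rewrite ge0_integralD//; [|exact: measurable_funepos|exact: measurable_funeneg].
by rewrite ep en -EFinD ltry.
Qed.

(** Where f = 0 < g the log-likelihood ratio is +oo, which integrability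
    confines to a null set. *)
Lemma ae_positive : {ae lambda, forall x, ~~ both_positive f g x -> g x = 0%R}.
Proof.
have := integrable_ae measurableT integrable_llr.
apply: filterS => x /(_ Logic.I) H; rewrite negb_and -!leNgt => /orP[fx|gx].
  apply/eqP; rewrite eq_le g0 andbT leNgt; apply/negP => gx.
  have fx0 : f x = 0%R by apply/eqP; rewrite eq_le fx f0.
  by move: H; rewrite llr_pinfty// gt0_mulye// lte_fin.
by apply/eqP; rewrite eq_le gx g0.
Qed.

Lemma ae_llrE : ae_eq lambda setT (fun x => llr f g x * (g x)%:E)
  (fun x => (rllr f g x * g x)%:E).
Proof.
apply: filterS ae_positive => x H _.
have [gx|/H ->] := boolP (both_positive f g x).
  by rewrite EFinM llr_positive// rllr_positive.
by rewrite mule0 mulr0.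
Qed.

Lemma integrable_rllr : lambda.-integrable setT (fun x => (rllr f g x * g x)%:E).
Proof.
have mm : measurable_fun setT (fun x => (rllr f g x * g x)%:E).
  by apply/measurable_EFinP; apply: measurable_funM => //; exact: measurable_rllr.
have /integrableP[_ i] := integrable_llr.
apply/integrableP; split => //.
rewrite (ae_eq_integral (abse \o (fun x => llr f g x * (g x)%:E)))//.
- exact/measurableT_comp.
- exact/measurableT_comp.
- by apply: filterS ae_llrE => x /(_ Logic.I) <-.
Qed.

Lemma kullbackE : kullback lambda f g = \int[lambda]_x (rllr f g x * g x)%:E.
Proof.
rewrite /kullback; apply: ae_eq_integral => //.
- by have /integrableP[] := integrable_rllr.
- exact: ae_llrE.
Qed.

Lemma kullback_fin : kullback lambda f g \is a fin_num.
Proof. by move: hI => /andP[h1 h2]; rewrite ge0_fin_numE// ltW. Qed.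

Let I := fine (kullback lambda f g).

Lemma kullback_gt0 : (0 < I)%R.
Proof. by rewrite -lte_fin fineK ?kullback_fin//; case/andP: hI. Qed.

(** The derivative of the left-hand side at th = 0 is - I, so the left-hand
    side is at most 1 - th (I - del) for small th.  Differentiation under the
    integral is dominated convergence of the difference quotients [expq]. *)
Lemma chernoff (del eta : R) : (0 < del)%R -> (0 < eta)%R ->
  exists2 th : R, (0 < th < eta)%R &
    \int[lambda]_x (expR (- (th * rllr f g x)) * g x)%:E <=
    (expR (- (th * (I - del))))%:E.
Proof.
move=> del0 eta0.
pose F n x : \bar R := (expq n (rllr f g x) * g x)%:E.
have mF n : measurable_fun setT (F n).
  apply/measurable_EFinP; apply: measurable_funM => //.
  apply: measurable_funM => //; apply: measurable_funB => //.
  apply: measurableT_comp; first exact: measurable_expR.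
  apply: measurableT_comp => //; apply: measurable_funM => //.
  exact: measurable_rllr.
(* The quotients lie between - exp (- r) and r. *)
pose D x : \bar R := (`|rllr f g x * g x| + (f x + g x))%:E.
have iD : lambda.-integrable setT D.
  rewrite (_ : D = (abse \o (fun x => (rllr f g x * g x)%:E)) \+ ((EFin \o f) \+ (EFin \o g)))//.
  apply: integrableD => //; first exact/integrable_abse/integrable_rllr.
  by apply: integrableD => //; exact: integrable_density.
have dom n x : `|F n x| <= D x.
  rewrite lee_fin; have := @expRN_rllr_le _ _ _ _ f0 g0 x.
  have := @expq_le _ n (rllr f g x); have := @expq_ge _ n (rllr f g x).
  move=> lo up ex; rewrite ler_norml; apply/andP; split.
    have := ler_wpM2r (g0 x) lo; have := normr_ge0 (rllr f g x * g x)%R.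
    by rewrite mulNr; lra.
  have := ler_wpM2r (g0 x) up; have := ler_norm (rllr f g x * g x)%R.
  by have := f0 x; have := g0 x; lra.
have [_ _ cF] : [/\ lambda.-integrable setT (fun x => (rllr f g x * g x)%:E),
   (\int[lambda]_x `|F n x - (rllr f g x * g x)%:E| @[n --> \oo] --> 0) &
   \int[lambda]_x F n x @[n --> \oo] --> \int[lambda]_x (rllr f g x * g x)%:E].
  apply: (@dominated_convergence _ _ _ lambda _ measurableT F _ D) => //.
  - by have /integrableP[] := integrable_rllr.
  - apply: aeW => x _; apply: cvg_EFin; first by apply: nearW.
    rewrite /comp /F/=; apply: cvgMl; exact: cvg_expq.
  - exact: aeW.
rewrite -kullbackE -(fineK kullback_fin) -/I in cF.
have iF n : lambda.-integrable setT (F n).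
  by apply: (le_integrable measurableT _ _ iD) => // x _; rewrite (le_trans (dom n x))// lee_abs.
have [N [Neta NI]] : exists N, (N.+1%:R^-1 < eta)%R /\ (I - del)%:E <= \int[lambda]_x F N x.
  move/fine_cvgP: cF => [_ cc].
  have lt1 : (I - del < I)%R by rewrite ltrBlDr ltrDl.
  near \oo => n; exists n; split.
    by near: n; exact: (cvgr_lt _ (@cvg_harmonic R)).
  have fn : \int[lambda]_x F n x \is a fin_num by exact: integrable_fin_num.
  rewrite -(fineK fn) lee_fin ltW//; near: n.
  exact: (cvgr_gt _ cc _ lt1).
(* The step of a difference quotient whose integral is at least I - del. *)
exists (N.+1%:R^-1)%R; first by rewrite Neta invr_gt0 ltr0n.
set th := (N.+1%:R^-1)%R in Neta *.
have th0 : (0 < th)%R by rewrite invr_gt0 ltr0n.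
have -> : \int[lambda]_x (expR (- (th * rllr f g x)) * g x)%:E = \int[lambda]_x ((g x)%:E - th%:E * F N x).
  apply: eq_integral => x _; rewrite /F -EFinM -EFinB; congr EFin.
  rewrite /expq !mulrA mulVf ?pnatr_eq0// mul1r mulrBl mul1r opprB addrC subrK//.
rewrite integralB//; last 2 first.
- exact: integrable_density.
- exact: integrableZl.
rewrite integralZl//; have [_ _ ->] := hg.
apply: le_trans (_ : 1 - th%:E * (I - del)%:E <= _).
  by rewrite leeB// lee_pmul2l// lte_fin.
by rewrite -EFinM -EFinB lee_fin -mulrN; exact: expR_ge1Dx.
Unshelve. all: end_near. Qed.

End densities.

(** * Sigma-algebras of coordinates and independence *)

(** The generators of the sigma-algebra of the coordinates indexed by S; every
    history below is contained in one of these sigma-algebras. *)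
Definition coord_sets (d : measure_display) (E : measurableType d)
    (Om I : Type) (Z : I -> Om -> E) (S : set I) : set (set Om) :=
  [set C | exists i A, [/\ S i, measurable A & C = Z i @^-1` A]].

Section coordinates.
Context (d dO : measure_display) (E : measurableType d) (Om : measurableType dO).
Context (I : choiceType) (Z : I -> Om -> E).
Implicit Types S : set I.

Local Notation sigma S := (<<s coord_sets Z S >>).

Lemma sub_sigma_coord S S' : S `<=` S' -> sigma S `<=` sigma S'.
Proof.
move=> SS'; apply: sub_sigma_algebra2 => _ [i [A [Si mA ->]]].
by exists i, A; split => //; exact: SS'.
Qed.

Lemma sigma_coord_measurable S :
  (forall i, S i -> measurable_fun setT (Z i)) -> sigma S `<=` measurable.
Proof.
move=> mZ; apply: smallest_sub; first exact: sigma_algebra_measurable.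
by move=> _ [i [A [Si mA ->]]]; rewrite -[X in measurable X]setTI; exact: mZ.
Qed.

Lemma measurable_coord S i : S i ->
  measurable_fun (setT : set (g_sigma_algebraType (coord_sets Z S))) (Z i).
Proof.
by move=> Si _ A mA; rewrite setTI; apply: sub_sigma_algebra; exists i, A.
Qed.

(** A pi-system generating the sigma-algebra of S, on which
    [mutually_independent] can be read off. *)
Definition cylinders S : set (set Om) :=
  [set C | exists (J : {fset I}) A, [/\ (forall i, i \in J -> S i),
     (forall i, measurable (A i)) & C = \bigcap_(i in [set` J]) Z i @^-1` A i]].

Lemma cylinders_setT S : cylinders S setT.
Proof.
by exists fset0, (fun=> setT); split => //; apply/esym/seteqP; split => // w _ i.
Qed.

Lemma coord_sets_cylinders S : coord_sets Z S `<=` cylinders S.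
Proof.
move=> _ [i [A [Si mA ->]]]; exists [fset i]%fset, (fun=> A); split => //.
  by move=> j; rewrite inE => /eqP ->.
apply/seteqP; split => [w Aw j /=|w /(_ i)]; first by rewrite inE => /eqP ->.
by apply; rewrite /= inE.
Qed.

Lemma cylinders_setI S : setI_closed (cylinders S).
Proof.
move=> _ _ [J1 [A1 [J1S mA1 ->]]] [J2 [A2 [J2S mA2 ->]]].
pose A i := (if i \in J1 then A1 i else setT) `&` (if i \in J2 then A2 i else setT).
exists (J1 `|` J2)%fset, A; split.
- by move=> i; rewrite inE => /orP[]; [exact: J1S|exact: J2S].
- by move=> i; apply: measurableI; case: ifP.
- apply/seteqP; split => [w [w1 w2] i _|w wA].
    by split => /=; case: ifP => // iJ; [exact: w1|exact: w2].
  by split => i /= iJ; have [] := wA i; rewrite /= ?inE ?iJ ?orbT.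
Qed.

Lemma cylinders_measurable S :
  (forall i, S i -> measurable_fun setT (Z i)) -> cylinders S `<=` measurable.
Proof.
move=> mZ _ [J [A [JS mA ->]]]; apply: fin_bigcap_measurable; first exact: finite_fset.
move=> i /JS Si; rewrite -[X in measurable X]setTI; exact: mZ.
Qed.

Lemma sigma_coordE S : sigma S `<=` <<s cylinders S >>.
Proof. by apply: sub_sigma_algebra2; exact: coord_sets_cylinders. Qed.

End coordinates.

Section independence.
Context (d dO : measure_display) (E : measurableType d) (Om : measurableType dO).
Context (R : realType) (P : probability Om R).
Context (I : choiceType) (D : set I) (Z : I -> Om -> E).
Hypothesis mZ : forall i, D i -> measurable_fun setT (Z i).
Hypothesis indZ : mutually_independent P D Z.

Local Notation sigma S := (<<s coord_sets Z S >>).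

Let mprob (A : set Om) (mA : measurable A) : {measure set Om -> \bar R} :=
  mscale (NngNum (fine_ge0 (measure_ge0 P A))) P.

Let mprobE A (mA : measurable A) B : mprob mA B = P A * P B.
Proof. by rewrite /mprob /= /mscale/= fineK// fin_num_measure. Qed.

(** Both sides are the product over the union of the two finite index sets,
    which are disjoint. *)
Lemma indep_cylinders S1 S2 A B : S1 `<=` D -> S2 `<=` D -> S1 `&` S2 = set0 ->
  cylinders Z S1 A -> cylinders Z S2 B -> P (A `&` B) = P A * P B.
Proof.
move=> S1D S2D S12 [J1 [A1 [J1S mA1 ->]]] [J2 [A2 [J2S mA2 ->]]].
have disj i : i \in J1 -> i \in J2 -> False.
  by move=> /J1S s1 /J2S s2; have : (S1 `&` S2) i by []; rewrite S12.
pose A' i := if i \in J1 then A1 i else A2 i.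
have -> : \bigcap_(i in [set` J1]) Z i @^-1` A1 i `&` \bigcap_(i in [set` J2]) Z i @^-1` A2 i =
  \bigcap_(i in [set` (J1 `|` J2)%fset]) Z i @^-1` A' i.
  apply/seteqP; split => [w [w1 w2] i|w wA]; rewrite /A'/=.
    by rewrite inE; case: ifP => [iJ _|_/=]; [exact: w1|exact: w2].
  split => i /= iJ; have := wA i; rewrite /A'/= inE iJ ?orbT => /(_ isT)//.
  by case: ifP => // /disj /(_ iJ).
rewrite !indZ//; last 4 first.
- by move=> i /J2S/S2D.
- by move=> i /J1S/S1D.
- by move=> i; rewrite inE => /orP[/J1S/S1D|/J2S/S2D].
- by move=> i; rewrite /A'; case: ifP.
have pe : perm_eq (J1 `|` J2)%fset ((J1 : seq I) ++ J2).
  apply: uniq_perm => [||i]; rewrite ?fset_uniq ?cat_uniq ?mem_cat ?inE// !fset_uniq andbT/=.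
  by apply/hasPn => i i2; apply/negP => i1; exact: (disj i).
rewrite (perm_big _ pe) big_cat/=.
congr (_ * _); apply: eq_big_seq => i; rewrite /A'; first by move=> ->.
by case: ifP => // /disj + iJ => /(_ iJ).
Qed.

(** Two applications of the uniqueness of finite measures that agree on a
    pi-system: one extends independence in the first event, with the second
    one a cylinder, the other extends it in the second event. *)
Lemma indep_sigma S1 S2 A B : S1 `<=` D -> S2 `<=` D -> S1 `&` S2 = set0 ->
  sigma S1 A -> sigma S2 B -> P (A `&` B) = P A * P B.
Proof.
move=> S1D S2D S12 sA sB.
have mZ1 i : S1 i -> measurable_fun setT (Z i) by move=> /S1D/mZ.
have mZ2 i : S2 i -> measurable_fun setT (Z i) by move=> /S2D/mZ.
have mA : measurable A by exact: (sigma_coord_measurable mZ1).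
have cyl2 C : cylinders Z S2 C -> P (A `&` C) = P A * P C.
  move=> cC; have mC := cylinders_measurable mZ2 cC.
  rewrite muleC -(mprobE mC A) -[LHS]/(mrestr P mC A).
  apply: (g_sigma_algebra_measure_unique (cylinders Z S1) _ (fun=> setT)).
  - exact: cylinders_measurable.
  - by move=> _; exact: cylinders_setT.
  - by rewrite bigcup_const//; exists 0%N.
  - exact: cylinders_setI.
  - move=> F cF; rewrite mprobE/= /mrestr muleC.
    exact: (indep_cylinders S1D S2D S12).
  - by move=> k; rewrite /= /mrestr (le_lt_trans (probability_le1 _ _)) ?ltry//; exact: measurableI.
  - exact: sigma_coordE.
rewrite -(mprobE mA B) setIC -[LHS]/(mrestr P mA B).
apply: (g_sigma_algebra_measure_unique (cylinders Z S2) _ (fun=> setT)).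
- exact: cylinders_measurable.
- by move=> _; exact: cylinders_setT.
- by rewrite bigcup_const//; exists 0%N.
- exact: cylinders_setI.
- by move=> F cF; rewrite mprobE/= /mrestr setIC cyl2.
- by move=> k; rewrite /= /mrestr (le_lt_trans (probability_le1 _ _)) ?ltry//; exact: measurableI.
- exact: sigma_coordE.
Qed.

End independence.

Section product_expectation.
Context (d : measure_display) (Om : measurableType d) (R : realType).
Context (P : probability Om R) (W V : Om -> \bar R).
Hypotheses (mW : measurable_fun setT W) (mV : measurable_fun setT V).
Hypotheses (W0 : forall w, 0 <= W w) (V0 : forall w, 0 <= V w).

(** Independence says that the joint law is the product law; then Tonelli. *)
Lemma ge0_integral_indep :
  (forall A B, measurable A -> measurable B ->
    P (W @^-1` A `&` V @^-1` B) = P (W @^-1` A) * P (V @^-1` B)) ->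
  \int[P]_w (W w * V w) = \int[P]_w W w * \int[P]_w V w.
Proof.
move=> ind.
pose W' : {mfun Om >-> \bar R} := mfun_Sub (mem_set mW).
pose V' : {mfun Om >-> \bar R} := mfun_Sub (mem_set mV).
have mWV : measurable_fun setT (fun w => (W w, V w)) by exact: measurable_fun_pair.
pose WV : {mfun Om >-> (\bar R * \bar R)%type} := mfun_Sub (mem_set mWV).
(* The absolute values make F nonnegative everywhere, as Tonelli asks, and
   change nothing on the range of (W, V). *)
pose F (z : \bar R * \bar R) := `|z.1| * `|z.2|.
have mF : measurable_fun setT F.
  by apply: emeasurable_funM; apply: measurableT_comp; (exact: abse_measurable || exact: measurable_fst || exact: measurable_snd).
have F0 z : 0 <= F z by rewrite mule_ge0.
have -> : \int[P]_w (W w * V w) = \int[distribution P WV]_z F z.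
  rewrite ge0_integral_distribution//; apply: eq_integral => w _.
  by rewrite /F/= !gee0_abs.
have joint : \int[distribution P WV]_z F z =
    \int[(distribution P W' \x distribution P V')%E]_z F z.
  apply: eq_measure_integral => A mA _; apply/esym.
  by apply: product_measure_unique => // A1 A2 mA1 mA2; exact: ind.
rewrite joint fubini_tonelli1//.
have absE (U : {mfun Om >-> \bar R}) : (forall w, 0 <= U w) ->
    \int[distribution P U]_x `|x| = \int[P]_w U w.
  move=> U0; rewrite ge0_integral_distribution//.
  by apply: eq_integral => w _ /=; rewrite gee0_abs.
transitivity (\int[distribution P W']_x (`|x| * \int[P]_w V w)).
  apply: eq_integral => x _; rewrite /fubini_F /F/= ge0_integralZl//.
  by rewrite (absE V').
rewrite ge0_integralZr//; first by rewrite (absE W').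
- exact: integral_ge0.
Qed.

End product_expectation.

Section independent_expectations.
Context (d dO : measure_display) (E : measurableType d) (Om : measurableType dO).
Context (R : realType) (P : probability Om R).
Context (I : choiceType) (D : set I) (Z : I -> Om -> E).
Hypothesis mZ : forall i, D i -> measurable_fun setT (Z i).
Hypothesis indZ : mutually_independent P D Z.

Definition coord_measurable (S : set I) (W : Om -> \bar R) :=
  measurable_fun (setT : set (g_sigma_algebraType (coord_sets Z S))) W.

Lemma coord_measurableT S W : S `<=` D -> coord_measurable S W ->
  measurable_fun setT W.
Proof.
move=> SD mW _ A mA; apply: (@sigma_coord_measurable _ _ _ _ _ Z S).
  by move=> i /SD/mZ.
exact: mW.
Qed.

Lemma coord_measurableS S S' W : S `<=` S' -> coord_measurable S W ->
  coord_measurable S' W.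
Proof. by move=> SS' mW _ A mA; apply: (sub_sigma_coord SS'); exact: mW. Qed.

Lemma integral_coord_indep S1 S2 (W V : Om -> \bar R) :
  S1 `<=` D -> S2 `<=` D -> S1 `&` S2 = set0 ->
  coord_measurable S1 W -> coord_measurable S2 V ->
  (forall w, 0 <= W w) -> (forall w, 0 <= V w) ->
  \int[P]_w (W w * V w) = \int[P]_w W w * \int[P]_w V w.
Proof.
move=> S1D S2D S12 mW mV W0 V0; apply: ge0_integral_indep => //.
- exact: (coord_measurableT S1D).
- exact: (coord_measurableT S2D).
- move=> A B mA mB; apply: (indep_sigma mZ indZ S1D S2D S12).
    by rewrite -[X in smallest _ _ X]setTI; exact: mW.
  by rewrite -[X in smallest _ _ X]setTI; exact: mV.
Qed.

(** The factor W is what makes the induction on s work, and what later lets an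
    event of the past stand next to a sum of future observations. *)
Lemma integral_coord_prod (phi : I -> E -> R) (s : seq I) S (W : Om -> \bar R) :
  (forall i, measurable_fun setT (phi i)) -> (forall i x, (0 <= phi i x)%R) ->
  uniq s -> (forall i, i \in s -> D i /\ ~ S i) ->
  S `<=` D -> coord_measurable S W -> (forall w, 0 <= W w) ->
  \int[P]_w (W w * \prod_(i <- s) (phi i (Z i w))%:E) =
  \int[P]_w W w * \prod_(i <- s) \int[P]_w (phi i (Z i w))%:E.
Proof.
move=> mphi phi0; elim: s S W => [|i s ih] S W.
  by move=> *; rewrite big_nil mule1; apply: eq_integral => w _; rewrite big_nil mule1.
move=> /= /andP[iNs us] sD SD mW W0.
have [Di NSi] := sD i (mem_head _ _).
have mi : coord_measurable [set i] (fun w => (phi i (Z i w))%:E).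
  apply/measurable_EFinP; apply: (measurableT_comp (mphi i)).
  exact: measurable_coord.
rewrite big_cons muleA -(integral_coord_indep (S1 := S) (S2 := [set i])) //; last 3 first.
- by move=> _ ->.
- by apply/seteqP; split => // j [Sj ji]; apply: NSi; rewrite -ji.
- by move=> w; rewrite lee_fin.
rewrite -(ih (S `|` [set i])) //; last 4 first.
- move=> j js; have [Dj NSj] := sD j (mem_behead (s := i :: s) js).
  split => // -[//|ji]; move: iNs; rewrite -ji js//.
- by move=> j [/SD//|->].
- apply: emeasurable_funM; apply: coord_measurableS (mW) || apply: coord_measurableS (mi).
    by left.
  by right.
- by move=> w; rewrite mule_ge0// lee_fin.
by apply: eq_integral => w _; rewrite big_cons muleA.
Qed.

End independent_expectations.

Section density.
Context (R : realType) (d dO : measure_display) (E : measurableType d).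
Context (Om : measurableType dO).
Context (lambda : {sigma_finite_measure set E -> \bar R}) (P : probability Om R).
Context (Z : Om -> E) (p : E -> R).
Hypotheses (mZ : measurable_fun setT Z) (hp : is_density lambda p).
Hypothesis hZ : has_density lambda P Z p.

(** The law of Z and p have the same integral on every set, so p is the
    Radon-Nikodym derivative. *)
Lemma integral_has_density (phi : E -> R) :
  measurable_fun setT phi -> (forall x, (0 <= phi x)%R) ->
  \int[P]_w (phi (Z w))%:E = \int[lambda]_x (phi x * p x)%:E.
Proof.
move=> mphi phi0; have [mp p0 p1] := hp.
pose Z' : {mfun Om >-> E} := mfun_Sub (mem_set mZ).
pose nu := distribution P Z'.
have nuE A : measurable A -> nu A = \int[lambda]_(x in A) (p x)%:E by exact: hZ.
have nul : nu `<< lambda.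
  apply/null_content_dominatesP => A mA lA; rewrite nuE//.
  by apply: null_set_integral => //; apply: measurable_funTS; exact/measurable_EFinP.
transitivity (\int[nu]_x (phi x)%:E).
  by rewrite ge0_integral_distribution//; exact/measurable_EFinP.
rewrite -(Radon_Nikodym_SigmaFinite.change_of_variables nul)//; last exact/measurable_EFinP.
have iRN := Radon_Nikodym_SigmaFinite.f_integrable nul.
have ip : lambda.-integrable setT (EFin \o p).
  apply/integrableP; split; first exact/measurable_EFinP.
  by under eq_integral do rewrite gee0_abs ?lee_fin//; rewrite p1 ltry.
have ae : ae_eq lambda setT (Radon_Nikodym_SigmaFinite.f nu lambda) (EFin \o p).
  apply: integral_ae_eq => //; first exact/measurable_EFinP.
  by move=> A _ mA; rewrite -Radon_Nikodym_SigmaFinite.f_integral//; exact: nuE.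
apply: ge0_ae_eq_integral => //.
- by apply: emeasurable_funM; [exact/measurable_EFinP|have /integrableP[] := iRN].
- by apply/measurable_EFinP/measurable_funM.
- by move=> x _; rewrite mule_ge0 ?lee_fin//; exact: Radon_Nikodym_SigmaFinite.f_ge0.
- by move=> x _; rewrite lee_fin mulr_ge0.
- by apply: filterS ae => x /(_ Logic.I) /= -> _; rewrite EFinM.
Qed.

End density.

(** * Change of measure *)

Section weighted_measure.
Context (d : measure_display) (Om : measurableType d) (R : realType).
Context (P : {measure set Om -> \bar R}) (W : Om -> \bar R).

(** The measure with density W with respect to P. *)
Definition weighted of measurable_fun setT W & (forall w, 0 <= W w) :=
  fun A : set Om => \int[P]_(w in A) W w.

Hypotheses (mW : measurable_fun setT W) (W0 : forall w, 0 <= W w).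

Let weighted0 : weighted mW W0 set0 = 0.
Proof. exact: integral_set0. Qed.

Let weighted_ge0 A : 0 <= weighted mW W0 A.
Proof. exact: integral_ge0. Qed.

Let weighted_sigma_additive : semi_sigma_additive (weighted mW W0).
Proof.
move=> F mF tF mUF; rewrite /weighted ge0_integral_bigcup//.
  by apply: is_cvg_ereal_nneg_natsum_cond => n _ _; exact: integral_ge0.
exact: measurable_funTS.
Qed.

HB.instance Definition _ := isMeasure.Build _ _ _ (weighted mW W0)
  weighted0 weighted_ge0 weighted_sigma_additive.

End weighted_measure.

Section change_of_measure.
Context (d dO : measure_display) (E : measurableType d) (Om : measurableType dO).
Context (R : realType) (P Q : probability Om R).
Context (I : choiceType) (D : set I) (Z : I -> Om -> E).
Hypothesis mZ : forall i, D i -> measurable_fun setT (Z i).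
Hypothesis indP : mutually_independent P D Z.
Hypothesis indQ : mutually_independent Q D Z.
Context (s : seq I) (r : E -> R).
Hypotheses (us : uniq s) (sD : forall i, i \in s -> D i).
Hypotheses (mr : measurable_fun setT r) (r0 : forall x, (0 <= r x)%R).
Hypothesis QP : forall i A, i \in s -> measurable A ->
  Q (Z i @^-1` A) = \int[P]_w (r (Z i w) * \1_A (Z i w))%:E.

(** Both sides are measures on the sigma-algebra of the coordinates in s, so
    it is enough to compare them on cylinders, where both factorize. *)
Lemma change_of_measure C : <<s coord_sets Z [set` s] >> C ->
  Q C = \int[P]_(w in C) (\prod_(i <- s) r (Z i w))%:E.
Proof.
have mW : measurable_fun setT (fun w => (\prod_(i <- s) r (Z i w))%:E).
  apply/measurable_EFinP.
  apply: measurable_prod => i /sD/mZ mi; exact: measurableT_comp.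
have W0 w : 0 <= (\prod_(i <- s) r (Z i w))%:E.
  by rewrite lee_fin; exact: prodr_ge0.
have mZs i : i \in s -> measurable_fun setT (Z i) by move=> /sD/mZ.
move=> sC; rewrite -[RHS]/(weighted P mW W0 C).
apply: (g_sigma_algebra_measure_unique (cylinders Z [set` s]) _ (fun=> setT)).
- exact: cylinders_measurable.
- by move=> _; exact: cylinders_setT.
- by rewrite bigcup_const//; exists 0%N.
- exact: cylinders_setI.
- move=> _ [J [A [Js mA ->]]].
  (* The cylinder is padded with full sides, so that its index set is exactly s,
     as in the product of the r (Z i). *)
  pose A' i := if i \in J then A i else setT.
  have mA' i : measurable (A' i) by rewrite /A'; case: ifP.
  have -> : \bigcap_(i in [set` J]) Z i @^-1` A i =
      \bigcap_(i in [set` [fset i in s]%fset]) Z i @^-1` A' i.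
    apply/seteqP; split => [w wA i /= _|w wA i /= iJ].
      by rewrite /A'; case: ifP => // iJ; exact: wA.
    by have := wA i; rewrite /= !inE /A' iJ; apply; exact: Js.
  have mC : measurable (\bigcap_(i in [set` [fset i in s]%fset]) Z i @^-1` A' i).
    apply: fin_bigcap_measurable; first exact: finite_fset.
    by move=> i; rewrite /= inE => /mZs mi; rewrite -[X in measurable X]setTI; exact: mi.
  rewrite /= /weighted integral_mkcond indQ//; last by move=> i; rewrite inE; exact: sD.
  transitivity (\int[P]_w (cst 1 w * \prod_(i <- s) (r (Z i w) * \1_(A' i) (Z i w))%:E)).
    rewrite (integral_coord_prod mZ indP (phi := fun i x => (r x * \1_(A' i) x)%R) (S := set0))//.
    + have -> : \int[P]_w cst 1 w = 1 by rewrite integral_cst//= probability_setT mule1.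
      rewrite mul1e; have pe : perm_eq [fset i in s]%fset s.
        by apply: uniq_perm; rewrite ?fset_uniq// => i; rewrite inE.
      by rewrite (perm_big _ pe)/=; apply: eq_big_seq => i si; exact: QP.
    + by move=> i; apply: measurable_funM.
    + by move=> i x; rewrite mulr_ge0.
    + by move=> i /sD Di; split => //; case.
    + exact: measurable_cst.
  apply: eq_integral => w _; rewrite mul1e -(big_morph _ EFinM erefl) big_split/=.
  rewrite epatch_indic /= EFinM; congr (_ * _%:E).
  rewrite [RHS]indicE; case: (boolP (w \in _)) => wC.
    move/set_mem : wC => wC; apply: big1_seq => i /andP[_ si].
    by rewrite indicE mem_set//; apply: wC; rewrite /= inE.
  apply/eqP; rewrite prodf_seq_eq0; apply: contraNT wC => /hasPn nz.
  apply/mem_set => i /=; rewrite inE => /nz /=; rewrite indicE.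
  by case: (boolP (_ \in _)) => [/set_mem//|]; rewrite eqxx.
- by move=> k; rewrite (le_lt_trans (probability_le1 _ _)) ?ltry.
- exact: sigma_coordE.
Qed.

End change_of_measure.

(** * Sums of log-likelihood ratios *)

Section log_likelihood_sums.
Context (R : realType) (d dO : measure_display) (E : measurableType d).
Context (Om : measurableType dO).
Context (lambda : {sigma_finite_measure set E -> \bar R}) (f g : E -> R).
Hypotheses (hf : is_density lambda f) (hg : is_density lambda g).
Hypothesis hI : 0 < kullback lambda f g < +oo.
Context (I : choiceType) (D : set I) (Z : I -> Om -> E).
Context (P : probability Om R).
Hypothesis mZ : forall i, D i -> measurable_fun setT (Z i).
Hypothesis indP : mutually_independent P D Z.

Local Notation r := (rllr f g).
Local Notation kl := (fine (kullback lambda f g)).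

Let mr : measurable_fun setT r := measurable_rllr hf hg.

Definition llsum (s : seq I) (w : Om) : R := (\sum_(i <- s) r (Z i w))%R.

Lemma coord_measurable_llsum (S : set I) (s : seq I) : (forall i, i \in s -> S i) ->
  measurable_fun (setT : set (g_sigma_algebraType (coord_sets Z S))) (llsum s).
Proof.
elim: s => [|i s ih] sS.
  by rewrite (_ : llsum [::] = cst 0%R)//; apply/funext => w; rewrite /llsum big_nil.
have -> : llsum (i :: s) = (fun w => r (Z i w) + llsum s w)%R.
  by apply/funext => w; rewrite /llsum big_cons.
apply: measurable_funD; last by apply: ih => j js; apply: sS; rewrite inE js orbT.
by apply: (measurableT_comp mr); apply: measurable_coord; apply: sS; rewrite mem_head.
Qed.

Lemma measurable_llsum (s : seq I) : (forall i, i \in s -> D i) ->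
  measurable_fun setT (llsum s).
Proof.
move=> sD; apply/measurable_EFinP.
apply: (coord_measurableT mZ (@subset_refl _ D)).
by apply/measurable_EFinP; exact: coord_measurable_llsum.
Qed.

Lemma coord_llsum_le (S : set I) (s : seq I) c : (forall i, i \in s -> S i) ->
  <<s coord_sets Z S >> [set w | (llsum s w <= c)%R].
Proof.
move=> sS.
have := @measurable_fun_ler _ (g_sigma_algebraType (coord_sets Z S)) R setT (llsum s) (cst c)
  (coord_measurable_llsum sS) (measurable_cst _) measurableT [set true] Logic.I.
by rewrite setTI; congr (_ _); apply/seteqP; split.
Qed.

Lemma coord_llsum_ge (S : set I) (s : seq I) c : (forall i, i \in s -> S i) ->
  <<s coord_sets Z S >> [set w | (c <= llsum s w)%R].
Proof.
move=> sS.
have := @measurable_fun_ler _ (g_sigma_algebraType (coord_sets Z S)) R setT (cst c) (llsum s)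
  (measurable_cst _) (coord_measurable_llsum sS) measurableT [set true] Logic.I.
by rewrite setTI; congr (_ _); apply/seteqP; split.
Qed.

Section postchange.
Context (s : seq I).
Hypotheses (us : uniq s) (sD : forall i, i \in s -> D i).
Hypothesis sg : forall i, i \in s -> has_density lambda P (Z i) g.

Variables (th del : R).
Hypothesis th0 : (0 < th)%R.
Hypothesis mgf : \int[lambda]_x (expR (- (th * r x)) * g x)%:E <=
  (expR (- (th * (kl - del))))%:E.

(** By independence, the integral is P A times the product of the exponential
    moments of the terms. *)
Lemma integral_exp_llsum (S : set I) A : S `<=` D ->
  (forall i, i \in s -> ~ S i) -> <<s coord_sets Z S >> A ->
  \int[P]_(w in A) (expR (- (th * llsum s w)))%:E <=
  P A * (expR (- (th * ((size s)%:R * (kl - del)))))%:E.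
Proof.
move=> SD Ss sA.
have mA : measurable A by apply: (sigma_coord_measurable _ sA) => i /SD/mZ.
pose phi (i : I) x : R := expR (- (th * r x)).
have mphi i : measurable_fun setT (phi i).
  apply: measurableT_comp; first exact: measurable_expR.
  by apply: measurableT_comp => //; exact: measurable_funM.
rewrite integral_mkcond epatch_indic.
have -> : \int[P]_w (((fun w => (expR (- (th * llsum s w)))%:E) \* (EFin \o \1_A)) w) =
   \int[P]_w ((EFin \o \1_A) w * \prod_(i <- s) (phi i (Z i w))%:E).
  apply: eq_integral => w _ /=; rewrite muleC; congr (_ * _).
  rewrite -(big_morph _ EFinM erefl) /llsum; congr (_%:E).
  rewrite mulr_sumr -sumrN; elim: (s) => [|i t ih]; first by rewrite !big_nil expR0.
  by rewrite !big_cons expRD ih.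
rewrite (integral_coord_prod mZ indP mphi (S := S))//; last 4 first.
- by move=> i x; exact: expR_ge0.
- by move=> i si; split; [exact: sD|exact: Ss].
- rewrite /coord_measurable; apply/measurable_EFinP.
  by apply: (@measurable_indic _ (g_sigma_algebraType (coord_sets Z S))).
- by move=> w; rewrite lee_fin.
have -> : \int[P]_w (EFin \o \1_A) w = P A by rewrite integral_indic// setIT.
rewrite lee_wpmul2l//.
apply: (@le_trans _ _ (\prod_(i <- s) (expR (- (th * (kl - del))))%:E)).
  elim: (s) sg sD => [_ _|i t ih tg tD]; first by rewrite !big_nil.
  rewrite !big_cons; apply: lee_pmul.
  - by apply: integral_ge0 => w _; rewrite lee_fin expR_ge0.
  - by apply: prode_ge0 => j _; apply: integral_ge0 => w _; rewrite lee_fin expR_ge0.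
  - have ti : i \in i :: t by rewrite mem_head.
    by rewrite (integral_has_density (mZ (tD i ti)) hg (tg i ti) (mphi i))// => x; exact: expR_ge0.
  - by apply: ih => j jt; [apply: tg|apply: tD]; rewrite inE jt orbT.
rewrite -(big_morph _ EFinM erefl) lee_fin big_const_seq count_predT iter_mulr_1.
rewrite -expRM_natl.
by rewrite !mulrN mulrCA.
Qed.

(** Markov's inequality for exp (- th llsum).  The event A belongs to
    coordinates outside s: it plays the role of the past of s. *)
Lemma llsum_lower_tail (S : set I) A c : S `<=` D ->
  (forall i, i \in s -> ~ S i) -> <<s coord_sets Z S >> A ->
  P (A `&` [set w | (llsum s w <= c)%R]) <=
  P A * (expR (th * (c - (size s)%:R * (kl - del))))%:E.
Proof.
move=> SD Ss sA.
have mA : measurable A by apply: (sigma_coord_measurable _ sA) => i /SD/mZ.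
have mC : measurable [set w | (llsum s w <= c)%R].
  by apply: (sigma_coord_measurable _ (coord_llsum_le c sD)) => i /mZ.
rewrite -[P (_ `&` _)]mul1e -integral_cst; last exact: measurableI.
have mL := measurable_llsum sD.
have me (B : set Om) : measurable_fun B (fun w => (expR (- (th * llsum s w)))%:E).
  apply: measurable_funTS; apply/measurable_EFinP/measurableT_comp; first exact: measurable_expR.
  by apply: measurableT_comp => //; exact: measurable_funM.
apply: (@le_trans _ _ (\int[P]_(w in A) ((expR (th * c))%:E * (expR (- (th * llsum s w)))%:E))).
  apply: (@le_trans _ _ (\int[P]_(w in A `&` [set w | (llsum s w <= c)%R])
     ((expR (th * c))%:E * (expR (- (th * llsum s w)))%:E))).
    apply: ge0_le_integral => //.
    - exact: measurableI.
    - exact: emeasurable_funM.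
    - move=> w [_ /= wc]; rewrite -EFinM lee_fin -expRD -expR0 ler_expR.
      by rewrite -mulrBr mulr_ge0 ?subr_ge0// ltW.
  apply: ge0_subset_integral => //; first exact: measurableI.
  exact: emeasurable_funM.
rewrite ge0_integralZl//.
apply: (@le_trans _ _ ((expR (th * c))%:E * (P A * (expR (- (th * ((size s)%:R * (kl - del)))))%:E))).
  by rewrite lee_wpmul2l ?lee_fin ?expR_ge0//; exact: (integral_exp_llsum SD).
by rewrite muleCA -EFinM -expRD -mulrBr.
Qed.

(** The transfer [integral_has_density] is for nonnegative functions, hence
    the detour by positive and negative parts. *)
Lemma integrable_rllr_comp i : i \in s ->
  P.-integrable setT (fun w => (r (Z i w))%:E) /\
  \int[P]_w (r (Z i w))%:E = kl%:E.
Proof.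
move=> si; have mi := mZ (sD si); have hi := sg si.
pose rp x : R := Num.max (r x) 0%R; pose rn x : R := Num.max (- r x)%R 0%R.
have mrp : measurable_fun setT rp by exact: measurable_maxr.
have mrn : measurable_fun setT rn by apply: measurable_maxr => //; exact: measurableT_comp.
have rp0 x : (0 <= rp x)%R by rewrite /rp le_max lexx orbT.
have rn0 x : (0 <= rn x)%R by rewrite /rn le_max lexx orbT.
have rE x : r x = (rp x - rn x)%R.
  rewrite /rp /rn; case: (leP 0%R (r x)) => h.
    by rewrite (max_idPr _) ?oppr_le0// subr0.
  by rewrite (max_idPl _) ?oppr_ge0 ?ltW// opprK add0r.
have ig := integrable_rllr hf hg hI.
have [_ g0 _] := hg; have mg : measurable_fun setT g by case: hg.
have fin (q : E -> R) : measurable_fun setT q -> (forall x, 0 <= q x)%R -> (forall x, q x <= `|r x|)%R ->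
    P.-integrable setT (fun w => (q (Z i w))%:E) /\
    lambda.-integrable setT (fun x => (q x * g x)%:E).
  move=> mq q0 qr.
  have il : lambda.-integrable setT (fun x => (q x * g x)%:E).
    apply: (le_integrable measurableT _ _ ig).
      by apply/measurable_EFinP; exact: measurable_funM.
    move=> x _ /=; rewrite lee_fin !normrM (ger0_norm (q0 x)).
    by rewrite ler_wpM2r.
  split => //; apply/integrableP; split; first by apply/measurable_EFinP; exact: measurableT_comp.
  under eq_integral do rewrite gee0_abs ?lee_fin//.
  rewrite (integral_has_density mi hg hi mq q0).
  exact: integrable_lty.
have [ip lp] : P.-integrable setT (fun w => (rp (Z i w))%:E) /\
    lambda.-integrable setT (fun x => (rp x * g x)%:E).
  by apply: fin => // x; rewrite /rp ge_max normr_ge0 ler_norm.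
have [inn ln] : P.-integrable setT (fun w => (rn (Z i w))%:E) /\
    lambda.-integrable setT (fun x => (rn x * g x)%:E).
  by apply: fin => // x; rewrite /rn ge_max normr_ge0 -normrN ler_norm.
have -> : (fun w => (r (Z i w))%:E) = (fun w => (rp (Z i w))%:E) \- (fun w => (rn (Z i w))%:E).
  by apply/funext => w /=; rewrite -EFinB -rE.
split; first exact: integrableB.
rewrite integralB// (integral_has_density mi hg hi mrp rp0) (integral_has_density mi hg hi mrn rn0).
rewrite -integralB// fineK; last exact: kullback_fin hI.
rewrite (kullbackE hf hg hI); apply: eq_integral => x _.
by rewrite -EFinB -mulrBl -rE.
Qed.

Lemma integral_llsum : P.-integrable setT (EFin \o llsum s) /\
  \int[P]_w (llsum s w)%:E = ((size s)%:R * kl)%:E.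
Proof.
suff: forall t, {subset t <= s} -> P.-integrable setT (EFin \o llsum t) /\
  \int[P]_w (llsum t w)%:E = ((size t)%:R * kl)%:E by apply.
elim=> [_|i t ih ts].
  have -> : EFin \o llsum [::] = cst 0 by apply/funext => w; rewrite /= /llsum big_nil.
  split; first exact: integrable0.
  rewrite mul0r (eq_integral (cst 0)) ?integral0// => w _.
  by rewrite /llsum big_nil.
have [it et] : P.-integrable setT (EFin \o llsum t) /\
    \int[P]_w (llsum t w)%:E = ((size t)%:R * kl)%:E.
  by apply: ih => j jt; apply: ts; rewrite inE jt orbT.
have [ii ei] := integrable_rllr_comp (ts i (mem_head _ _)).
have lE : EFin \o llsum (i :: t) = (fun w => (r (Z i w))%:E) \+ (EFin \o llsum t).
  by apply/funext => w; rewrite /= /llsum big_cons EFinD.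
split; first by rewrite lE; exact: integrableD.
rewrite -[LHS]/(\int[P]_w (EFin \o llsum (i :: t)) w) lE integralD//= ei et.
by rewrite -EFinD -natr1 mulrDl mul1r addrC.
Qed.

(** Only the first moment of the sum is available.  Since its lower tail is
    exponentially small, its excess over the mean n kl is bounded by a
    nonnegative variable G of expectation at most n del + 1 / th, to which
    Markov's inequality applies. *)
Lemma llsum_upper_tail (eta : R) : (0 < del)%R -> (0 < eta)%R -> (0 < size s)%N ->
  P [set w | ((size s)%:R * (kl + eta) <= llsum s w)%R] <=
  (del / eta + (th * eta * (size s)%:R)^-1)%:E.
Proof.
move=> del0 eta0 s0; set n : R := (size s)%:R.
have n0 : (0 < n)%R by rewrite ltr0n.
set ev := [set w | _].
have mev : measurable ev.
  by apply: (sigma_coord_measurable _ (coord_llsum_ge _ sD)) => i /mZ.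
have mL := measurable_llsum sD.
pose e w : R := expR (- (th * llsum s w)).
have e0 w : (0 <= e w)%R by exact: expR_ge0.
have me : measurable_fun setT e.
  apply: measurableT_comp; first exact: measurable_expR.
  by apply: measurableT_comp => //; exact: measurable_funM.
pose C := expR (th * (n * (kl - del))).
have Ie : \int[P]_w (e w)%:E <= (expR (- (th * (n * (kl - del)))))%:E.
  apply: le_trans (integral_exp_llsum (S := set0) (A := setT) _ _ _) _ => //.
  - by move=> i _ [].
  - exact: (@measurableT _ (g_sigma_algebraType (coord_sets Z set0))).
  by rewrite probability_setT mul1e.
have ie : P.-integrable setT (EFin \o e).
  apply/integrableP; split; first exact/measurable_EFinP.
  under eq_integral do rewrite gee0_abs ?lee_fin//.
  exact: le_lt_trans Ie (ltry _).
have [iL eL] := integral_llsum.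
(* exp y >= 1 + y at y = th (n (kl - del) - llsum) shows that the exponential
   correction keeps G nonnegative; its expectation is at most 1 / th. *)
pose G w : R := (llsum s w + ((- n * kl + n * del) + th^-1 * C * e w))%R.
have mG : measurable_fun setT (EFin \o G).
  apply/measurable_EFinP; apply: measurable_funD => //; apply: measurable_funD => //.
  exact: measurable_funM.
have CeE w : (C * e w = expR (th * (n * (kl - del) - llsum s w)))%R.
  by rewrite /C /e -expRD -mulrBr.
have G1 w : (llsum s w - n * kl <= G w)%R.
  have : (0 <= th^-1 * C * e w)%R by rewrite !mulr_ge0// ?invr_ge0 ?expR_ge0// ltW.
  have : (0 <= n * del)%R by rewrite mulr_ge0// ltW.
  rewrite /G; lra.
have G0 w : (0 <= G w)%R.
  have := expR_ge1Dx (th * (n * (kl - del) - llsum s w)); rewrite -CeE.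
  have ti : (0 < th^-1)%R by rewrite invr_gt0.
  move/(ler_wpM2l (ltW ti)); rewrite mulrDr mulr1 !mulrA mulVf ?gt_eqF// mul1r.
  rewrite /G mulrBr mulNr; lra.
have IG : \int[P]_w (G w)%:E <= (n * del + th^-1)%:E.
  have -> : (fun w => (G w)%:E) = (EFin \o llsum s) \+ (cst (- n * kl + n * del)%:E \+
      (fun w => (th^-1 * C)%:E * (EFin \o e) w)).
    by apply/funext => w; rewrite /= -EFinM -!EFinD.
  have ic : P.-integrable setT (cst (- n * kl + n * del)%:E).
    exact: finite_measure_integrable_cst.
  rewrite integralD//; last by apply: integrableD => //; exact: integrableZl.
  rewrite integralD//; last exact: integrableZl.
  rewrite integralZl// integral_cst//= probability_setT mule1 eL.
  rewrite -(fineK (integrable_fin_num measurableT ie)) -EFinM -!EFinD lee_fin.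
  have : (fine (\int[P]_x (EFin \o e) x) <= expR (- (th * (n * (kl - del)))))%R.
    by rewrite -lee_fin fineK//; exact: integrable_fin_num.
  have tC : (0 <= th^-1 * C)%R by rewrite mulr_ge0 ?invr_ge0 ?expR_ge0// ltW.
  move/(ler_wpM2l tC); rewrite [X in (_ <= X)%R](_ : _ = th^-1)%R; last first.
    by rewrite /C -mulrA -expRD subrr expR0 mulr1.
  by rewrite -/n; lra.
have : (n * eta)%:E * P ev <= (n * del + th^-1)%:E.
  apply: le_trans IG; rewrite -integral_cst//.
  apply: (@le_trans _ _ (\int[P]_(w in ev) (G w)%:E)).
    apply: ge0_le_integral => //.
    - by move=> w _; rewrite lee_fin mulr_ge0// ltW.
    - exact: measurable_funTS.
    - move=> w wev; rewrite lee_fin (le_trans _ (G1 w))//.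
      by move: wev; rewrite /ev /= -/n mulrDr; lra.
  by apply: ge0_subset_integral => // w _; rewrite lee_fin.
have fP : P ev \is a fin_num by exact: fin_num_measure.
rewrite -(fineK fP) -EFinM !lee_fin mulrC -ler_pdivlMr ?mulr_gt0// => /le_trans; apply.
rewrite le_eqVlt; apply/orP; left; apply/eqP; field.
by rewrite !gt_eqF.
Qed.

End postchange.
End log_likelihood_sums.

(** * Likelihood ratios of two product laws *)

Section density_moments.
Context (R : realType) (d dO : measure_display) (E : measurableType d).
Context (Om : measurableType dO).
Context (lambda : {sigma_finite_measure set E -> \bar R}) (f g : E -> R).
Hypotheses (hf : is_density lambda f) (hg : is_density lambda g).
Hypothesis hI : 0 < kullback lambda f g < +oo.
Context (P : probability Om R) (Z : Om -> E).
Hypothesis mZ : measurable_fun setT Z.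

Local Notation r := (rllr f g).

Let f0 x : (0 <= f x)%R. Proof. by case: hf. Qed.
Let g0 x : (0 <= g x)%R. Proof. by case: hg. Qed.
Let mf : measurable_fun setT f. Proof. by case: hf. Qed.
Let mg : measurable_fun setT g. Proof. by case: hg. Qed.

Lemma tilt_ge0 a x : (0 <= tilt f g a x)%R.
Proof. by rewrite /tilt; case: ifP. Qed.

(** Since f > 0 almost everywhere on {g > 0}, the law g is absolutely
    continuous with respect to the law f. *)
Lemma integral_tilt1 A : measurable A ->
  \int[lambda]_(x in A) (g x)%:E = \int[lambda]_x (tilt f g 1 x * \1_A x * f x)%:E.
Proof.
move=> mA; rewrite integral_mkcond epatch_indic; apply: ge0_ae_eq_integral => //.
- by apply: emeasurable_funM; apply/measurable_EFinP => //; exact: measurable_indic.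
- apply/measurable_EFinP; apply: measurable_funM => //; apply: measurable_funM => //.
  exact: measurable_tilt hf hg _.
- by move=> x _ /=; rewrite mule_ge0// lee_fin.
- by move=> x _; rewrite lee_fin !mulr_ge0// tilt_ge0.
- apply: filterS (ae_positive hf hg hI) => x gx _ /=; rewrite -EFinM; congr EFin.
  rewrite /tilt; case: ifPn => [xg|/gx ->]; last by rewrite !mul0r.
  by rewrite mul1r mulrAC expR_rllr.
Qed.

Lemma measurable_bad : measurable [set x | ~~ both_positive f g x].
Proof.
rewrite -[X in measurable X]setTI.
have -> : [set x | ~~ both_positive f g x] = both_positive f g @^-1` [set false].
  by apply/seteqP; split => x /=; case: both_positive.
by apply: (measurable_both_positive hf hg).
Qed.

Lemma post_change_positive : has_density lambda P Z g ->
  P [set w | ~~ both_positive f g (Z w)] = 0.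
Proof.
move=> hZ; rewrite -[LHS]/(P (Z @^-1` [set x | ~~ both_positive f g x])) hZ; last exact: measurable_bad.
have mb := measurable_bad.
rewrite (ae_eq_integral (cst 0)) ?integral0//; last 2 first.
- by apply: measurable_funTS; exact/measurable_EFinP.
- by apply: filterS (ae_positive hf hg hI) => x gx /= /gx ->.
Qed.

Lemma pre_change_pos : has_density lambda P Z f ->
  P [set w | (f (Z w) <= 0)%R] = 0.
Proof.
move=> hZ; rewrite -[LHS]/(P (Z @^-1` [set x | (f x <= 0)%R])) hZ; last first.
  have := @measurable_fun_ler _ E R setT f (cst 0%R) mf (measurable_cst _) measurableT [set true] Logic.I.
  by rewrite setTI.
apply: integral0_eq => x /= fx; congr EFin; apply/eqP.
by rewrite eq_le fx f0.
Qed.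

(** Where both densities are positive,
    (g / f) ^ (1 - th) f = (g / f) ^ (- th) g: moments before the change are
    moments after the change. *)
Lemma integral_tilt_le th : has_density lambda P Z f ->
  \int[P]_w (tilt f g (1 - th) (Z w))%:E <=
  \int[lambda]_x (expR (- (th * r x)) * g x)%:E.
Proof.
move=> hZ; have mt := measurable_tilt hf hg (1 - th).
rewrite (integral_has_density mZ hf hZ mt); last exact: tilt_ge0.
apply: ge0_le_integral => //.
- by move=> x _; rewrite lee_fin mulr_ge0// tilt_ge0.
- by apply/measurable_EFinP; exact: measurable_funM.
- apply/measurable_EFinP; apply: measurable_funM => //.
  apply: measurableT_comp; first exact: measurable_expR.
  apply: measurableT_comp => //; apply: measurable_funM => //.
  exact: measurable_rllr hf hg.
- move=> x _; rewrite lee_fin /tilt; case: ifPn => [xg|_]; last first.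
    by rewrite mul0r mulr_ge0// expR_ge0.
  by rewrite mulrBl mul1r expRD mulrC mulrA [(f x * _)%R]mulrC expR_rllr// mulrC.
Qed.

End density_moments.

Section likelihood_bound.
Context (R : realType) (d dO : measure_display) (E : measurableType d).
Context (Om : measurableType dO).
Context (lambda : {sigma_finite_measure set E -> \bar R}) (f g : E -> R).
Hypotheses (hf : is_density lambda f) (hg : is_density lambda g).
Hypothesis hI : 0 < kullback lambda f g < +oo.
Context (I : choiceType) (D : set I) (Z : I -> Om -> E).
Context (P Q : probability Om R).
Hypothesis mZ : forall i, D i -> measurable_fun setT (Z i).
Hypothesis indP : mutually_independent P D Z.
Hypothesis indQ : mutually_independent Q D Z.
Context (s : seq I).
Hypotheses (us : uniq s) (sD : forall i, i \in s -> D i).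
Hypothesis sf : forall i, i \in s -> has_density lambda P (Z i) f.
Hypothesis sg : forall i, i \in s -> has_density lambda Q (Z i) g.

(** On the coordinates of s the likelihood ratio of Q to P is at most
    exp (llsum f g Z s), hence at most exp b on C. *)
Lemma likelihood_bound C b : <<s coord_sets Z [set` s] >> C ->
  C `<=` [set w | (llsum f g Z s w <= b)%R] -> Q C <= (expR b)%:E * P C.
Proof.
move=> sC Cb.
have mC : measurable C by apply: (sigma_coord_measurable _ sC) => i /sD/mZ.
have mt := measurable_tilt hf hg 1%R.
rewrite (change_of_measure mZ indP indQ us sD mt _ _ sC); last 2 first.
- by move=> x; exact: tilt_ge0.
- move=> i A si mA; rewrite (sg si)// (integral_tilt1 hf hg hI)//.
  rewrite -(integral_has_density (phi := (fun x => tilt f g 1 x * \1_A x)%R) (mZ (sD si)) hf (sf si))//.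
  - exact: measurable_funM.
  - by move=> x; rewrite mulr_ge0// tilt_ge0.
rewrite -integral_cst//; apply: ge0_le_integral => //.
- by move=> w _; rewrite lee_fin prodr_ge0// => i _; exact: tilt_ge0.
- apply: measurable_funTS; apply/measurable_EFinP.
  by apply: measurable_prod => i /sD/mZ mi; exact: measurableT_comp.
- move=> w /Cb /= wb; rewrite lee_fin; apply: le_trans (_ : expR (llsum f g Z s w) <= _)%R; last by rewrite ler_expR.
  rewrite /llsum expR_sum; apply: ler_prod => i _; rewrite tilt_ge0/= /tilt.
  by case: ifP => // _; rewrite mul1r.
Qed.

End likelihood_bound.

Section independent_events.
Context (d dO : measure_display) (E : measurableType d) (Om : measurableType dO).
Context (R : realType) (P : probability Om R).
Context (I : choiceType) (D : set I) (Z : I -> Om -> E).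
Hypothesis mZ : forall i, D i -> measurable_fun setT (Z i).
Hypothesis indP : mutually_independent P D Z.

(** Grouping property of independence, by induction on s. *)
Lemma indep_bigcap (J : eqType) (s : seq J) (S : J -> set I) (F : J -> set Om) :
  uniq s -> (forall j, j \in s -> S j `<=` D) ->
  (forall j, j \in s -> <<s coord_sets Z (S j) >> (F j)) ->
  (forall j k, j \in s -> k \in s -> j != k -> S j `&` S k = set0) ->
  P (\big[setI/setT]_(j <- s) F j) = \prod_(j <- s) P (F j).
Proof.
move=> us SD sF disj; pose SS (t : seq J) : set I := [set i | exists2 j, j \in t & S j i].
have sFS (t : seq J) : {subset t <= s} -> <<s coord_sets Z (SS t) >> (\big[setI/setT]_(j <- t) F j).
  elim: t => [_|j t ih ts].
    by rewrite big_nil; exact: (@measurableT _ (g_sigma_algebraType (coord_sets Z _))).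
  rewrite big_cons; apply: (@measurableI _ (g_sigma_algebraType (coord_sets Z (SS (j :: t))))).
    apply: (sub_sigma_coord _ (sF j _)); last by apply: ts; rewrite mem_head.
    by move=> i Si; exists j => //; rewrite mem_head.
  have ts' : {subset t <= s} by move=> k kt; apply: ts; rewrite inE kt orbT.
  apply: (sub_sigma_coord _ (ih ts')).
  by move=> i [k kt Si]; exists k => //; rewrite inE kt orbT.
suff: forall t : seq J, {subset t <= s} -> uniq t ->
    P (\big[setI/setT]_(j <- t) F j) = \prod_(j <- t) P (F j) by apply.
elim => [_ _|j t ih ts /= /andP[jt ut]]; first by rewrite !big_nil probability_setT.
have ts' : {subset t <= s} by move=> k kt; apply: ts; rewrite inE kt orbT.
have js : j \in s by apply: ts; rewrite mem_head.
rewrite !big_cons (@indep_sigma _ _ _ _ _ P _ D _ mZ indP (S j) (SS t)) ?ih//.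
- exact: SD.
- by move=> i [k /ts' ks Si]; exact: SD Si.
- apply/seteqP; split => // i [Sji [k kt Ski]].
  have <- : S j `&` S k = set0.
    by apply: disj => //; [exact: ts'|apply: contraNN jt => /eqP ->].
  by split.
- exact: sF.
- exact: sFS.
Qed.

End independent_events.

(** * Votes *)

Definition alarms (E : Type) (R : realType) (K : nat) (f g : E -> R) (h : R)
    (x : obs_array K E) (t : nat) : {set 'I_K} :=
  [set k | h%:E <= cusum f g x t k].

Section order_statistics.
Context (R : realType) (K : nat).

Lemma nth_sorted_ge (s : seq (\bar R)) (h : \bar R) i : sorted <=%O s ->
  (i < size s)%N -> (h <= nth -oo s i) = (size s - i <= count (<=%O h) s)%N.
Proof.
move=> ss si; apply/idP/idP => [hi|].
  rewrite -{2}(cat_take_drop i s) count_cat.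
  have -> : count (<=%O h) (drop i s) = (size s - i)%N.
    rewrite -size_drop; apply/eqP; rewrite -all_count; apply/(all_nthP -oo) => j.
    rewrite size_drop => ji; rewrite nth_drop (le_trans hi)//.
    by apply: (sorted_leq_nth le_trans le_refl) => //; rewrite ?inE ?leq_addr// -ltn_subRL.
  exact: leq_addl.
apply: contraLR; rewrite -!ltNge => hi; rewrite -ltnNge.
rewrite -[X in count _ X](cat_take_drop i.+1 s) count_cat.
have -> : count (<=%O h) (take i.+1 s) = 0%N.
  apply/eqP; rewrite -leqn0 leqNgt -has_count -all_predC; apply/(all_nthP -oo) => j.
  rewrite size_take => jt; have ji : (j <= i)%N by move: jt; case: ifP => //; lia.
  rewrite nth_take// /= -ltNge (le_lt_trans _ hi)//.
  by apply: (sorted_leq_nth le_trans le_refl) => //; rewrite ?inE// (leq_ltn_trans ji).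
rewrite add0n (leq_ltn_trans (count_size _ _))// size_drop.
exact: ltn_sub2l.
Qed.

(** The (#|A| - L + 1)-th smallest value is the L-th largest. *)
Lemma order_stat_ge (A : {set 'I_K}) (y : 'I_K -> \bar R) (h : \bar R) L :
  (0 < L <= #|A|)%N ->
  (h <= order_stat A y (#|A| - L + 1)) = (L <= #|[set k in A | (h <= y k)%E]|)%N.
Proof.
move=> /andP[L0 LA]; rewrite /order_stat addn1/= nth_sorted_ge; last 2 first.
- by apply: sort_sorted; exact: le_total.
- by rewrite size_sort size_map -cardE ltn_subrL L0 (leq_trans L0).
rewrite size_sort size_map -cardE subKn//; congr (_ <= _)%N.
rewrite (permP (permEl (perm_sort _ _))) count_map -size_filter cardE; apply/perm_size/uniq_perm.
- by rewrite filter_uniq// enum_uniq.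
- exact: enum_uniq.
- by move=> k; rewrite mem_filter /= !mem_enum [RHS]inE andbC.
Qed.

End order_statistics.

Section voting.
Context (E : Type) (R : realType) (K : nat) (f g : E -> R).
Implicit Types (x : obs_array K E) (A N : {set 'I_K}).

Lemma cusum_ge0 x t k : 0 <= cusum f g x t k.
Proof. by case: t => [|t] //=; rewrite le_max lexx orbT. Qed.

Lemma voting_timeE A L h x : (0 < L <= #|A|)%N ->
  voting_time f g A L h x = ereal_inf [set t%:R%:E | t in [set t : nat |
    (0 < t)%N /\ (L <= #|A :&: alarms f g h x t|)%N]].
Proof.
move=> hL; rewrite /voting_time; congr (ereal_inf (image _ _)); apply/funext => t /=.
rewrite order_stat_ge// (_ : [set _ in A | _] = A :&: alarms f g h x t)//.
by apply/setP => k; rewrite !inE.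
Qed.

(** The infimum of a set of integers is attained, so that the first vote is no
    later than n exactly when some vote takes place up to n. *)
Lemma voting_time_le A L h x n : (0 < L <= #|A|)%N ->
  (voting_time f g A L h x <= n%:R%:E) <->
  (exists t, (0 < t <= n)%N /\ (L <= #|A :&: alarms f g h x t|)%N).
Proof.
move=> hL; rewrite voting_timeE//; split => [Tn|[t [/andP[t0 tn] vt]]]; last first.
  apply: (@le_trans _ _ t%:R%:E); last by rewrite lee_fin ler_nat.
  by apply: ereal_inf_lbound; exists t.
have : ereal_inf [set t%:R%:E | t in [set t : nat |
    (0 < t)%N /\ (L <= #|A :&: alarms f g h x t|)%N]] < (n%:R + 1 : R)%:E.
  by rewrite (le_lt_trans Tn)// lte_fin ltrDl.
case/ereal_inf_lt => _ [t [t0 vt] <-].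
by rewrite lte_fin natr1 ltr_nat ltnS => tn; exists t; rewrite t0.
Qed.

Lemma voting_time_values A L h x : (0 < L <= #|A|)%N ->
  voting_time f g A L h x = +oo \/
  exists2 n : nat, (0 < n)%N & voting_time f g A L h x = n%:R%:E.
Proof.
move=> hL; have [[t [t0 vt]]|nv] :=
    pselect (exists t, (0 < t)%N /\ (L <= #|A :&: alarms f g h x t|)%N); last first.
  left; rewrite voting_timeE// (_ : [set _ | _ in _] = set0) ?ereal_inf0//.
  by rewrite -subset0 => y [t vt _]; apply: nv; exists t.
right; pose v n := (0 < n)%N && (L <= #|A :&: alarms f g h x n|)%N.
have ev : exists n, v n by exists t; rewrite /v t0.
case: (ex_minnP ev) => n /andP[n0 vn] nmin; exists n => //.
apply/eqP; rewrite eq_le; apply/andP; split.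
  by apply/voting_time_le => //; exists n; rewrite n0 leqnn.
rewrite voting_timeE//; apply: le_ereal_inf_tmp => _ [m [m0 vm] <-].
by rewrite lee_fin ler_nat; apply: nmin; rewrite /v m0.
Qed.

Lemma voting_time_ge0 A L h x : (0 < L <= #|A|)%N -> 0 <= voting_time f g A L h x.
Proof. by move=> hL; have [->|[n _ ->]] := voting_time_values h x hL. Qed.

Lemma voting_time_gt A L h x n : (0 < L <= #|A|)%N ->
  (forall t, (0 < t <= n)%N -> (#|A :&: alarms f g h x t| < L)%N) ->
  n%:R%:E <= voting_time f g A L h x.
Proof.
move=> hL nv; rewrite leNgt; apply/negP => Tn.
have /voting_time_le - /(_ hL)[t [tn vt]] := ltW Tn.
by have := nv t tn; rewrite ltnNge vt.
Qed.

(** The statistic of an honest sensor only reads its own observations, which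
    no strategy can alter. *)
Lemma cusum_observed N pi x t k : k \in N ->
  cusum f g (observed N pi x) t k = cusum f g x t k.
Proof. by move=> kN; elim: t => //= t ->; rewrite /observed kN. Qed.

(** Among L votes at most M come from corrupt sensors. *)
Lemma voting_time_observed N pi x h L M : #|N| = (K - M)%N -> (M < L)%N -> (L <= K)%N ->
  voting_time f g N (L - M) h x <=
  voting_time f g [set: 'I_K]%SET L h (observed N pi x).
Proof.
move=> cN ML LK.
have hL : (0 < L <= #|[set: 'I_K]%SET|)%N by rewrite cardsT card_ord LK; lia.
have hN : (0 < L - M <= #|N|)%N by rewrite cN; lia.
have [->|[n n0 Tn]] := voting_time_values h (observed N pi x) hL; first exact: leey.
have /voting_time_le - /(_ hL)[t [tn vt]] :
  voting_time f g [set: 'I_K]%SET L h (observed N pi x) <= n%:R%:E by rewrite Tn.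
rewrite Tn; apply/voting_time_le => //; exists t; split => //.
have -> : N :&: alarms f g h x t = N :&: alarms f g h (observed N pi x) t.
  by apply/setP => k; rewrite !inE; case: (boolP (k \in N)) => //= kN; rewrite cusum_observed.
set Y := alarms _ _ _ _ _ in vt *; rewrite finset.setTI in vt.
have cC : #|~: N| = M by rewrite cardsCs finset.setCK card_ord cN; lia.
have := cardsID N Y; have := subset_leq_card (finset.subsetIr Y (~: N)).
by rewrite cC -finset.setDE finset.setIC; lia.
Qed.

End voting.

Section measurability_cusum.
Context (d dU : measure_display) (E : measurableType d) (U : measurableType dU).
Context (R : realType) (K : nat) (f g : E -> R).
Hypothesis mllr : measurable_fun setT (llr f g).
Context (y : U -> obs_array K E).

Lemma measurable_cusum t k :
  (forall s, (0 < s <= t)%N -> measurable_fun setT (fun u => y u s k)) ->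
  measurable_fun setT (fun u => cusum f g (y u) t k).
Proof.
elim: t => [|t ih] my; first exact: measurable_cst.
apply: measurable_maxe => //; apply: emeasurable_funD.
  by apply: ih => s /andP[s0 st]; apply: my; rewrite s0 (leq_trans st).
by apply: (measurableT_comp mllr); apply: my; rewrite leqnn.
Qed.

Lemma measurable_alarm h t k :
  (forall s, (0 < s <= t)%N -> measurable_fun setT (fun u => y u s k)) ->
  measurable [set u | h%:E <= cusum f g (y u) t k].
Proof.
by move=> /measurable_cusum mc; rewrite -[X in measurable X]setTI; exact: emeasurable_fun_c_infty.
Qed.

(** The hypothesis bears on the coordinates up to t in A only, so that the
    lemma also applies when U carries the sigma-algebra of a history. *)
Lemma measurable_vote (A : {set 'I_K}) L h t :
  (forall s k, (0 < s <= t)%N -> k \in A -> measurable_fun setT (fun u => y u s k)) ->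
  measurable [set u | (L <= #|A :&: alarms f g h (y u) t|)%N].
Proof.
move=> my.
(* At least L sensors vote iff some finite set of at least L sensors does. *)
have -> : [set u | (L <= #|A :&: alarms f g h (y u) t|)%N] =
  \bigcup_(C in [set C : {set 'I_K} | (L <= #|C|)%N /\ C \subset A])
   \bigcap_(k in [set k | k \in C]) [set u | h%:E <= cusum f g (y u) t k].
  apply/seteqP; split => [u /= Lu|u [C /= [LC /fintype.subsetP CA] uC]].
    exists (A :&: alarms f g h (y u) t); first by split => //; exact: finset.subsetIl.
    by move=> k /=; rewrite !inE => /andP[].
  apply: (leq_trans LC); apply/subset_leq_card/fintype.subsetP => k kC.
  by rewrite !inE (CA _ kC)/=; exact: uC.
apply: fin_bigcup_measurable => //= C [_ /fintype.subsetP CA].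
apply: fin_bigcap_measurable => //= k kC; apply: measurable_alarm => s st.
by apply: my => //; exact: CA.
Qed.

Lemma measurable_voting_time (A : {set 'I_K}) L h : (0 < L <= #|A|)%N ->
  (forall s k, (0 < s)%N -> k \in A -> measurable_fun setT (fun u => y u s k)) ->
  measurable_fun setT (fun u => voting_time f g A L h (y u)).
Proof.
move=> hL my.
pose F t u : \bar R := if (0 < t)%N && (L <= #|A :&: alarms f g h (y u) t|)%N then t%:R%:E else +oo.
have -> : (fun u => voting_time f g A L h (y u)) = (fun u => einfs (F ^~ u) 0%N).
  apply/funext => u; rewrite voting_timeE// /einfs; apply/eqP; rewrite eq_le; apply/andP; split.
    apply: le_ereal_inf_tmp => _ [t _ <-]; rewrite /F; case: ifP => [/andP[t0 vt]|_]; last exact: leey.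
    by apply: ereal_inf_lbound; exists t.
  apply: le_ereal_inf_tmp => _ [t [t0 vt] <-]; apply: ereal_inf_lbound; exists t => //.
  by rewrite /F t0 vt.
apply: measurable_fun_einfs => t; rewrite /F; apply: measurable_fun_ifT => //.
case: ltnP => t0 /=; last exact: measurable_cst.
apply: (measurable_fun_bool true) => //.
rewrite setTI; have -> : (fun u => (L <= #|A :&: alarms f g h (y u) t|)%N) @^-1` [set true] =
  [set u | (L <= #|A :&: alarms f g h (y u) t|)%N] by apply/seteqP; split.
by apply: measurable_vote => s k /andP[s0 _]; exact: my.
Qed.

End measurability_cusum.

(** * Paths of the CUSUM statistic *)

Section paths.
Context (E : Type) (R : realType) (K : nat) (f g : E -> R).
Implicit Types (x : obs_array K E).
Local Notation r := (rllr f g).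

(** Time s is excluded: if s is the change time, these are the first n terms
    after the change. *)
Definition wsum x (k : 'I_K) (s n : nat) : R := (\sum_(t <- iota s n) r (x t.+1 k))%R.

Lemma wsum0 x k s : wsum x k s 0 = 0%R.
Proof. by rewrite /wsum big_nil. Qed.

Lemma wsumD x k s n1 n2 : wsum x k s (n1 + n2) = (wsum x k s n1 + wsum x k (s + n1) n2)%R.
Proof. by rewrite /wsum iotaD big_cat. Qed.

Lemma wsumS x k s n : wsum x k s n.+1 = (wsum x k s n + r (x (s + n).+1 k))%R.
Proof. by rewrite -addn1 wsumD {2}/wsum /= big_seq1. Qed.

(** On these paths the ratios at times s+1 .. s+n are finite and [wsum] is
    their genuine sum. *)
Definition block_positive x (k : 'I_K) (s n : nat) : Prop :=
  forall t, (s <= t < s + n)%N -> both_positive f g (x t.+1 k).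

(** Clipping at 0 only increases the statistic. *)
Lemma cusum_ge_wsum x k s n : block_positive x k s n ->
  (wsum x k s n)%:E <= cusum f g x (s + n) k.
Proof.
elim: n => [_|n ih gd]; first by rewrite wsum0; exact: cusum_ge0.
rewrite addnS /= le_max wsumS EFinD; apply/orP; left.
have gn : both_positive f g (x (s + n).+1 k) by apply: gd; rewrite leq_addr addnS ltnS/=.
rewrite llr_positive// -rllr_positive// leeD2r//; apply: ih => t /andP[st tn]; apply: gd.
by rewrite st addnS ltnS ltnW.
Qed.

(** s is the last time at which the statistic was clipped to 0. *)
Lemma cusum_wsum x k n : block_positive x k 0 n ->
  exists2 s, (s <= n)%N & cusum f g x n k = (wsum x k s (n - s))%:E.
Proof.
elim: n => [_|n ih gd]; first by exists 0%N => //; rewrite wsum0.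
have [|s sn e] := ih; first by move=> t /andP[t0 tn]; apply: gd; rewrite t0/= ltnW.
have gn : both_positive f g (x n.+1 k) by apply: gd; rewrite /= ltnS.
rewrite /= e llr_positive// -rllr_positive// -EFinD.
have -> : (wsum x k s (n - s) + r (x n.+1 k) = wsum x k s (n.+1 - s))%R.
  by rewrite subSn// wsumS subnKC.
rewrite -EFin_max; case: (leP (wsum x k s (n.+1 - s)) 0%R) => h.
  by exists n.+1 => //; rewrite subnn wsum0.
by exists s => //; exact: leqW.
Qed.

(** The recursion of the exponential of a * cusum: products replace sums and
    the clipping level is 1 = exp 0. *)
Fixpoint ucusum (a : R) x t (k : 'I_K) : R :=
  if t is s.+1 then Num.max (ucusum a x s k * tilt f g a (x s.+1 k))%R 1%R else 1%R.

Lemma ucusum_ge1 a x t k : (1 <= ucusum a x t k)%R.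
Proof. by case: t => [|t] //=; rewrite le_max lexx orbT. Qed.

Hypothesis g0 : forall z, (0 <= g z)%R.

(** A degenerate observation with f > 0 has g = 0; it sends the statistic to 0,
    so that the statistic stays finite. *)
Lemma cusum_ucusum (a : R) x t k : (0 <= a)%R ->
  (forall s, (s < t)%N -> (0 < f (x s.+1 k))%R) ->
  exists2 c : R, cusum f g x t k = c%:E & (expR (a * c) <= ucusum a x t k)%R.
Proof.
move=> a0; elim: t => [_|t ih fp]; first by exists 0%R => //; rewrite mulr0 expR0.
have [|c e ec] := ih; first by move=> s st; apply: fp; exact: ltnW.
have [gt|bt] := boolP (both_positive f g (x t.+1 k)); last first.
  exists 0%R; last by rewrite mulr0 expR0 ucusum_ge1.
  by rewrite /= e (llr_fE g0 (fp t (ltnSn t)) bt) addeNy (max_idPr (leNye _)).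
exists (Num.max (c + r (x t.+1 k)) 0)%R.
  by rewrite /= e llr_positive// -rllr_positive// -EFinD EFin_max.
rewrite /= /tilt gt maxr_pMr// mulr0 mulrDr.
have homo : {homo @expR R : u v / (u <= v)%R} by move=> u v; rewrite ler_expR.
case: (leP (a * c + a * r (x t.+1 k))%R 0%R) => _.
  by rewrite expR0 le_max lexx orbT.
by rewrite le_max expRD ler_wpM2r ?expR_ge0.
Qed.

End paths.

(** * Expectations of hitting times *)

Section hitting.
Context (d : measure_display) (Om : measurableType d) (R : realType).
Context (P : probability Om R).

Lemma measure_bigU_le (J : eqType) (s : seq J) (F : J -> set Om) (c : R) :
  (forall j, j \in s -> measurable (F j)) ->
  (forall j, j \in s -> P (F j) <= c%:E) ->
  P (\big[setU/set0]_(j <- s) F j) <= ((size s)%:R * c)%:E.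
Proof.
elim: s => [_ _|j s ih mF Fc]; first by rewrite big_nil measure0 mul0r.
have mF' k : k \in s -> measurable (F k) by move=> ks; apply: mF; rewrite inE ks orbT.
rewrite big_cons; apply: (le_trans (measureU2 _ _ _)).
- by apply: mF; rewrite mem_head.
- by rewrite big_seq; apply: bigsetU_measurable.
rewrite -[(size (j :: s))]/((size s).+1) -natr1 mulrDl mul1r [X in _ <= X%:E]addrC EFinD; apply: leeD.
  by apply: Fc; rewrite mem_head.
by apply: ih => // k ks; apply: Fc; rewrite inE ks orbT.
Qed.

(** If n is the first index with b n false, then b holds at 0 .. n-1, and the
    sum is at least n; if there is none, then the sum is infinite. *)
Lemma hitting_le (T : \bar R) (c : nat) (b : nat -> bool) : (0 < c)%N ->
  (forall n, ~~ b n -> T <= (c * n)%:R%:E) ->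
  T <= c%:R%:E * \sum_(n <oo) (b n)%:R%:E.
Proof.
move=> c0 Tb.
have b0 n : 0 <= (b n)%:R%:E :> \bar R by rewrite lee_fin ler0n.
have [enb|ab] := pselect (exists n, ~~ b n); last first.
  have -> : \sum_(n <oo) (b n)%:R%:E = +oo :> \bar R.
    apply/eqyP => e e0; apply: (@le_trans _ _ (\sum_(0 <= n < (Num.truncn e).+1) (b n)%:R%:E)).
      rewrite (eq_bigr (fun=> 1%:E)); last first.
        by move=> n _; case: (boolP (b n)) => // nb; exfalso; apply: ab; exists n.
      rewrite sumEFin lee_fin big_const_nat subn0 iter_addr_0.
      by apply/ltW; exact: truncnS_gt.
    exact: nneseries_lim_ge.
  by rewrite gt0_muley ?leey// lte_fin ltr0n.
case: (ex_minnP enb) => n nb nmin.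
apply: le_trans (Tb n nb) _; rewrite natrM EFinM lee_wpmul2l ?lee_fin ?ler0n//.
apply: (@le_trans _ _ (\sum_(0 <= j < n) (b j)%:R%:E)); last exact: nneseries_lim_ge.
rewrite big_nat (eq_bigr (fun=> 1%:E)); last first.
  move=> j /andP[_ jn]; case: (boolP (b j)) => // jb.
  by have := nmin j jb; rewrite leqNgt jn.
by rewrite -big_nat sumEFin lee_fin big_const_nat subn0 iter_addr_0.
Qed.

(** The tail-sum formula E[T] <= c sum_n P(T > c n), localized on A. *)
Lemma integral_hitting_le (T : Om -> \bar R) (A : set Om) (D : nat -> set Om) c (b : R) :
  measurable A -> measurable_fun setT T -> (forall w, 0 <= T w) ->
  (forall n, measurable (D n)) -> (0 < c)%N ->
  (forall n w, ~ D n w -> T w <= (c * n)%:R%:E) ->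
  (forall j, \sum_(0 <= n < j) P (A `&` D n) <= b%:E) ->
  \int[P]_(w in A) T w <= (c%:R * b)%:E.
Proof.
move=> mA mT T0 mD c0 TD sb.
have mi n : measurable_fun A (fun w => (\1_(D n) w)%:E : \bar R).
  by apply: measurable_funTS; apply/measurable_EFinP; exact: measurable_indic.
have i0 n w : 0 <= (\1_(D n) w)%:E :> \bar R by rewrite lee_fin.
apply: (@le_trans _ _ (\int[P]_(w in A) (c%:R%:E * \sum_(n <oo) (\1_(D n) w)%:E))).
  apply: ge0_le_integral => //.
  - exact: measurable_funTS.
  - by apply: emeasurable_funM => //; apply: ge0_emeasurable_sum.
  - move=> w Aw; apply: hitting_le => // n; rewrite notin_setE; exact: TD.
rewrite ge0_integralZl//; last 2 first.
- by apply: ge0_emeasurable_sum.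
- by move=> w _; apply: nneseries_ge0.
rewrite EFinM lee_wpmul2l ?lee_fin ?ler0n// integral_nneseries//.
apply: lime_le; first by apply: is_cvg_nneseries => n _ _; apply: integral_ge0.
apply: nearW => j; apply: le_trans (sb j); apply: lee_sum => n _.
by rewrite integral_indic// setIC.
Qed.

(** The inequality is tested on the events A n of G where the conditional
    expectation exceeds c + 1 / (n + 1), which it forces to be null. *)
Lemma ess_sup_cond_le (G : set (set Om)) (Y Z : Om -> \bar R) (c : R) :
  (0 <= c)%R -> G `<=` measurable -> is_cond_expectation P G Y Z ->
  (forall A, G A -> \int[P]_(w in A) Y w <= c%:E * P A) ->
  ess_sup P Z <= c%:E.
Proof.
move=> c0 Gm [Z0 mZ eZ] hY; apply/ess_supP.
have mZT : measurable_fun setT Z by move=> _ A mA; rewrite setTI; apply: Gm; exact: mZ.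
pose A n := [set w | (c + n.+1%:R^-1)%:E <= Z w].
have AE n : A n = Z @^-1` `[(c + n.+1%:R^-1)%:E, +oo[.
  by apply/seteqP; split => w; rewrite /A/= in_itv/= andbT.
have GA n : G (A n) by rewrite AE; apply: mZ; exact: emeasurable_itv.
have PA n : P (A n) = 0.
  have mA := Gm _ (GA n).
  have fP : P (A n) \is a fin_num by exact: fin_num_measure.
  have : (c + n.+1%:R^-1)%:E * P (A n) <= c%:E * P (A n).
    apply: le_trans (hY _ (GA n)); rewrite -(eZ _ (GA n)) -integral_cst//.
    apply: ge0_le_integral => //; last exact: measurable_funTS.
    by move=> w _; rewrite lee_fin addr_ge0// invr_ge0.
  rewrite -(fineK fP) -!EFinM lee_fin mulrDl gerDl pmulr_rle0// => p0.
  by congr EFin; apply/eqP; rewrite eq_le p0 fine_ge0.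
have nA : P.-negligible (\bigcup_n A n).
  apply: negligible_bigcup => n; apply/negligibleP; last exact: PA.
  exact: Gm.
apply: negligibleS nA => w /= /negP; rewrite -ltNge => cZ.
have [n cn] : exists n, (c + n.+1%:R^-1)%:E <= Z w.
  case: (Z w) cZ => [z| |] //; last by exists 0%N; exact: leey.
  rewrite lte_fin -subr_gt0 => cz; exists (Num.truncn (z - c)^-1).
  rewrite lee_fin -lerBrDl -[X in (_ <= X)%R]invrK lef_pV2 ?posrE ?invr_gt0 ?ltr0n//.
  exact/ltW/truncnS_gt.
by exists n.
Qed.

End hitting.

Lemma geometric_sum_le (R : realType) (q : R) j : (0 <= q < 1)%R ->
  (\sum_(0 <= n < j) q ^+ n <= (1 - q)^-1)%R.
Proof.
move=> /andP[q0 q1]; rewrite big_mkord -[X in (_ <= X)%R]mul1r ler_pdivlMr ?subr_gt0//.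
have := subrX1 q j; have : (0 <= q ^+ j)%R by exact: exprn_ge0.
rewrite mulrC; set S := (\sum_(_ < _) _)%R; lra.
Qed.

(** Bounds the contribution of the indices n < n0, at which probabilities are
    only bounded by 1. *)
Lemma count_sum_le (R : realType) n0 j :
  (\sum_(0 <= n < j) ((n < n0)%N%:R : R) <= n0%:R)%R.
Proof.
rewrite -natr_sum ler_nat; elim: j => [|j ih]; first by rewrite big_geq.
suff : (\sum_(0 <= i < j.+1) (i < n0) <= minn j.+1 n0)%N by lia.
elim: j {ih} => [|j ih]; first by rewrite big_nat1; lia.
by rewrite big_nat_recr//=; move: ih; set S := (\sum_(_ <= _ < _) _)%N; lia.
Qed.

(** * The honest observations *)

Section honest_observations.
Context (R : realType) (d dO : measure_display).
Context (E : measurableType d) (Om : measurableType dO).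
Context (lambda : {sigma_finite_measure set E -> \bar R}) (f g : E -> R).
Hypotheses (hf : is_density lambda f) (hg : is_density lambda g).
Hypothesis hI : 0 < kullback lambda f g < +oo.
Context (K : nat) (N : {set 'I_K}) (X : Om -> obs_array K E).

Local Notation kl := (fine (kullback lambda f g)).
(** The array as a family over pairs (time, sensor); the honest entries, at
    times t >= 1, have indices in [honest_index N]. *)
Definition obs (X : Om -> obs_array K E) (i : nat * 'I_K) (w : Om) : E := X w i.1 i.2.
Local Notation Z := (obs X).
Definition honest_index (N : {set 'I_K}) : set (nat * 'I_K) := [set i | (0 < i.1)%N /\ i.2 \in N].
Local Notation D := (honest_index N).
Definition past (N : {set 'I_K}) (t : nat) : set (nat * 'I_K) := [set i | (0 < i.1 <= t)%N /\ i.2 \in N].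
(** The range of times is that of [wsum], see [llsum_blk]. *)
Definition blk (k : 'I_K) (s n : nat) : seq (nat * 'I_K) := [seq (t.+1, k) | t <- iota s n].

Lemma past_honest t : past N t `<=` D.
Proof. by move=> i [/andP[i0 _] iN]; split. Qed.

Lemma blk_uniq k s n : uniq (blk k s n).
Proof. by rewrite map_inj_uniq ?iota_uniq// => a b []. Qed.

Lemma blk_size k s n : size (blk k s n) = n.
Proof. by rewrite size_map size_iota. Qed.

Lemma mem_blk k s n i : i \in blk k s n -> (s < i.1 <= s + n)%N /\ i.2 = k.
Proof. by move=> /mapP[t]; rewrite mem_iota => ts ->. Qed.

Lemma blk_honest k s n : k \in N -> forall i, i \in blk k s n -> D i.
Proof. by move=> kN i /mem_blk[/andP[si _] ik]; split; [exact: leq_ltn_trans si|rewrite ik]. Qed.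
Arguments blk_honest {k s n} kN i ib.

Lemma llsum_blk k s n w : llsum f g Z (blk k s n) w = wsum f g (X w) k s n.
Proof. by rewrite /llsum /blk big_map. Qed.

Section honest.
Context (Q : probability Om R) (p : nat -> 'I_K -> E -> R).
Hypothesis hQ : honest_law lambda N X Q p.

Lemma honest_measurable i : D i -> measurable_fun setT (Z i).
Proof. by case: hQ => mX _ _ [i0 iN]; exact: mX. Qed.

Lemma honest_indep : mutually_independent Q D Z.
Proof. by case: hQ. Qed.

Lemma honest_density i : D i -> has_density lambda Q (Z i) (p i.1 i.2).
Proof. by case: hQ => _ hd _ [i0 iN]; exact: hd. Qed.

End honest.

Hypothesis mZ : forall i, D i -> measurable_fun setT (Z i).

Section strategies.
Context (pi : nat -> obs_array K E -> 'I_K -> E).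
Hypothesis hpi : is_strategy N pi.

(** A report of a corrupt sensor is a measurable function of the honest
    observations up to the same time, so that it adds no information. *)
Lemma history_observed t :
  history [set: 'I_K] (fun w => observed N pi (X w)) t `<=`
  <<s coord_sets Z (past N t) >>.
Proof.
apply: smallest_sub; first exact: smallest_sigma_algebra.
move=> _ [s [k [C [/andP[s0 st] _ mC ->]]]].
have [kN|kN] := boolP (k \in N).
  have -> : (fun u => observed N pi (X u) s k) = Z (s, k).
    by apply/funext => w; rewrite /observed kN.
  by apply: sub_sigma_algebra; exists (s, k), C; split => //=; split => //; rewrite s0.
have -> : (fun u => observed N pi (X u) s k) @^-1` C = X @^-1` ((fun x => pi s x k) @^-1` C).
  by apply/seteqP; split => w /=; rewrite /observed (negbTE kN).
have [_ /(_ C mC)] := hpi s0 kN.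
(* The sets whose preimage under X is in the target sigma-algebra form a
   sigma-algebra containing the generators of the history of X. *)
pose G := [set A : set (obs_array K E) | <<s coord_sets Z (past N t) >> (X @^-1` A)].
have sG : sigma_algebra setT G.
  have [h0 hC hU] := smallest_sigma_algebra setT (coord_sets Z (past N t)).
  split => [|A GA|F GF]; rewrite /G/=.
  - by rewrite preimage_set0.
  - have -> : X @^-1` (setT `\` A) = setT `\` X @^-1` A by [].
    exact: hC.
  - by rewrite preimage_bigcup; exact: hU.
suff : history N (fun x : obs_array K E => x) s `<=` G by apply.
apply: smallest_sub => // _ [s' [k' [A [/andP[s'0 s's] k'N mA ->]]]].
apply: sub_sigma_algebra; exists (s', k'), A; split => //; split => //=.
by rewrite s'0 (leq_trans s's).
Qed.

Lemma measurable_observed s k : (0 < s)%N ->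
  measurable_fun setT (fun w => observed N pi (X w) s k).
Proof.
move=> s0 _ A mA; rewrite setTI.
apply: (sigma_coord_measurable (S := past N s) (Z := Z)).
  by move=> i /past_honest/mZ.
by apply: history_observed; apply: sub_sigma_algebra; exists s, k, A; rewrite s0 leqnn finset.in_setT.
Qed.

End strategies.

Lemma measurable_badZ i : D i -> measurable [set w | ~~ both_positive f g (Z i w)].
Proof.
by move=> /mZ mi; have := mi measurableT _ (measurable_bad hf hg); rewrite setTI.
Qed.

(** The event that a degenerate observation occurs along s; it is null after
    the change ([bad_null]). *)
Definition bad (s : seq (nat * 'I_K)) : set Om :=
  \big[setU/set0]_(i <- s) [set w | ~~ both_positive f g (Z i w)].

Lemma block_positive_blk k s n w : ~ bad (blk k s n) w -> block_positive f g (X w) k s n.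
Proof.
rewrite /bad -bigcup_seq => nb t tn; apply/negPn/negP => nt; apply: nb.
by exists (t.+1, k) => //=; apply/mapP; exists t; rewrite ?mem_iota.
Qed.

Lemma coord_bad (S : set (nat * 'I_K)) s : (forall i, i \in s -> S i) ->
  <<s coord_sets Z S >> (bad s).
Proof.
move=> sS; rewrite /bad big_seq.
apply: (@bigsetU_measurable _ (g_sigma_algebraType (coord_sets Z S))) => i si.
apply: sub_sigma_algebra; exists i, [set x | ~~ both_positive f g x]; split => //; first exact: sS.
exact: measurable_bad hf hg.
Qed.

Lemma bad_measurable s : (forall i, i \in s -> D i) -> measurable (bad s).
Proof. by move=> sD; apply: (sigma_coord_measurable mZ); exact: coord_bad. Qed.

Lemma bad_null (Q : probability Om R) s : (forall i, i \in s -> D i) ->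
  (forall i, i \in s -> has_density lambda Q (Z i) g) -> Q (bad s) = 0.
Proof.
move=> sD sg; apply/eqP; rewrite -measure_le0 -[leRHS](_ : ((size s)%:R * 0)%:E = 0); last by rewrite mulr0.
apply: measure_bigU_le => i si; first by apply: measurable_badZ; exact: sD.
by rewrite (post_change_positive hf hg hI)//; exact: sg.
Qed.

Lemma low_measurable c s : (forall i, i \in s -> D i) ->
  measurable [set w | (llsum f g Z s w <= c)%R].
Proof.
by move=> sD; apply: (sigma_coord_measurable mZ); exact: (coord_llsum_le hf hg c sD).
Qed.

(** * The delay is at most (1 + eps) h / I + C *)

Section delay_upper_bound.
Context (B : {set 'I_K}) (P : nat -> probability Om R) (L : nat).
Hypotheses (hB : B \subset N) (L0 : (0 < L)%N) (LB : (L <= #|B|)%N).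
Hypothesis hP : forall nu : nat, honest_law lambda N X (P nu) (change_density f g B nu).

Let BN k : k \in B -> k \in N. Proof. exact: (fintype.subsetP hB). Qed.

(** The block blk k nu n starts just after the change time nu. *)
Lemma post_change_density nu k n : k \in B ->
  forall i, i \in blk k nu n -> has_density lambda (P nu) (Z i) g.
Proof.
move=> kB i ib; have Di := blk_honest (BN kB) i ib.
have := honest_density (hP nu) Di; have [/andP[ni _] ->] := mem_blk ib.
by rewrite /change_density kB ni.
Qed.
Arguments post_change_density nu {k n} kB i ib.

(** The rule has stopped at nu + n unless some sensor of B has a sum of n
    log-likelihood ratios below h (event [Dn]).  On an event A of the past this
    has probability at most #|B| q ^ n P(A) once n >= n0, with
    n0 of order (1 + eps) h / I, and summing over n bounds the conditional
    delay by n0 + #|B| / (1 - q). *)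
Lemma delay_upper (eps : R) : (0 < eps)%R -> exists C : R, forall h : R, (0 < h)%R ->
  worst_delay N X P (voting_time f g [set: 'I_K]%SET L h) <=
  ((1 + eps) * h / kl + C)%:E.
Proof.
move=> eps0; have I0 : (0 < kl)%R by exact: kullback_gt0 hI.
(* del makes the rate kl - 2 del equal to kl / (1 + eps): one del is lost in
   the exponential moment, the other one is the exponential rate. *)
set del : R := (kl * eps / (2 * (1 + eps)))%R.
have del0 : (0 < del)%R by rewrite /del !divr_gt0 ?mulr_gt0//; lra.
have klE : (kl = (1 + eps) * (kl - 2 * del))%R.
  by rewrite /del; field; lra.
have [th /andP[th0 _] mgf] := chernoff hf hg hI del0 (ltr01 : (0 < 1 :> R)%R).
set q := expR (- (th * del))%R.
have q01 : (0 <= q < 1)%R by rewrite expR_ge0 expR_lt1 oppr_lt0 mulr_gt0.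
have q0 : (0 <= q)%R by case/andP: q01.
exists (1 + #|B|%:R * (1 - q)^-1)%R => h h0.
set C : R := (1 + #|B|%:R * (1 - q)^-1)%R.
have c0 : (0 <= (1 + eps) * h / kl)%R by rewrite divr_ge0 ?mulr_ge0 ?ltW//; lra.
have C0 : (0 <= C)%R.
  by rewrite addr_ge0// mulr_ge0// invr_ge0 subr_ge0 ltW//; case/andP: q01.
apply: ge_ereal_sup => _ [nu [pi [Y [hpi hY ->]]]].
set G := history _ _ _ in hY.
have GS : G `<=` <<s coord_sets Z (past N nu) >> by exact: history_observed.
have Gm : G `<=` measurable.
  by move=> A /GS; apply: sigma_coord_measurable => i /past_honest/mZ.
apply: (ess_sup_cond_le (G := G)) hY _ => //; first by rewrite addr_ge0.
move=> A GA; have mA := Gm _ GA.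
pose low k n := [set w | (llsum f g Z (blk k nu n) w <= h)%R].
pose Dn n := \big[setU/set0]_(k <- enum B) (low k n `|` bad (blk k nu n)).
have mbad k n : k \in B -> measurable (bad (blk k nu n)).
  by move=> kB; apply: bad_measurable; exact: blk_honest (BN kB).
have mlow k n : k \in B -> measurable (low k n).
  by move=> kB; apply: low_measurable; exact: blk_honest (BN kB).
have mDn n : measurable (Dn n).
  rewrite /Dn big_seq; apply: bigsetU_measurable => k; rewrite mem_enum => kB.
  by apply: measurableU; [exact: mlow|exact: mbad].
have PAf : P nu A \is a fin_num by exact: fin_num_measure.
set pA := fine (P nu A); have pA0 : (0 <= pA)%R by exact: fine_ge0.
have [n0 n0le n0ge] : exists2 n0 : nat, (n0%:R <= (1 + eps) * h / kl + 1)%R &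
    forall n, (n0 <= n)%N -> ((1 + eps) * h / kl <= n%:R)%R.
  exists (Num.truncn ((1 + eps) * h / kl)%R).+1.
    by rewrite -natr1 lerD2r truncn_le.
  by move=> n; rewrite -(ler_nat R) => /(le_trans _); apply; exact/ltW/truncnS_gt.
have PDn n : P nu (A `&` Dn n) <= (pA * ((n < n0)%N%:R + #|B|%:R * q ^+ n))%:E.
  have [nn|nn] := ltnP n n0.
    apply: (@le_trans _ _ (P nu A)).
      by apply: le_measure; rewrite ?inE//; exact: measurableI.
    rewrite -(fineK PAf) lee_fin -/pA ler_peMr// lerDl mulr_ge0// exprn_ge0//.
  rewrite add0r mulrCA cardE /Dn big_distrr/=.
  apply: measure_bigU_le => k; rewrite mem_enum => kB.
    by apply: measurableI => //; apply: measurableU; [exact: mlow|exact: mbad].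
  rewrite setIUr; apply: (le_trans (measureU2 _ _ _)).
  - by apply: measurableI => //; exact: mlow.
  - by apply: measurableI => //; exact: mbad.
  rewrite [X in _ + X](_ : _ = 0) ?adde0; last first.
    apply/eqP; rewrite -measure_le0 -[leRHS](bad_null (s := blk k nu n) (blk_honest (BN kB)) (post_change_density nu kB)).
    apply: le_measure; rewrite ?inE//; last exact: mbad.
    by apply: measurableI => //; exact: mbad.
  apply: le_trans (llsum_lower_tail hf hg mZ (honest_indep (hP nu)) (blk_uniq _ _ _)
    (blk_honest (BN kB)) (post_change_density nu kB) th0 mgf h (@past_honest nu) _ (GS _ GA)) _.
    by move=> i /mem_blk[/andP[ni _] _] [/andP[_ /(leq_trans ni)]]; rewrite ltnn.
  rewrite -(fineK PAf) -EFinM lee_fin ler_wpM2l// blk_size /q -expRM_natl ler_expR.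
  have := n0ge n nn; rewrite ler_pdivrMr// [X in (_ <= _ * X)%R -> _](klE : kl = _) mulrCA ler_pM2l; last lra.
  move=> hn; have : (th * (h - n%:R * (kl - del)) <= th * (- n%:R * del))%R.
    by rewrite ler_pM2l//; move: hn; rewrite !mulrBr; lra.
  by rewrite !mulNr !mulrN mulrCA.
apply: (le_trans (integral_hitting_le (c := 1%N) (D := Dn)
   (b := (pA * ((1 + eps) * h / kl + C))%R) mA _ _ mDn _ _ _)) => //.
- apply: measurable_maxe => //; apply: emeasurable_funB => //.
  apply: (measurable_voting_time (measurable_llr hf hg)).
    by rewrite cardsT card_ord L0 (leq_trans LB)// -[leqRHS](card_ord K) max_card.
  by move=> s k s0 _; exact: measurable_observed.
- by move=> w; rewrite le_max lexx orbT.
- move=> n w nD; rewrite mul1n.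
  have wB k : k \in B -> (h < wsum f g (X w) k nu n)%R /\ block_positive f g (X w) k nu n.
    move=> kB; move: nD; rewrite /Dn -bigcup_seq => nD; split.
      rewrite -llsum_blk ltNge; apply/negP => hl; apply: nD.
      by exists k; rewrite /= ?mem_enum//; left.
    by apply: block_positive_blk => bk; apply: nD; exists k; rewrite /= ?mem_enum//; right.
  have n_gt0 : (0 < n)%N.
    rewrite lt0n; apply/eqP => n00; have /card_gt0P[k kB] : (0 < #|B|)%N by exact: leq_trans LB.
    by have [] := wB k kB; rewrite n00 wsum0 ltNge (ltW h0).
  rewrite ge_max lee_fin ler0n andbT leeBlDr// -EFinD -natrD.
  apply/voting_time_le; first by rewrite cardsT card_ord L0 (leq_trans LB)// -[leqRHS](card_ord K) max_card.
  exists (n + nu)%N; rewrite addn_gt0 n_gt0 leqnn; split => //.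
  apply: (leq_trans LB); apply/subset_leq_card/fintype.subsetP => k kB.
  rewrite !inE cusum_observed; last exact: BN.
  have [hk gk] := wB k kB; rewrite addnC; apply: le_trans (cusum_ge_wsum gk).
  by rewrite lee_fin ltW.
- move=> j; apply: (@le_trans _ _ (\sum_(0 <= n < j) (pA * ((n < n0)%N%:R + #|B|%:R * q ^+ n))%:E)).
    by apply: lee_sum => n _; exact: PDn.
  rewrite sumEFin lee_fin -mulr_sumr ler_wpM2l// big_split/= -mulr_sumr /C addrA.
  apply: lerD; first by apply: le_trans (count_sum_le _ _ _) _.
  by rewrite ler_wpM2l//; exact: geometric_sum_le.
- by rewrite mul1r -(fineK PAf) -EFinM mulrC.
Qed.

End delay_upper_bound.

End honest_observations.

(** * The delay is at least (1 - eps) h / I - C *)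

Lemma expRN_le (R : realType) (y : R) : (0 < y)%R -> (expR (- y) <= 4 / y ^+ 2)%R.
Proof.
move=> y0; rewrite expRN -[X in (_ <= X)%R]invrK lef_pV2 ?posrE ?expR_gt0 ?invr_gt0 ?divr_gt0 ?exprn_gt0//.
rewrite invf_div; have := expR_ge1Dx (y / 2).
have -> : expR y = (expR (y / 2) ^+ 2)%R by rewrite -expRM_natl; congr expR; field.
by rewrite !expr2; nra.
Qed.

Lemma natr_expRN_le (R : realType) (a : R) n : (0 < a)%R -> (0 < n)%N ->
  (n%:R * expR (- (n%:R * a)) <= 4 / a ^+ 2 / n%:R)%R.
Proof.
move=> a0 n0; have n0' : (0 < n%:R :> R)%R by rewrite ltr0n.
have := ler_wpM2l (ltW n0') (expRN_le (mulr_gt0 n0' a0)).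
move=> /le_trans; apply; rewrite le_eqVlt; apply/orP; left; apply/eqP; field.
by rewrite !gt_eqF.
Qed.

(** If Y_t >= h, then the sum over s+1 .. t is at least h for some s <= t, and
    the sum over 1 .. n differs from it by the sums over 1 .. s and
    t+1 .. n, which are above - c unless one of the first two cases holds. *)
Lemma early_cusum_path (E : Type) (R : realType) (K : nat) (f g : E -> R)
    (x : obs_array K E) k n t (h c : R) :
  block_positive f g x k 0 n -> (t <= n)%N -> h%:E <= cusum f g x t k ->
  [\/ exists2 s, (s <= n)%N & (wsum f g x k 0 s <= - c)%R,
      (wsum f g x k t (n - t) <= - c)%R |
      (h - 2 * c <= wsum f g x k 0 n)%R].
Proof.
move=> gd tn hx.
have gdt : block_positive f g x k 0 t by move=> u /andP[_ ut]; apply: gd; exact: leq_trans tn.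
have [s st e] := cusum_wsum gdt.
have [lo1|hi1] := leP (wsum f g x k 0 s) (- c)%R.
  by apply: Or31; exists s => //; exact: leq_trans tn.
have [lo2|hi2] := leP (wsum f g x k t (n - t)) (- c)%R; first exact: Or32.
apply: Or33; move: hx; rewrite e lee_fin => hx.
have -> : wsum f g x k 0 n =
    (wsum f g x k 0 s + wsum f g x k s (t - s) + wsum f g x k t (n - t))%R.
  have {1}-> : n = (s + (t - s) + (n - t))%N by rewrite (subnKC st) (subnKC tn).
  by rewrite wsumD wsumD !add0n (subnKC st).
lra.
Qed.

Section sequential_bounds.
Context (R : realType) (d dO : measure_display).
Context (E : measurableType d) (Om : measurableType dO).
Context (lambda : {sigma_finite_measure set E -> \bar R}) (f g : E -> R).
Hypotheses (hf : is_density lambda f) (hg : is_density lambda g).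
Hypothesis hI : 0 < kullback lambda f g < +oo.
Context (K : nat) (N : {set 'I_K}) (X : Om -> obs_array K E).

Local Notation kl := (fine (kullback lambda f g)).
Local Notation Z := (obs X).
Local Notation D := (honest_index N).

Hypothesis mZ : forall i, D i -> measurable_fun setT (Z i).

(** The observations that determine the statistic of sensor k at time t. *)
Definition colpast (k : 'I_K) (t : nat) : set (nat * 'I_K) :=
  [set i | (0 < i.1 <= t)%N /\ i.2 = k].

Lemma colpast_honest k t : k \in N -> colpast k t `<=` D.
Proof. by move=> kN i [/andP[i0 _] ik]; split; rewrite ?ik. Qed.

Lemma coord_alarm h t k :
  <<s coord_sets Z (colpast k t) >> [set w | h%:E <= cusum f g (X w) t k].
Proof.
apply: (@measurable_alarm _ _ _ (g_sigma_algebraType (coord_sets Z (colpast k t))) _ _ _ _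
   (measurable_llr hf hg)) => s st.
exact: (@measurable_coord _ _ _ _ _ Z (colpast k t) (s, k)).
Qed.

Section prechange.
Context (Q : probability Om R) (k : 'I_K).
Hypotheses (kN : k \in N) (indQ : mutually_independent Q D Z).
Hypothesis fQ : forall i, D i -> i.2 = k -> has_density lambda Q (Z i) f.
Context (th rho : R).
Hypotheses (th1 : (th < 1)%R) (rho1 : (rho < 1)%R).
Hypothesis mgf : \int[lambda]_x (expR (- (th * rllr f g x)) * g x)%:E <= rho%:E.

Local Notation U t := (fun w => ucusum f g (1 - th) (X w) t k).

Let coord_tilt t : measurable_fun (setT : set (g_sigma_algebraType (coord_sets Z [set (t.+1, k)])))
  (fun w => tilt f g (1 - th) (X w t.+1 k)).
Proof.
apply: (measurableT_comp (measurable_tilt hf hg (1 - th))).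
exact: (@measurable_coord _ _ _ _ _ Z _ (t.+1, k)).
Qed.

Lemma coord_ucusum t :
  measurable_fun (setT : set (g_sigma_algebraType (coord_sets Z (colpast k t)))) (U t).
Proof.
elim: t => [|t ih] /=; first exact: measurable_cst.
apply: measurable_maxr => //; apply: measurable_funM.
  move=> _ A mA; apply: (@sub_sigma_coord _ _ _ _ _ Z (colpast k t)); last exact: ih.
  by move=> i [/andP[i0 it] ik]; split => //; rewrite i0 (leq_trans it).
move=> _ A mA; apply: (@sub_sigma_coord _ _ _ _ _ Z [set (t.+1, k)]); last exact: coord_tilt.
by move=> _ ->; split => //=; rewrite leqnn.
Qed.

(** If u_t is this expectation, then independence gives
    u_(t+1) <= rho u_t + 1, and 1 / (1 - rho) is the fixed point. *)
Lemma integral_ucusum t : \int[Q]_w (U t w)%:E <= ((1 - rho)^-1)%:E.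
Proof.
have r0 : (0 <= rho)%R.
  rewrite -lee_fin; apply: le_trans mgf; apply: integral_ge0 => x _.
  by rewrite lee_fin mulr_ge0 ?expR_ge0//; case: hg.
have mU s : measurable_fun setT (EFin \o U s).
  by apply: (coord_measurableT mZ (@colpast_honest k s kN)); apply/measurable_EFinP; exact: coord_ucusum.
have U0 s w : (0 <= U s w)%R by apply: le_trans (ucusum_ge1 _ _ _ _ _ _).
elim: t => [|t ih] /=.
  rewrite (eq_integral (cst 1))// integral_cst//= probability_setT mule1 lee_fin.
  by rewrite invr_ge1 ?posrE ?subr_gt0 ?unitfE ?gt_eqF ?subr_gt0//; lra.
have mt : coord_measurable Z [set (t.+1, k)] (fun w => (tilt f g (1 - th) (X w t.+1 k))%:E).
  by apply/measurable_EFinP; exact: coord_tilt.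
have Dt : [set (t.+1, k)] `<=` D by move=> _ ->.
have t0 w : 0 <= (tilt f g (1 - th) (X w t.+1 k))%:E by rewrite lee_fin tilt_ge0.
apply: (@le_trans _ _ (\int[Q]_w ((U t w)%:E * (tilt f g (1 - th) (X w t.+1 k))%:E + 1))).
  apply: ge0_le_integral => //.
  - by move=> w _; rewrite lee_fin (le_trans _ (ucusum_ge1 f g (1 - th) (X w) t.+1 k)).
  - exact: (mU t.+1).
  - apply: emeasurable_funD => //; apply: emeasurable_funM; first exact: mU.
    exact: (coord_measurableT mZ Dt).
  - move=> w _; rewrite -EFinM -EFinD lee_fin ge_max lerDl lerDr ler01/=.
    by rewrite mulr_ge0// tilt_ge0.
rewrite ge0_integralD//; last 2 first.
- by move=> w _; rewrite mule_ge0// lee_fin.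
- by apply: emeasurable_funM; [exact: mU|exact: (coord_measurableT mZ Dt)].
rewrite integral_cst//= probability_setT mule1.
rewrite (integral_coord_indep mZ indQ (@colpast_honest k t kN) Dt)//; last 3 first.
- by rewrite -subset0 => i [[/andP[_ it] _] e]; move: it; rewrite e ltnn.
- by apply/measurable_EFinP; exact: coord_ucusum.
- by move=> w; rewrite lee_fin.
have Dk : D (t.+1, k) by split.
have It : \int[Q]_w (tilt f g (1 - th) (X w t.+1 k))%:E <= rho%:E.
  exact: le_trans (integral_tilt_le hf hg (mZ Dk) th (fQ Dk erefl)) mgf.
have -> : ((1 - rho)^-1)%:E = ((1 - rho)^-1)%:E * rho%:E + 1 :> \bar R.
  by rewrite -EFinM -EFinD; congr EFin; field; rewrite subr_eq0 gt_eqF.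
rewrite leeD2r//; apply: lee_pmul => //; apply: integral_ge0 => w _ //.
by rewrite lee_fin.
Qed.

(** Markov's inequality for [ucusum]; the bound is uniform in t. *)
Lemma prechange_tail (h : R) t :
  Q [set w | h%:E <= cusum f g (X w) t k] <=
  (expR (- ((1 - th) * h)) / (1 - rho))%:E.
Proof.
pose V := [set w | (expR ((1 - th) * h) <= U t w)%R].
(* Where f = 0 the statistic may be infinite, but that is a null event before
   the change. *)
pose W := \big[setU/set0]_(i <- blk k 0 t) [set w | (f (Z i w) <= 0)%R].
have bD i : i \in blk k 0 t -> D i by exact: blk_honest.
have mW i : i \in blk k 0 t -> measurable [set w | (f (Z i w) <= 0)%R].
  move=> /bD/mZ mi; have mf : measurable_fun setT f by case: hf.
  have := @measurable_fun_ler _ Om R setT (f \o Z i) (cst 0%R) (measurableT_comp mf mi) (measurable_cst _) measurableT [set true] Logic.I.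
  by rewrite setTI.
have W0 : Q W = 0.
  apply/eqP; rewrite -measure_le0 -[leRHS](_ : ((size (blk k 0 t))%:R * 0)%:E = 0); last by rewrite mulr0.
  apply: measure_bigU_le => // i ib; rewrite (pre_change_pos hf)//.
  by apply: fQ; [exact: bD|have [_ ->] := mem_blk ib].
have mU : measurable_fun setT (U t).
  by apply/measurable_EFinP; apply: (coord_measurableT mZ (@colpast_honest k t kN)); apply/measurable_EFinP; exact: coord_ucusum.
have mV : measurable V.
  have := @measurable_fun_ler _ Om R setT (cst (expR ((1 - th) * h))) (U t) (measurable_cst _) mU measurableT [set true] Logic.I.
  by rewrite setTI.
have mWW : measurable W by rewrite /W big_seq; exact: bigsetU_measurable.
have mH : measurable [set w | h%:E <= cusum f g (X w) t k].
  apply: (sigma_coord_measurable (S := colpast k t) (Z := Z)); last exact: coord_alarm.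
  by move=> i /(colpast_honest kN)/mZ.
apply: (@le_trans _ _ (Q (W `|` V))).
  apply: le_measure; rewrite ?inE//; first exact: measurableU.
  move=> w /= hw; have [Ww|nW] := pselect (W w); [by left|right].
  have g0 z : (0 <= g z)%R by case: hg.
  have a0 : (0 <= 1 - th)%R by rewrite subr_ge0 ltW.
  have [|c e ec] := @cusum_ucusum E R K f g g0 (1 - th) (X w) t k a0.
    move=> s st; rewrite ltNge; apply/negP => fs; apply: nW.
    rewrite /W -bigcup_seq; exists (s.+1, k) => //=.
    by apply/mapP; exists s; rewrite ?mem_iota.
  rewrite /V/=; apply: le_trans ec; rewrite ler_expR ler_pM2l ?subr_gt0//.
  by move: hw; rewrite e lee_fin.
have UV : Q (W `|` V) <= Q V.
  by apply: le_trans (measureU2 _ mWW mV) _; rewrite [X in X + _]W0 add0e.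
apply: le_trans UV _.
have : (expR ((1 - th) * h))%:E * Q V <= ((1 - rho)^-1)%:E.
  apply: le_trans (integral_ucusum t); rewrite -integral_cst//.
  apply: (@le_trans _ _ (\int[Q]_(w in V) (U t w)%:E)).
    apply: ge0_le_integral => //.
    - by move=> w _; rewrite lee_fin expR_ge0.
    - by apply: measurable_funTS; exact/measurable_EFinP.
  apply: ge0_subset_integral => //; first exact/measurable_EFinP.
  by move=> w _; rewrite lee_fin; apply: le_trans (ucusum_ge1 _ _ _ _ _ _).
have fV : Q V \is a fin_num by exact: fin_num_measure.
rewrite -(fineK fV) -EFinM !lee_fin => H.
by rewrite expRN ler_pdivlMl// expR_gt0.
Qed.

End prechange.

Lemma integral_ge_compl (Q : probability Om R) (T : Om -> \bar R) (V : set Om) n (e : R) :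
  measurable_fun setT T -> (forall w, 0 <= T w) -> measurable V ->
  (forall w, ~ V w -> n%:R%:E <= T w) -> Q V <= e%:E ->
  (n%:R * (1 - e))%:E <= \int[Q]_w T w.
Proof.
move=> mT T0 mV VT Ve; have mV' : measurable (~` V) by exact: measurableC.
apply: (@le_trans _ _ (\int[Q]_(w in ~` V) n%:R%:E)); last first.
  apply: (@le_trans _ _ (\int[Q]_(w in ~` V) T w)).
    apply: ge0_le_integral => //; exact: measurable_funTS.
  exact: ge0_subset_integral.
rewrite integral_cst// EFinM lee_wpmul2l ?lee_fin ?ler0n//.
by rewrite /= probability_setC// EFinB leeB.
Qed.

(** [llsum_lower_tail] with a trivial past. *)
Lemma llsum_low_prob (Q : probability Om R) (s : seq (nat * 'I_K)) (th del c : R) :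
  mutually_independent Q D Z -> uniq s -> (forall i, i \in s -> D i) ->
  (forall i, i \in s -> has_density lambda Q (Z i) g) -> (0 < th)%R ->
  \int[lambda]_x (expR (- (th * rllr f g x)) * g x)%:E <=
    (expR (- (th * (kl - del))))%:E ->
  Q [set w | (llsum f g Z s w <= c)%R] <=
  (expR (th * (c - (size s)%:R * (kl - del))))%:E.
Proof.
move=> indQ us sD sg th0 mgf.
have := llsum_lower_tail hf hg mZ indQ us sD sg th0 mgf (S := set0) (A := setT) c.
rewrite setTI probability_setT mul1e; apply => //.
- by move=> i _ [].
- exact: (@measurableT _ (g_sigma_algebraType (coord_sets Z set0))).
Qed.

Lemma blk_sub (k : 'I_K) s m i : i \in blk k s m -> i \in blk k 0 (s + m).
Proof.
move=> /mapP[t]; rewrite mem_iota => /andP[_ tm] ->.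
by apply/mapP; exists t; rewrite ?mem_iota.
Qed.

Section delay_lower_bound.
Context (B : {set 'I_K}) (P : nat -> probability Om R) (M L : nat).
Hypotheses (hB : B \subset N) (cN : #|N| = (K - M)%N) (ML : (M < L)%N) (LK : (L <= K)%N).
Hypothesis hP : forall nu : nat, honest_law lambda N X (P nu) (change_density f g B nu).

Let BN k : k \in B -> k \in N. Proof. exact: (fintype.subsetP hB). Qed.

Definition early (h : R) n k : set Om :=
  \big[setU/set0]_(t <- iota 1 n) [set w | h%:E <= cusum f g (X w) t k].

Lemma alarm_measurable h t k : k \in N ->
  measurable [set w | h%:E <= cusum f g (X w) t k].
Proof.
move=> kN; apply: (sigma_coord_measurable (S := colpast k t) (Z := Z)); last exact: coord_alarm.
by move=> i /(colpast_honest kN)/mZ.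
Qed.

Lemma early_measurable h n k : k \in N -> measurable (early h n k).
Proof.
by move=> kN; rewrite /early big_seq; apply: bigsetU_measurable => t _; exact: alarm_measurable.
Qed.

(** Union bound over the n times. *)
Lemma early_pre_change (th rho h : R) n k : k \in N -> k \notin B ->
  (th < 1)%R -> (rho < 1)%R ->
  \int[lambda]_x (expR (- (th * rllr f g x)) * g x)%:E <= rho%:E ->
  P 0%N (early h n k) <= (n%:R * (expR (- ((1 - th) * h)) / (1 - rho)))%:E.
Proof.
move=> kN kB th1 rho1 mgf; rewrite -[in leRHS](size_iota 1 n).
apply: measure_bigU_le => t _; first exact: alarm_measurable.
apply: (prechange_tail kN (honest_indep (hP 0%N)) _ th1 rho1 mgf) => i Di ik.
by have := honest_density (hP 0%N) Di; rewrite /change_density ik (negbTE kB).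
Qed.

(** By [early_cusum_path], an early vote needs one of 2 (n + 1) sums to be
    below - c, each with probability at most exp (- th c), or the sum over
    1 .. n to be at least n (kl + eta). *)
Lemma early_post_change (th del eta c h : R) n k : k \in B -> (0 < th)%R ->
  (0 < del)%R -> (del <= kl)%R -> (0 < eta)%R -> (0 < n)%N -> (0 <= c)%R ->
  (n%:R * (kl + eta) + 2 * c <= h)%R ->
  \int[lambda]_x (expR (- (th * rllr f g x)) * g x)%:E <=
    (expR (- (th * (kl - del))))%:E ->
  P 0%N (early h n k) <=
  (2 * (n.+1%:R * expR (- (th * c))) + (del / eta + (th * eta * n%:R)^-1))%:E.
Proof.
move=> kB th0 del0 delI eta0 n0 c0 hc mgf; have kN := BN kB.
have indP0 := honest_indep (hP 0%N).
pose low s m := [set w | (llsum f g Z (blk k s m) w <= - c)%R].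
pose F1 := \big[setU/set0]_(j <- iota 0 n.+1) low 0%N j.
pose F2 := \big[setU/set0]_(j <- iota 0 n.+1) low j (n - j)%N.
pose F3 := [set w | ((size (blk k 0 n))%:R * (kl + eta) <= llsum f g Z (blk k 0 n) w)%R].
pose F0 := bad f g X (blk k 0 n).
have mlow s m : measurable (low s m) by exact: (low_measurable hf hg mZ _ (blk_honest kN)).
have mF1 : measurable F1 by exact: bigsetU_measurable.
have mF2 : measurable F2 by exact: bigsetU_measurable.
have mF0 : measurable F0 by exact: (bad_measurable hf hg mZ (blk_honest kN)).
have mF3 : measurable F3.
  by apply: (sigma_coord_measurable mZ); exact: (coord_llsum_ge hf hg _ (blk_honest kN)).
have Plow s m : P 0%N (low s m) <= (expR (- (th * c)))%:E.
  apply: le_trans (llsum_low_prob _ indP0 (blk_uniq _ _ _) (blk_honest kN) _ th0 mgf) _.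
    move=> i ib; apply: (post_change_density hB hP kB (nu := 0%N) (n := (s + m)%N)).
    exact: blk_sub.
  rewrite lee_fin ler_expR mulrBr mulrN lerBlDr lerDl.
  by rewrite (mulr_ge0 (ltW th0))// mulr_ge0// subr_ge0.
have P1 : P 0%N F1 <= (n.+1%:R * expR (- (th * c)))%:E.
  by rewrite -[in leRHS](size_iota 0 n.+1); exact: measure_bigU_le.
have P2 : P 0%N F2 <= (n.+1%:R * expR (- (th * c)))%:E.
  by rewrite -[in leRHS](size_iota 0 n.+1); exact: measure_bigU_le.
have P3 : P 0%N F3 <= (del / eta + (th * eta * n%:R)^-1)%:E.
  rewrite -[in leRHS](blk_size k 0 n).
  apply: (llsum_upper_tail hf hg hI mZ indP0 (blk_uniq _ _ _) (blk_honest kN) _ th0 mgf) => //.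
    exact: (post_change_density hB hP kB).
  by rewrite blk_size.
have P0 : P 0%N F0 = 0.
  by apply: (bad_null hf hg hI mZ (blk_honest kN)); exact: (post_change_density hB hP kB).
apply: (@le_trans _ _ (P 0%N ((F1 `|` F2) `|` (F3 `|` F0)))).
  apply: le_measure; rewrite ?inE; [exact: early_measurable| |].
    by apply: measurableU; exact: measurableU.
  move=> w; rewrite /early -bigcup_seq => -[t /= tn hw].
  have [Fw|nF0] := pselect (F0 w); first by right; right.
  have gd := block_positive_blk nF0.
  move: tn; rewrite mem_iota add1n ltnS => /andP[t0 tn].
  have [[s sn lo]|lo|hi] := early_cusum_path c gd tn hw.
  - left; left; rewrite /F1 -bigcup_seq; exists s; first by change (s \in iota 0 n.+1); rewrite mem_iota.
    by rewrite /low/= llsum_blk.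
  - left; right; rewrite /F2 -bigcup_seq; exists t; first by change (t \in iota 0 n.+1); rewrite mem_iota.
    by rewrite /low/= llsum_blk.
  - right; left; rewrite /F3/= blk_size llsum_blk; apply: le_trans hi.
    by rewrite lerBrDr.
apply: (le_trans (measureU2 _ (measurableU _ _ mF1 mF2) (measurableU _ _ mF3 mF0))).
rewrite EFinD; apply: leeD.
  apply: (le_trans (measureU2 _ mF1 mF2)).
  by rewrite mulr_natl mulr2n EFinD; exact: leeD.
apply: (le_trans (measureU2 _ mF3 mF0)).
by rewrite [X in _ + X]P0 adde0.
Qed.

(** With c and h of order n, the exponential terms of both kinds of sensors are
    O(1 / n), and the remaining del / eta of [early_post_change] is small by
    the choice of del. *)
Lemma early_total (eps : R) : (0 < eps)%R -> (eps < 1)%R -> exists n1 : nat,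
  forall n (h : R), (n1 <= n)%N -> (0 < n)%N -> (n%:R * kl <= (1 - eps) * h)%R ->
  P 0%N (\big[setU/set0]_(k <- enum N) early h n k) <= eps%:E.
Proof.
move=> eps0 eps1; have I0 : (0 < kl)%R by exact: kullback_gt0 hI.
set nN : R := #|N|%:R; have nN0 : (0 <= nN)%R by rewrite ler0n.
set eta : R := (kl * eps / 2)%R.
have eta0 : (0 < eta)%R by rewrite /eta; nra.
set del : R := (eps * eta / (2 * (nN + 1)))%R.
have del0 : (0 < del)%R by rewrite /del !divr_gt0 ?mulr_gt0//; lra.
have delI : (del < kl)%R.
  rewrite /del ltr_pdivrMr; last lra.
  have h1 : (eps * eta < eta)%R by rewrite gtr_pMl.
  have h2 : (kl * eps < kl)%R by rewrite gtr_pMr.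
  have h3 : (0 <= kl * nN)%R by rewrite mulr_ge0// ltW.
  have h4 : (eta < kl)%R by rewrite /eta; lra.
  have -> : (kl * (2 * (nN + 1)) = 2 * (kl * nN) + 2 * kl)%R by ring.
  lra.
(* th <= 1 / 2 makes exp (- (1 - th) h) at most exp (- n kl / 2). *)
have half0 : (0 < 2^-1 :> R)%R by rewrite invr_gt0.
have [th /andP[th0 th1] mgf] := chernoff hf hg hI del0 half0.
set rho := expR (- (th * (kl - del)))%R in mgf.
have rho1 : (rho < 1)%R by rewrite expR_lt1 oppr_lt0 mulr_gt0// subr_gt0.
pose ka := (th * (kl * eps / 4))%R; have ka0 : (0 < ka)%R by rewrite /ka mulr_gt0// divr_gt0// mulr_gt0.
pose ka' := (kl / 2)%R; have ka'0 : (0 < ka')%R by rewrite /ka' divr_gt0.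
pose C1 := (4 * (4 / ka ^+ 2) + (th * eta)^-1)%R.
pose C2 := (4 / ka' ^+ 2 / (1 - rho))%R.
have C10 : (0 < C1)%R.
  by rewrite /C1 addr_gt0 ?mulr_gt0 ?invr_gt0 ?exprn_gt0 ?mulr_gt0.
have C20 : (0 < C2)%R by rewrite /C2 !divr_gt0 ?exprn_gt0 ?subr_gt0.
exists (Num.truncn (2 * nN * (C1 + C2) / eps)).+1 => n h n1 n0 hn.
have n0' : (0 < n%:R :> R)%R by rewrite ltr0n.
have nC : (2 * nN * (C1 + C2) / eps <= n%:R)%R.
  by apply/ltW/(lt_le_trans (truncnS_gt _)); rewrite ler_nat.
have h_ge0 : (0 <= h)%R.
  rewrite -(pmulr_rge0 h (_ : (0 < 1 - eps)%R)) ?subr_gt0//.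
  by apply: le_trans hn; rewrite mulr_ge0// ltW.
have sE k : k \in enum N -> P 0%N (early h n k) <= (del / eta + (C1 + C2) / n%:R)%:E.
  rewrite mem_enum => kN; have [kB|kB] := boolP (k \in B).
    (* n (kl + eta) + 2 c = (1 + eps) n kl <= (1 + eps) (1 - eps) h <= h. *)
    pose c := (n%:R * (kl * eps / 4))%R.
    have c0 : (0 <= c)%R by rewrite /c mulr_ge0// ltW// divr_gt0// mulr_gt0.
    have hc : (n%:R * (kl + eta) + 2 * c <= h)%R.
      have -> : (n%:R * (kl + eta) + 2 * c = (1 + eps) * (n%:R * kl))%R.
        by rewrite /c /eta; field.
      have p1 : (0 <= 1 + eps)%R by rewrite addr_ge0// ltW.
      apply: le_trans (ler_wpM2l p1 hn) _.
      have : (0 <= eps ^+ 2 * h)%R by rewrite mulr_ge0// sqr_ge0.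
      rewrite (_ : (1 + eps) * ((1 - eps) * h) = h - eps ^+ 2 * h)%R; last by ring.
      by lra.
    apply: (le_trans (early_post_change kB th0 del0 (ltW delI) eta0 n0 c0 hc mgf)).
    rewrite lee_fin addrCA lerD2l.
    have -> : (th * c = n%:R * ka)%R by rewrite /c /ka mulrCA.
    have n2 : (n.+1%:R <= 2 * n%:R :> R)%R by rewrite -natrM ler_nat; move: n0; clear; lia.
    have := natr_expRN_le ka0 n0; have := ler_wpM2r (expR_ge0 (- (n%:R * ka))) n2.
    have : (0 <= C2 / n%:R)%R by rewrite divr_ge0// ltW.
    have -> : ((th * eta * n%:R)^-1 = (th * eta)^-1 / n%:R)%R by rewrite invfM.
    set z := (4 / ka ^+ 2 / n%:R)%R; set y := (_^-1 / n%:R)%R.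
    have -> : ((C1 + C2) / n%:R = 4 * z + y + C2 / n%:R)%R by rewrite /C1 /z /y; ring.
    lra.
  apply: (le_trans (early_pre_change h n kN kB _ rho1 mgf)); first lra.
  rewrite lee_fin.
  have h2 : (n%:R * ka' <= (1 - th) * h)%R.
    apply: (@le_trans _ _ (2^-1 * h)%R).
      rewrite /ka' mulrA mulrC ler_pM2l ?invr_gt0//; apply: (le_trans hn).
      by rewrite ler_piMl// lerBlDr lerDl ltW.
    by rewrite ler_wpM2r//; lra.
  have := natr_expRN_le ka'0 n0.
  have e2 : (expR (- ((1 - th) * h)) <= expR (- (n%:R * ka')))%R by rewrite ler_expR lerN2.
  have := ler_wpM2l (ltW n0') e2 => e3 /(le_trans e3) e4.
  have : (0 <= C1 / n%:R)%R by rewrite divr_ge0// ltW.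
  have : (0 <= del / eta)%R by rewrite divr_ge0// ltW.
  have : (n%:R * (expR (- ((1 - th) * h)) / (1 - rho)) <= C2 / n%:R)%R.
    rewrite /C2 mulrA [leRHS]mulrAC ler_wpM2r//.
    by rewrite invr_ge0 subr_ge0 ltW.
  rewrite mulrDl; lra.
apply: le_trans (measure_bigU_le _ sE) _.
  by move=> k; rewrite mem_enum; exact: early_measurable.
rewrite -cardE -/nN lee_fin mulrDr.
have -> : (eps = eps / 2 + eps / 2)%R by field.
apply: lerD.
  have -> : (nN * (del / eta) = (nN / (nN + 1)) * (eps / 2))%R.
    rewrite /del; field; rewrite !gt_eqF//; lra.
  rewrite ger_pMl; last lra.
  by rewrite ler_pdivrMr; lra.
rewrite mulrA ler_pdivrMr//; move: nC; rewrite ler_pdivrMr//; lra.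
Qed.

Lemma constant_past (pi : nat -> obs_array K E -> 'I_K -> E) :
  history [set: 'I_K] (fun w => observed N pi (X w)) 0 `<=`
  [set A | A = set0 \/ A = setT].
Proof.
apply: smallest_sub; last first.
  by move=> C0 [s [k [C [/andP[s0 s1] _ _ _]]]]; move: s0 s1; case: s.
split => [|A [->|->]|F FA]; first by left.
- by right; rewrite setD0.
- by left; rewrite setDv.
- have [[i Fi]|nF] := pselect (exists i, F i = setT).
    by right; apply/seteqP; split => // w _; exists i => //; rewrite Fi.
  left; apply: bigcup0 => i _; have [//|Fi] := FA i.
  by exfalso; apply: nF; exists i.
Qed.

(** Any strategy will do, at nu = 0, since T_L >= S_(L-M) on every path; as the
    past is trivial, a version of the conditional expectation is constant. *)
Lemma worst_delay_ge (h : R) :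
  \int[P 0%N]_w voting_time f g N (L - M) h (X w) <=
  worst_delay N X P (voting_time f g [set: 'I_K]%SET L h).
Proof.
have hL : (0 < L <= #|[set: 'I_K]%SET|)%N by rewrite cardsT card_ord LK andbT (leq_ltn_trans _ ML).
have hN : (0 < L - M <= #|N|)%N by rewrite cN subn_gt0 ML leq_sub2r.
have /card_gt0P[j jN] : (0 < #|N|)%N by case/andP: hN; exact: leq_trans.
(* The corrupt sensors copy an honest one, which is measurable. *)
pose pi (t : nat) (x : obs_array K E) (_ : 'I_K) := x t j.
have hpi : is_strategy N pi.
  move=> t k t0 _; split => [x y xy|A mA]; first by rewrite /pi xy// t0/=.
  by apply: sub_sigma_algebra; exists t, j, A; split; rewrite ?t0 ?leqnn.
pose T w := voting_time f g [set: 'I_K]%SET L h (observed N pi (X w)).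
have mT : measurable_fun setT T.
  apply: (measurable_voting_time (measurable_llr hf hg)) => // s k s0 _.
  exact: (measurable_observed mZ hpi).
have T0 w : 0 <= T w by exact: voting_time_ge0.
apply: (@le_trans _ _ (\int[P 0%N]_w T w)).
  apply: ge0_le_integral => //.
  - by move=> w _; exact: voting_time_ge0.
  - apply: (measurable_voting_time (measurable_llr hf hg)) => // s k s0 kN.
    exact: (mZ (i := (s, k))).
  - by move=> w _; exact: voting_time_observed.
apply: ereal_sup_ubound; exists 0%N, pi, (cst (\int[P 0%N]_w T w)); split => //.
- have c0 : 0 <= \int[P 0%N]_w T w by exact: integral_ge0.
  have TE w : maxe (T w - 0%:R%:E) 0 = T w by rewrite sube0 (max_idPl _).
  split => // [A _|A /constant_past[->|->]]; last first.
  - rewrite integral_cst//= probability_setT mule1.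
    by apply: eq_integral => w _; rewrite -/(T w) TE.
  - by rewrite !integral_set0.
  - rewrite preimage_cst; case: ifP => _; last exact: sigma_algebra0.
    by rewrite -[setT](setD0 setT); apply: sigma_algebraCD; exact: sigma_algebra0.
- by rewrite ess_sup_cst//= probability_setT.
Qed.

(** Up to n = (1 - e) h / kl no honest sensor votes, with probability at least
    1 - e; (1 - e) ^ 2 >= 1 - eps as e = eps / 2.  Small values of h, for which
    n is below the range of [early_total], are absorbed by C. *)
Lemma delay_lower (eps : R) : (0 < eps)%R -> (eps < 1)%R -> exists C : R,
  forall h : R, (0 < h)%R ->
  ((1 - eps) * h / kl - C)%:E <=
  worst_delay N X P (voting_time f g [set: 'I_K]%SET L h).
Proof.
move=> eps0 eps1; have I0 : (0 < kl)%R by exact: kullback_gt0 hI.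
have hN : (0 < L - M <= #|N|)%N by rewrite cN subn_gt0 ML leq_sub2r.
have mS h : measurable_fun setT (fun w => voting_time f g N (L - M) h (X w)).
  apply: (measurable_voting_time (measurable_llr hf hg)) => // s k s0 kN.
  exact: (mZ (i := (s, k))).
pose e := (eps / 2)%R; have e0 : (0 < e)%R by rewrite /e; lra.
have e1 : (e < 1)%R by rewrite /e; lra.
have [n1 hn1] := early_total e0 e1.
exists (n1%:R + 2)%R => h h0; apply: le_trans (worst_delay_ge h).
have S0 w : 0 <= voting_time f g N (L - M) h (X w) by exact: voting_time_ge0.
set y := (h / kl)%R; have y0 : (0 < y)%R by rewrite divr_gt0.
have hy : (h = y * kl)%R by rewrite /y divfK// gt_eqF.
rewrite -[((1 - eps) * h / kl)%R]mulrA -/y.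
set n := Num.truncn ((1 - e) * y).
have e1y : (0 <= (1 - e) * y)%R by rewrite mulr_ge0// ?subr_ge0 ltW.
have nle : (n%:R <= (1 - e) * y)%R by rewrite truncn_le.
have ngt : ((1 - e) * y < n%:R + 1)%R by rewrite natr1 truncnS_gt.
have [n1n|nn1] := leqP n1.+1 n; last first.
  apply: (@le_trans _ _ 0); last exact: integral_ge0.
  have : (n%:R <= n1%:R :> R)%R by rewrite ler_nat.
  by rewrite lee_fin /e in ngt *; nra.
have n0 : (0 < n)%N by exact: leq_trans n1n.
have Pe := hn1 n h (ltnW n1n) n0 _.
apply: le_trans (integral_ge_compl (V := \big[setU/set0]_(k <- enum N) early h n k) (n := n) (e := e) (mS h) S0 _ _ _).
- rewrite lee_fin; have : (0 <= n1%:R :> R)%R by rewrite ler0n.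
  by rewrite /e in ngt nle e0 e1 *; nra.
- by rewrite big_seq; apply: bigsetU_measurable => k; rewrite mem_enum; exact: early_measurable.
- move=> w nV; apply: voting_time_gt => // t /andP[t0 tn].
  rewrite ltnNge; apply/negP => al; apply: nV.
  have /card_gt0P[k] : (0 < #|N :&: alarms f g h (X w) t|)%N by case/andP: hN => m0 _; exact: leq_trans al.
  rewrite !inE => /andP[kN hk]; rewrite -bigcup_seq; exists k; rewrite /= ?mem_enum//.
  rewrite /early -bigcup_seq; exists t => //; change (t \in iota 1 n).
  by rewrite mem_iota add1n ltnS t0.
- by apply: Pe; rewrite hy mulrA ler_wpM2r// ltW.
Qed.

End delay_lower_bound.
End sequential_bounds.

(** * The calibrated threshold satisfies (1 - eps) m h <= log gamma + C *)

Lemma prode_le_exp (R : realType) (J : eqType) (s : seq J) (F : J -> \bar R) (q : R) :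
  (forall j, j \in s -> 0 <= F j <= q%:E) -> \prod_(j <- s) F j <= (q ^+ size s)%:E.
Proof.
elim: s => [|j s ih] sF; first by rewrite big_nil expr0.
have /andP[F0 Fq] := sF j (mem_head _ _).
have sF' i : i \in s -> 0 <= F i <= q%:E by move=> si; apply: sF; rewrite inE si orbT.
rewrite big_cons exprS EFinM; apply: lee_pmul => //; last exact: ih.
by rewrite big_seq; apply: prode_ge0 => i /sF'/andP[].
Qed.

Section threshold_upper_bound.
Context (R : realType) (d dO : measure_display).
Context (E : measurableType d) (Om : measurableType dO).
Context (lambda : {sigma_finite_measure set E -> \bar R}) (f g : E -> R).
Hypotheses (hf : is_density lambda f) (hg : is_density lambda g).
Hypothesis hI : 0 < kullback lambda f g < +oo.
Context (K : nat) (N : {set 'I_K}) (X : Om -> obs_array K E).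

Local Notation kl := (fine (kullback lambda f g)).
Local Notation Z := (obs X).
Local Notation D := (honest_index N).

Context (Pinf : probability Om R).
Hypothesis hPinf : honest_law lambda N X Pinf (fun _ _ => f).
Let mZ i : D i -> measurable_fun setT (Z i) := honest_measurable hPinf (i:=i).
Context (m : nat) (m0 : (0 < m)%N) (mN : (m <= #|N|)%N).

Let mT h : measurable_fun setT (fun w => voting_time f g N m h (X w)).
Proof.
apply: (measurable_voting_time (measurable_llr hf hg)) => [|s k s0 kN]; first by rewrite m0.
exact: (mZ (i := (s, k))).
Qed.

Let T0 h w : 0 <= voting_time f g N m h (X w).
Proof. by apply: voting_time_ge0; rewrite m0. Qed.

(** Some set of m honest sensors votes; for each of the at most 2 ^ K sets, the
    votes of its sensors are independent and bounded by [prechange_tail]. *)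
Lemma vote_prob (th rho h : R) t : (th < 1)%R -> (rho < 1)%R ->
  \int[lambda]_x (expR (- (th * rllr f g x)) * g x)%:E <= rho%:E ->
  Pinf [set w | (m <= #|N :&: alarms f g h (X w) t|)%N] <=
  (#|{: {set 'I_K}}|%:R * (expR (- ((1 - th) * h)) / (1 - rho)) ^+ m)%:E.
Proof.
move=> th1 rho1 mgf; set q := (expR _ / _)%R.
have q0 : (0 <= q)%R by rewrite /q divr_ge0 ?expR_ge0// subr_ge0 ltW.
pose ss := enum [set C : {set 'I_K} | (C \subset N) && (#|C| == m)].
pose F C := \big[setI/setT]_(k <- enum (C : {set 'I_K})) [set w | h%:E <= cusum f g (X w) t k].
have mF C : C \in ss -> measurable (F C).
  rewrite mem_enum inE => /andP[/fintype.subsetP CN _]; rewrite /F big_seq.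
  apply: bigsetI_measurable => k; rewrite mem_enum => /CN kN.
  exact: (alarm_measurable hf hg mZ).
apply: (@le_trans _ _ (Pinf (\big[setU/set0]_(C <- ss) F C))).
  apply: le_measure; rewrite ?inE.
  - apply: (measurable_vote (measurable_llr hf hg)) => s k /andP[s0 _] kN.
    exact: (mZ (i := (s, k))).
  - by rewrite big_seq; apply: bigsetU_measurable.
  move=> w /= mw; rewrite -bigcup_seq.
  pose s := take m (enum (N :&: alarms f g h (X w) t)).
  have sC : #|[set k in s]| = m.
    rewrite cardsE (card_uniqP _); last by rewrite take_uniq// enum_uniq.
    by rewrite size_take -cardE; case: ltngtP mw => // ->.
  have sA k : k \in s -> k \in N :&: alarms f g h (X w) t.
    by move=> /mem_take; rewrite mem_enum.
  exists [set k in s]%SET.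
    change ([set k in s]%SET \in ss).
    rewrite /ss mem_enum inE; apply/andP; split; last by rewrite sC.
    by apply/fintype.subsetP => k; rewrite inE => /sA; rewrite inE => /andP[].
  rewrite /F -bigcap_seq => k /=; rewrite mem_enum inE => /sA.
  by rewrite !inE => /andP[].
apply: (@le_trans _ _ ((size ss)%:R * q ^+ m)%:E); last first.
  rewrite lee_fin ler_wpM2r ?exprn_ge0// ler_nat /ss -cardE max_card//.
apply: measure_bigU_le => // C; rewrite mem_enum inE => /andP[/fintype.subsetP CN /eqP Cm].
rewrite /F (indep_bigcap mZ (honest_indep hPinf) (S := fun k => colpast k t)).
- rewrite -Cm cardE; apply: prode_le_exp => k; rewrite mem_enum => /CN kN.
  rewrite measure_ge0/=.
  apply: (prechange_tail hf hg mZ kN (honest_indep hPinf) _ th1 rho1 mgf) => i Di _.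
  exact: (honest_density hPinf Di).
- exact: enum_uniq.
- by move=> k; rewrite mem_enum => /CN kN; exact: colpast_honest.
- by move=> k _; exact: (@coord_alarm _ _ _ _ _ _ _ _ hf hg).
- move=> k l _ _ kl; rewrite -subset0 => i [[_ ik] [_ il]].
  by move: kl; rewrite -ik -il eqxx.
Qed.

(** If p bounds the probability of a vote of m sensors at any given time, there
    is no vote up to n with probability at least 1 - n p, so
    gamma >= n (1 - n p).  With n the integer part of 1 / (2 p) this is of
    order 1 / p, that is of order exp (m (1 - th) h). *)
Lemma threshold_upper (eps : R) : (0 < eps)%R -> (eps < 1)%R -> exists C : R,
  forall h gamma : R, (0 < h)%R -> (1 < gamma)%R ->
  \int[Pinf]_w voting_time f g N m h (X w) = gamma%:E ->
  ((1 - eps) * (m%:R * h) <= ln gamma + C)%R.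
Proof.
move=> eps0 eps1; have I0 : (0 < kl)%R by exact: kullback_gt0 hI.
have I2 : (0 < kl / 2)%R by rewrite divr_gt0.
(* th < eps, so that 1 - th exceeds 1 - eps. *)
have [th /andP[th0 theps] mgf] := chernoff hf hg hI I2 eps0.
have th1 : (th < 1)%R by exact: lt_trans eps1.
set rho := expR (- (th * (kl - kl / 2)))%R in mgf.
have rho1 : (rho < 1)%R by rewrite expR_lt1 oppr_lt0 mulr_gt0//; lra.
have rho0 : (0 < 1 - rho)%R by rewrite subr_gt0.
pose S : R := #|{: {set 'I_K}}|%:R.
have S0 : (0 < S)%R by rewrite ltr0n; apply/card_gt0P; exists (finset.set0 : {set 'I_K}).
exists (ln 6 + ln S - m%:R * ln (1 - rho))%R => h gamma h0 gamma1 eg.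
set q := (expR (- ((1 - th) * h)) / (1 - rho))%R.
have q0 : (0 < q)%R by rewrite divr_gt0 ?expR_gt0.
set p := (S * q ^+ m)%R; have p0 : (0 < p)%R by rewrite mulr_gt0 ?exprn_gt0.
pose n := Num.truncn (2 * p)^-1.
have pi0 : (0 <= (2 * p)^-1)%R by rewrite invr_ge0 mulr_ge0// ltW.
have nle : (n%:R <= (2 * p)^-1)%R by rewrite truncn_le.
have ngt : ((2 * p)^-1 < n%:R + 1)%R by rewrite natr1 truncnS_gt.
pose vt t := [set w | (m <= #|N :&: alarms f g h (X w) t|)%N].
have mvt t : measurable (vt t).
  apply: (measurable_vote (measurable_llr hf hg)) => s k /andP[s0 _] kN.
  exact: (mZ (i := (s, k))).
pose V := \big[setU/set0]_(t <- iota 1 n) vt t.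
have PV : Pinf V <= (n%:R * p)%:E.
  rewrite -[in leRHS](size_iota 1 n); apply: measure_bigU_le => // t _.
  exact: vote_prob.
have gge : ((n%:R * (1 - n%:R * p))%:E <= gamma%:E).
  rewrite -eg; apply: (integral_ge_compl (V := V)) => //.
    by rewrite /V; apply: bigsetU_measurable.
  move=> w nV; apply: voting_time_gt; first by rewrite m0.
  move=> t /andP[t1 tn]; rewrite ltnNge; apply/negP => tv; apply: nV.
  rewrite /V -bigcup_seq; exists t => //; change (t \in iota 1 n).
  by rewrite mem_iota add1n ltnS t1.
have np : (n%:R * p <= 2^-1)%R.
  by rewrite -ler_pdivlMr// -invfM.
have n0 : (0 <= n%:R :> R)%R by rewrite ler0n.
have n2 : (n%:R / 2 <= gamma)%R.
  move: gge; rewrite lee_fin; apply: le_trans; rewrite ler_wpM2l//; lra.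
have p6 : (p^-1 <= 6 * gamma)%R.
  have -> : (p^-1 = 2 * (2 * p)^-1)%R by field; rewrite gt_eqF.
  lra.
have : (- ln p <= ln 6 + ln gamma)%R.
  rewrite -lnV ?posrE// -lnM ?posrE//; last lra.
  by rewrite ler_ln ?posrE ?invr_gt0//; lra.
rewrite /p lnM ?posrE ?exprn_gt0// lnXn// /q ln_div ?posrE ?expR_gt0// expRK -[((_ - ln _) *+ m)%R]mulr_natl.
have : ((1 - eps) * (m%:R * h) <= m%:R * ((1 - th) * h))%R.
  rewrite mulrCA ler_wpM2l ?ler0n// ler_wpM2r ?(ltW h0)//; lra.
rewrite (mulrBr m%:R) mulrN; lra.
Qed.
End threshold_upper_bound.

(** * The calibrated threshold satisfies log gamma <= (1 + eps) m h + C *)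

Lemma expRN_le_inv (R : realType) (y : R) : (0 < y)%R -> (expR (- y) <= y^-1)%R.
Proof.
move=> y0; rewrite expRN lef_pV2 ?posrE ?expR_gt0//.
by apply: le_trans (expR_ge1Dx y); rewrite lerDr.
Qed.

Lemma blocks_disjoint n l l' t : l != l' ->
  (l * n < t <= l * n + n)%N -> (l' * n < t <= l' * n + n)%N -> False.
Proof.
wlog ll' : l l' / (l < l')%N => [wh|].
  move=> ll' h1 h2; case: (ltngtP l l') => [lt|lt|eq].
  - exact: wh lt ll' h1 h2.
  - by apply: wh lt _ h2 h1; rewrite eq_sym.
  - by move: ll'; rewrite eq eqxx.
move=> _ /andP[_ tl] /andP[tl' _]; have : (l.+1 * n <= l' * n)%N by rewrite leq_mul2r ll' orbT.
by rewrite mulSnr leqNgt (leq_trans tl' tl).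
Qed.

Section threshold_lower_bound.
Context (R : realType) (d dO : measure_display).
Context (E : measurableType d) (Om : measurableType dO).
Context (lambda : {sigma_finite_measure set E -> \bar R}) (f g : E -> R).
Hypotheses (hf : is_density lambda f) (hg : is_density lambda g).
Hypothesis hI : 0 < kullback lambda f g < +oo.
Context (K : nat) (N : {set 'I_K}) (X : Om -> obs_array K E).

Local Notation kl := (fine (kullback lambda f g)).
Local Notation Z := (obs X).
Local Notation D := (honest_index N).

Context (Pinf Q : probability Om R) (B : {set 'I_K}).
Hypothesis hPinf : honest_law lambda N X Pinf (fun _ _ => f).
Hypothesis hB : B \subset N.
Hypothesis hQ : honest_law lambda N X Q (change_density f g B 0).
Let mZ i : D i -> measurable_fun setT (Z i) := honest_measurable hPinf (i:=i).
Let BN k : k \in B -> k \in N. Proof. exact: (fintype.subsetP hB). Qed.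

Let blk_post s n k : k \in B ->
  forall i, i \in blk k s n -> has_density lambda Q (Z i) g.
Proof.
move=> kB i ib; have Di := blk_honest (BN kB) ib.
have := honest_density hQ Di; have [/andP[ni _] ->] := mem_blk ib.
by rewrite /change_density kB (leq_ltn_trans _ ni).
Qed.

(** Over n observations from s on, the sum of sensor k is away from its
    post-change mean n kl by n eta, or not meaningful.  Not being too low
    makes the sensor vote; not being too high keeps the likelihood ratio
    under control. *)
Definition atypical (eta : R) n s k : set Om :=
  [set w | (llsum f g Z (blk k s n) w <= n%:R * (kl - eta))%R] `|`
  [set w | (n%:R * (kl + eta) <= llsum f g Z (blk k s n) w)%R] `|`
  bad f g X (blk k s n).

Lemma coord_atypical (S : set (nat * 'I_K)) eta n s k :
  (forall i, i \in blk k s n -> S i) ->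
  <<s coord_sets Z S >> (atypical eta n s k).
Proof.
move=> bS.
apply: (@measurableU _ (g_sigma_algebraType (coord_sets Z S))).
  apply: (@measurableU _ (g_sigma_algebraType (coord_sets Z S))).
    exact: (coord_llsum_le hf hg).
  exact: (coord_llsum_ge hf hg).
exact: (coord_bad hf hg).
Qed.

Lemma atypical_measurable eta n s k : k \in N -> measurable (atypical eta n s k).
Proof.
move=> kN; apply: (sigma_coord_measurable (S := D) mZ).
by apply: coord_atypical; exact: blk_honest.
Qed.

Lemma atypical_prob (th del eta : R) n s k : k \in B -> (0 < th)%R ->
  (0 < del)%R -> (0 < eta)%R -> (0 < n)%N ->
  \int[lambda]_x (expR (- (th * rllr f g x)) * g x)%:E <=
    (expR (- (th * (kl - del))))%:E ->
  Q (atypical eta n s k) <=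
  (expR (- (th * (n%:R * (eta - del)))) + (del / eta + (th * eta * n%:R)^-1))%:E.
Proof.
move=> kB th0 del0 eta0 n0 mgf; have kN := BN kB.
have bD := blk_honest kN (s := s) (n := n).
have indQ := honest_indep hQ.
have mlo : measurable [set w | (llsum f g Z (blk k s n) w <= n%:R * (kl - eta))%R].
  exact: (low_measurable hf hg mZ).
have mhi : measurable [set w | (n%:R * (kl + eta) <= llsum f g Z (blk k s n) w)%R].
  by apply: (sigma_coord_measurable mZ); exact: (coord_llsum_ge hf hg).
have mb := bad_measurable hf hg mZ bD.
apply: (le_trans (measureU2 _ (measurableU _ _ mlo mhi) mb)).
rewrite [X in _ + X](bad_null hf hg hI mZ bD (blk_post kB)) adde0.
apply: (le_trans (measureU2 _ mlo mhi)); rewrite EFinD; apply: leeD.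
  apply: le_trans (llsum_low_prob hf hg mZ _ indQ (blk_uniq _ _ _) bD (blk_post kB) th0 mgf) _.
  rewrite lee_fin ler_expR blk_size le_eqVlt; apply/orP; left; apply/eqP; ring.
have := llsum_upper_tail hf hg hI mZ indQ (blk_uniq _ _ _) bD (blk_post kB) th0 mgf del0 eta0.
by rewrite blk_size; apply.
Qed.

Section block.
Context (A : {set 'I_K}) (m n : nat) (eta : R).
Hypotheses (AB : A \subset B) (cA : #|A| = m) (n0 : (0 < n)%N).

Definition blks s : seq (nat * 'I_K) := [seq (t.+1, k) | k <- enum A, t <- iota s n].
(** Off this event, all the sensors of A vote at time s + n when the threshold
    is at most n (kl - eta), see [hit_voting_time]. *)
Definition miss s : set Om := \big[setU/set0]_(k <- enum A) atypical eta n s k.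

Hypothesis miss_half : forall s, Q (miss s) <= (2^-1)%:E.

Let AN k : k \in A -> k \in N. Proof. by move=> kA; apply/BN/(fintype.subsetP AB). Qed.

Lemma blk_blks s k i : k \in A -> i \in blk k s n -> i \in blks s.
Proof.
move=> kA /mapP[t ts ->]; apply/allpairsPdep; exists k, t.
by rewrite mem_enum.
Qed.

Lemma mem_blks s i : i \in blks s -> exists2 k, k \in A & i \in blk k s n.
Proof.
move=> /allpairsPdep[k [t [kA ts ->]]]; exists k; first by rewrite -mem_enum.
exact: map_f.
Qed.

Lemma blks_uniq s : uniq (blks s).
Proof.
apply: allpairs_uniq; rewrite ?enum_uniq ?iota_uniq//.
by move=> [k t] [k' t'] _ _ [-> ->].
Qed.

Lemma coord_miss s : <<s coord_sets Z [set` blks s] >> (miss s).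
Proof.
rewrite /miss big_seq.
apply: (@bigsetU_measurable _ (g_sigma_algebraType (coord_sets Z [set` blks s]))) => k.
rewrite mem_enum => kA; apply: coord_atypical => i; exact: blk_blks.
Qed.

Lemma blks_honest s i : i \in blks s -> D i.
Proof. by move=> /mem_blks[k /AN kN]; exact: blk_honest. Qed.

Lemma miss_measurable s : measurable (miss s).
Proof.
apply: (sigma_coord_measurable (S := [set` blks s]) (Z := Z)); last exact: coord_miss.
by move=> i ib; apply: mZ; exact: blks_honest ib.
Qed.

Lemma hit_llsum s w : ~ miss s w ->
  (llsum f g Z (blks s) w <= m%:R * (n%:R * (kl + eta)))%R.
Proof.
rewrite /miss -bigcup_seq => nm.
rewrite /llsum /blks big_allpairs_dep/= -cA mulr_natl -sumr_const -[leRHS]big_enum/=.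
rewrite big_seq [leRHS]big_seq; apply: ler_sum => k; rewrite mem_enum => kA.
rewrite leNgt; apply/negP => lk; apply: nm; exists k; first by rewrite /= mem_enum.
by left; right; rewrite /= /llsum /blk big_map ltW.
Qed.

Lemma hit_voting_time s h w : (h <= n%:R * (kl - eta))%R -> (0 < m <= #|N|)%N ->
  ~ miss s w -> voting_time f g N m h (X w) <= (s + n)%:R%:E.
Proof.
move=> hn hN; rewrite /miss -bigcup_seq => nm; apply/voting_time_le => //.
exists (s + n)%N; rewrite addn_gt0 n0 orbT leqnn; split => //.
rewrite -cA; apply/subset_leq_card/fintype.subsetP => k kA; rewrite !inE AN//=.
have nk : ~ atypical eta n s k w by move=> ak; apply: nm; exists k; rewrite //= mem_enum.
apply: le_trans (cusum_ge_wsum (block_positive_blk _)); last by move=> bk; apply: nk; right.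
rewrite lee_fin; apply: (le_trans hn); rewrite leNgt; apply/negP => lk; apply: nk.
by left; left; rewrite /= llsum_blk ltW.
Qed.

(** After a change, the complement of miss s has probability at least 1 / 2,
    and on it the likelihood ratio is at most exp (m n (kl + eta)): it has
    probability at least exp (- m n (kl + eta)) / 2 without a change. *)
Lemma miss_Pinf s : Pinf (miss s) <= (1 - expR (- (m%:R * (n%:R * (kl + eta)))) / 2)%:E.
Proof.
set b := (m%:R * _)%R.
have bD := @blks_honest s.
have half : (2^-1)%:E <= Q (~` miss s).
  rewrite probability_setC; last exact: miss_measurable.
  have -> : 2^-1%:E = 1 - 2^-1%:E :> \bar R by rewrite -EFinB; congr EFin; field.
  by rewrite leeB.
have sg i : i \in blks s -> has_density lambda Q (Z i) g.
  by move=> /mem_blks[k /(fintype.subsetP AB) kB]; exact: blk_post.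
have sf i : i \in blks s -> has_density lambda Pinf (Z i) f.
  by move=> /bD Di; exact: (honest_density hPinf Di).
have cm : <<s coord_sets Z [set` blks s] >> (~` miss s).
  rewrite -setTD; apply: sigma_algebraCD; exact: coord_miss.
have := likelihood_bound hf hg hI mZ (honest_indep hPinf) (honest_indep hQ)
  (blks_uniq s) bD sf sg cm (@hit_llsum s).
move=> /(le_trans half); rewrite probability_setC; last exact: miss_measurable.
have fm : Pinf (miss s) \is a fin_num.
  by apply: fin_num_measure; exact: miss_measurable.
rewrite -(fineK fm) -EFinB -EFinM !lee_fin => hb.
have := ler_wpM2l (expR_ge0 (- b)) hb.
rewrite -/b mulrA -expRD addNr expR0 mul1r; lra.
Qed.

(** If S_m(h) > j n, then each of the first j blocks of length n is missed,
    and disjoint blocks are independent: the tail of S_m(h) / n is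
    geometric. *)
Lemma threshold_block (h gamma : R) : (0 < m <= #|N|)%N -> (0 <= kl + eta)%R ->
  (h <= n%:R * (kl - eta))%R ->
  \int[Pinf]_w voting_time f g N m h (X w) = gamma%:E ->
  (gamma <= n%:R * (2 * expR (m%:R * (n%:R * (kl + eta)))))%R.
Proof.
move=> hN ke hn eg; set b := (m%:R * _)%R.
have b0 : (0 <= b)%R by rewrite mulr_ge0// mulr_ge0.
set q := (1 - expR (- b) / 2)%R.
have eb1 : (expR (- b) <= 1)%R by rewrite -expR0 ler_expR oppr_le0.
have eb0 : (0 < expR (- b))%R by rewrite expR_gt0.
have q01 : (0 <= q < 1)%R by rewrite /q; lra.
pose Dn j := \big[setI/setT]_(i <- iota 0 j) miss (i * n).
have mDn j : measurable (Dn j) by apply: bigsetI_measurable => i _; exact: miss_measurable.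
rewrite -lee_fin -eg (_ : (2 * expR b = (1 - q)^-1)%R); last first.
  by rewrite /q opprB addrCA subrr addr0 invf_div expRN invrK.
apply: (integral_hitting_le (D := Dn) measurableT _ _ mDn n0) => //.
- apply: (measurable_voting_time (measurable_llr hf hg)) => // s k s0 kN.
  exact: (mZ (i := (s, k))).
- by move=> w; exact: voting_time_ge0.
- move=> j w; rewrite /Dn -bigcap_seq => nD.
  have [i ij nm] : exists2 i, (i < j)%N & ~ miss (i * n) w.
    apply: contrapT => nex; apply: nD => i /=; rewrite mem_iota => /andP[_ ij].
    by apply: contrapT => nm; apply: nex; exists i.
  apply: (le_trans (hit_voting_time hn hN nm)); rewrite lee_fin ler_nat.
  by rewrite -mulSnr mulnC leq_mul2l ij orbT.
- move=> j; apply: le_trans (_ : _ <= (\sum_(0 <= i < j) q ^+ i)%:E) _; last first.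
    by rewrite lee_fin; exact: geometric_sum_le.
  rewrite -sumEFin; apply: lee_sum => i _; rewrite setTI.
  rewrite /Dn (indep_bigcap mZ (honest_indep hPinf) (S := fun i => [set` blks (i * n)])).
  - rewrite -[in leRHS](size_iota 0 i); apply: prode_le_exp => l _.
    by rewrite measure_ge0/=; exact: miss_Pinf.
  - exact: iota_uniq.
  - by move=> l _ x; exact: blks_honest.
  - by move=> l _; exact: coord_miss.
  - move=> l l' _ _ ll'; rewrite -subset0 => x [/= /mem_blks[k _ /mem_blk[h1 _]]].
    move=> /mem_blks[k' _ /mem_blk[h2 _]]; exact: blocks_disjoint ll' h1 h2.
Qed.

End block.

(** In [atypical_prob] the term del / eta is fixed by del to 1 / (8 m), and the
    other ones are O(1 / n). *)
Lemma miss_prob_half (m : nat) (eta : R) : (0 < m)%N -> (0 < eta)%R ->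
  exists n1 : nat, forall (A : {set 'I_K}) n s, A \subset B -> #|A| = m ->
    (n1 <= n)%N -> (0 < n)%N -> Q (miss A n eta s) <= (2^-1)%:E.
Proof.
move=> m0 eta0; have mR : (0 < m%:R :> R)%R by rewrite ltr0n.
pose del := (eta / (8 * m%:R))%R; have del0 : (0 < del)%R by rewrite /del divr_gt0// mulr_gt0.
have deleta : (del < eta)%R.
  have : (1 <= m%:R :> R)%R by rewrite ler1n.
  by rewrite /del ltr_pdivrMr ?mulr_gt0// => m1; rewrite ltr_pMr//; lra.
have [th /andP[th0 _] mgf] := chernoff hf hg hI del0 (ltr01 : (0 < 1 :> R)%R).
have a0 : (0 < th * (eta - del))%R by rewrite mulr_gt0// subr_gt0.
pose C := ((th * (eta - del))^-1 + (th * eta)^-1)%R.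
have C0 : (0 < C)%R by rewrite /C addr_gt0// invr_gt0// mulr_gt0.
exists (Num.truncn (4 * m%:R * C)).+1 => A n s AB cA n1 n0.
have nR : (0 < n%:R :> R)%R by rewrite ltr0n.
have nC : (4 * m%:R * C <= n%:R)%R.
  by apply/ltW/(lt_le_trans (truncnS_gt _)); rewrite ler_nat.
have key k : k \in enum A -> Q (atypical eta n s k) <= ((2 * m%:R)^-1)%:E.
  rewrite mem_enum => /(fintype.subsetP AB) kB.
  apply: (le_trans (atypical_prob s kB th0 del0 eta0 n0 mgf)); rewrite lee_fin.
  have -> : (th * (n%:R * (eta - del)) = n%:R * (th * (eta - del)))%R by ring.
  have := expRN_le_inv (mulr_gt0 nR a0) => e1.
  have e2 : (C / n%:R <= (4 * m%:R)^-1)%R.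
    by rewrite ler_pdivrMr// mulrC ler_pdivlMr ?mulr_gt0// mulrC.
  have e3 : ((n%:R * (th * (eta - del)))^-1 + (th * eta * n%:R)^-1 = C / n%:R)%R.
    by rewrite /C !invfM; ring.
  have e4 : (del / eta = (8 * m%:R)^-1)%R by rewrite /del; field; rewrite !gt_eqF.
  have hm (c : R) : ((c * m%:R)^-1 = c^-1 * m%:R^-1)%R by exact: invfM.
  have m' : (0 < m%:R^-1 :> R)%R by rewrite invr_gt0.
  rewrite !hm in e2 e4 *; lra.
apply: (le_trans (measure_bigU_le _ key)).
  move=> k; rewrite mem_enum => /(fintype.subsetP AB) kB.
  exact/atypical_measurable/BN.
rewrite -cardE cA lee_fin le_eqVlt; apply/orP; left; apply/eqP.
by field; rewrite gt_eqF.
Qed.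

(** [threshold_block] applies with n (kl - eta) >= h, and n may be chosen
    within a constant of h / (kl - eta); the factor n of its bound is absorbed
    in exp (n eta) / eta. *)
Lemma threshold_lower (m : nat) (eps : R) : (0 < m <= #|B|)%N -> (0 < eps)%R ->
  exists C : R, forall h gamma : R, (0 < h)%R -> (1 < gamma)%R ->
  \int[Pinf]_w voting_time f g N m h (X w) = gamma%:E ->
  (ln gamma <= (1 + eps) * (m%:R * h) + C)%R.
Proof.
move=> /andP[m0 mB] eps0; have I0 : (0 < kl)%R by exact: kullback_gt0 hI.
have hN : (0 < m <= #|N|)%N by rewrite m0 (leq_trans mB)// subset_leq_card.
set eta := (eps * kl / (3 + eps))%R.
have eta0 : (0 < eta)%R by rewrite /eta divr_gt0 ?mulr_gt0// addr_gt0.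
(* eta is the solution of this equation. *)
have ratio : (kl + 2 * eta = (1 + eps) * (kl - eta))%R.
  by rewrite /eta; field; rewrite gt_eqF// addr_gt0.
have ke : (0 < kl - eta)%R.
  have : (0 < (1 + eps) * (kl - eta))%R by rewrite -ratio; lra.
  by rewrite pmulr_rgt0//; lra.
have [n1 hn1] := miss_prob_half m0 eta0.
pose A := [set k in take m (enum B)]%SET.
have AB : A \subset B.
  by apply/fintype.subsetP => k; rewrite inE => /mem_take; rewrite mem_enum.
have cA : #|A| = m.
  rewrite cardsE (card_uniqP _); last by rewrite take_uniq// enum_uniq.
  by rewrite size_take -cardE; case: ltngtP mB => // ->.
exists (ln 2 - ln eta + m%:R * ((1 + n1%:R) * (kl + 2 * eta)))%R => h gamma h0 gamma1 eg.
have hk0 : (0 <= h / (kl - eta))%R by rewrite divr_ge0// ltW.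
set n := (Num.truncn (h / (kl - eta)) + 1 + n1)%N.
have n0 : (0 < n)%N by rewrite /n addn1.
have nR : (0 < n%:R :> R)%R by rewrite ltr0n.
have n1n : (n1 <= n)%N by rewrite leq_addl.
have nle : (n%:R <= h / (kl - eta) + (1 + n1%:R))%R.
  by rewrite /n !natrD -addrA lerD2r truncn_le.
have nge : (h / (kl - eta) <= n%:R)%R.
  by rewrite /n natrD; apply: ler_wpDr => //; rewrite addn1; exact/ltW/truncnS_gt.
have hn : (h <= n%:R * (kl - eta))%R by rewrite -ler_pdivrMr.
have half s : Q (miss A n eta s) <= (2^-1)%:E by exact: hn1.
have ke' : (0 <= kl + eta)%R by rewrite addr_ge0// ltW.
have := threshold_block AB cA n0 half hN ke' hn eg => gle.
have lg : (ln gamma <= ln n%:R + (ln 2 + m%:R * (n%:R * (kl + eta))))%R.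
  apply: le_trans (_ : _ <= ln (n%:R * (2 * expR (m%:R * (n%:R * (kl + eta))))))%R _.
    rewrite ler_ln ?posrE ?mulr_gt0 ?expR_gt0//; lra.
  by rewrite !lnM ?posrE ?mulr_gt0 ?expR_gt0// expRK.
have lnn : (ln n%:R <= n%:R * eta - ln eta)%R.
  rewrite lerBrDr -lnM ?posrE//.
  by apply/ltW/ln_sublinear; rewrite mulr_gt0.
have m1 : (1 <= m%:R :> R)%R by rewrite ler1n.
have p1 : (n%:R * eta <= m%:R * (n%:R * eta))%R by rewrite ler_peMl// mulr_ge0// ltW.
have p2 : (m%:R * (n%:R * (kl + 2 * eta)) <=
    (1 + eps) * (m%:R * h) + m%:R * ((1 + n1%:R) * (kl + 2 * eta)))%R.
  have -> : ((1 + eps) * (m%:R * h) = m%:R * (h / (kl - eta) * (kl + 2 * eta)))%R.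
    by rewrite ratio; field; rewrite gt_eqF.
  rewrite -mulrDr -mulrDl ler_wpM2l ?ler0n// ler_wpM2r//; lra.
have p3 : (m%:R * (n%:R * (kl + 2 * eta)) =
   m%:R * (n%:R * (kl + eta)) + m%:R * (n%:R * eta))%R by ring.
lra.
Qed.

End threshold_lower_bound.

(** * Detection class and asymptotic delay *)

Section rates.
Context (R : realType).
Implicit Types (c m h l e C : R).

(** With e' = e / (2 + e) one has (1 + e') / (1 - e') = 1 + e: this combines
    [delay_upper] and [threshold_upper], both at e'. *)
Lemma delay_rate_upper c m h l e C C' : (0 < c)%R -> (0 < m)%R -> (0 < e)%R ->
  ((1 - e / (2 + e)) * (m * h) <= l + C')%R ->
  ((1 + e / (2 + e)) * h / c + C <=
   (1 + e) * (l / (m * c)) + ((1 + e) * (C' / (m * c)) + C))%R.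
Proof.
move=> c0 m0 e0 hl.
have -> : ((1 + e / (2 + e)) * h / c = (1 + e) * (((1 - e / (2 + e)) * (m * h)) / (m * c)))%R.
  by field; rewrite !gt_eqF//; lra.
rewrite addrA lerD2r -mulrDr -mulrDl ler_wpM2l; [by []|lra|].
by rewrite ler_wpM2r// invr_ge0 mulr_ge0// ltW.
Qed.

(** Here (1 - e') / (1 + e') = 1 / (1 + e) >= 1 - e: this combines
    [delay_lower] and [threshold_lower], both at e'. *)
Lemma delay_rate_lower c m h l e C C' : (0 < c)%R -> (0 < m)%R -> (0 < e)%R ->
  (0 <= l)%R -> (l <= (1 + e / (2 + e)) * (m * h) + C')%R ->
  ((1 - e) * (l / (m * c)) - (`|C'| / (m * c) + C) <=
   (1 - e / (2 + e)) * h / c - C)%R.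
Proof.
move=> c0 m0 e0 l0 hl; rewrite opprD addrA lerD2r.
have -> : ((1 - e / (2 + e)) * h / c = (((1 + e / (2 + e)) * (m * h)) / (1 + e)) / (m * c))%R.
  by field; rewrite !gt_eqF//; lra.
rewrite (mulrA (1 - e)%R) -mulrBl ler_wpM2r ?invr_ge0 ?mulr_ge0 ?(ltW m0) ?(ltW c0)//.
rewrite ler_pdivlMr; last lra.
set u := (_ * (m * h))%R in hl *.
have : (0 <= e ^+ 2 * l)%R by rewrite mulr_ge0// sqr_ge0.
have : (0 <= e * `|C'|)%R by rewrite mulr_ge0// ltW.
have : (C' <= `|C'|)%R by exact: ler_norm.
have -> : (((1 - e) * l - `|C'|) * (1 + e) = l - e ^+ 2 * l - `|C'| - e * `|C'|)%R by ring.
lra.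
Qed.

(** With error at most eps / 2 from the factor and C <= (eps / 2) log gamma / a
    for large gamma, the quotient is within eps of 1. *)
Lemma asymp_equiv_log (Gam : set R) (J : R -> \bar R) (a : R) : (0 < a)%R ->
  (forall gamma, Gam gamma -> (1 < gamma)%R) ->
  (forall e, (0 < e)%R -> (e < 1)%R -> exists C, forall gamma, Gam gamma ->
     ((1 - e) * (ln gamma / a) - C)%:E <= J gamma <= ((1 + e) * (ln gamma / a) + C)%:E) ->
  asymp_equiv (within Gam (pinfty_nbhs R)) J (fun gamma => (ln gamma / a)%:E).
Proof.
move=> a0 G1 hJ.
have JE e : (0 < e)%R -> (e < 1)%R -> exists C, forall gamma, Gam gamma ->
    exists2 j : R, J gamma = j%:E &
    ((1 - e) * (ln gamma / a) - C <= j <= (1 + e) * (ln gamma / a) + C)%R.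
  move=> e0 e1; have [C hC] := hJ e e0 e1; exists C => gamma /hC.
  case: (J gamma) => [j| |]; rewrite ?leye_eq ?leeNy_eq ?andbF//.
  by rewrite !lee_fin => jC; exists j.
have quot gamma j : Gam gamma -> J gamma = j%:E ->
    J gamma / (ln gamma / a)%:E = (j / (ln gamma / a))%:E.
  move=> /G1 g1 ->; rewrite inver gt_eqF// divr_gt0//; exact: ln_gt0.
rewrite /asymp_equiv; apply/fine_cvgP; split.
  rewrite near_withinE; near=> gamma => Gg.
  have [C /(_ gamma Gg)[j Jj _]] := JE 2^-1%R ltac:(lra) ltac:(lra).
  by rewrite (quot _ _ Gg Jj).
apply/cvgrPdist_le => eps eps0.
pose e := (Num.min eps 1 / 2)%R.
have e0 : (0 < e)%R by rewrite /e divr_gt0// lt_min eps0 ltr01.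
have ee : (e <= eps / 2)%R by rewrite /e ler_pM2r// ge_min lexx.
have e1 : (e < 1)%R.
  have : (Num.min eps 1 <= 1)%R by rewrite ge_min lexx orbT.
  by rewrite /e; lra.
have [C hC] := JE e e0 e1.
rewrite near_withinE; near=> gamma => Gg.
have [j Jj /andP[lo hi]] := hC gamma Gg.
have u0 : (0 < ln gamma / a)%R by rewrite divr_gt0// ln_gt0// G1.
rewrite /= (quot _ _ Gg Jj)/=; set u := (ln gamma / a)%R in lo hi u0 *.
have Cu : (C <= eps / 2 * u)%R.
  rewrite -ler_pdivrMl ?divr_gt0// /u ler_pdivlMr//.
  rewrite -ler_expR lnK; last by rewrite posrE (lt_trans ltr01 (G1 _ Gg)).
  apply/ltW; near: gamma; apply: nbhs_pinfty_gt; exact: num_real.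
have -> : (1 - j / u = (u - j) / u)%R by rewrite mulrBl divff// gt_eqF.
rewrite normrM (gtr0_norm (_ : 0 < u^-1)%R) ?invr_gt0// ler_pdivrMr// ler_norml.
have : (e * u <= eps / 2 * u)%R by rewrite ler_wpM2r// ltW.
move=> eu; apply/andP; split; lra.
Unshelve. all: by end_near.
Qed.
End rates.

Section detection_class.
Context (R : realType) (d : measure_display) (E : measurableType d) (K : nat) (f g : E -> R).
Hypothesis mllr : measurable_fun setT (llr f g).

(** Whether a vote takes place at a time t <= n is decided by the observations
    up to t. *)
Lemma voting_time_stopping (A : {set 'I_K}) L h : (0 < L <= #|A|)%N ->
  is_stopping_time (voting_time f g A L h).
Proof.
move=> hL; split => [x|n]; first exact: voting_time_values.
have -> : [set x | voting_time f g A L h x <= n%:R%:E] =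
    \big[setU/set0]_(t <- iota 1 n) [set x | (L <= #|A :&: alarms f g h x t|)%N].
  apply/seteqP; split => x /=; rewrite -bigcup_seq.
    move=> /(voting_time_le f g h x n hL)[t [tn vt]]; exists t => //.
    by change (t \in iota 1 n); rewrite mem_iota add1n ltnS.
  move=> [t /= tn vt]; apply/(voting_time_le f g h x n hL); exists t; split => //.
  by move: tn; rewrite mem_iota add1n ltnS.
set G := history _ _ _.
rewrite big_seq; apply: (@bigsetU_measurable _ (g_sigma_algebraType _)) => t.
rewrite mem_iota add1n ltnS => tn.
apply: (@measurable_vote _ _ _ (g_sigma_algebraType _) _ _ _ _ mllr) => s k sn kA _ C mC.
rewrite setTI; apply: sub_sigma_algebra; exists s, k, C; split => //.
  by move: tn sn; lia.
Qed.
End detection_class.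

Theorem theorem8 (R : realType) (d dO : measure_display)
  (E : measurableType d) (Om : measurableType dO)
  (lambda : {sigma_finite_measure set E -> \bar R}) (f g : E -> R)
  (hf : is_density lambda f) (hg : is_density lambda g)
  (hI : 0 < kullback lambda f g < +oo)
  (K M : nat) (hMK : (M < K)%N)
  (N : {set 'I_K}) (hN : #|N| = (K - M)%N)
  (B : {set 'I_K}) (hB : B \subset N)
  (X : Om -> obs_array K E)
  (Pinf : probability Om R) (P : nat -> probability Om R)
  (hPinf : honest_law lambda N X Pinf (fun _ _ => f))
  (hP : forall nu : nat, honest_law lambda N X (P nu) (change_density f g B nu))
  (L : nat) (hML : (M < L)%N) (hLK : (L <= K)%N)
  (Gam : set R) (h : R -> R)
  (hGam : forall gamma : R, Gam gamma ->
     [/\ (1 < gamma)%R, (0 < h gamma)%R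
       & \int[Pinf]_w voting_time f g N (L - M) (h gamma) (X w) = gamma%:E]) :
  (forall gamma : R, Gam gamma ->
     detection_class N X Pinf gamma
       (voting_time f g [set: 'I_K]%SET L (h gamma))) /\
  ((L <= #|B|)%N ->
     asymp_equiv (within Gam (pinfty_nbhs R))
       (fun gamma =>
          worst_delay N X P (voting_time f g [set: 'I_K]%SET L (h gamma)))
       (fun gamma =>
          (ln gamma)%:E / ((L - M)%N%:R%:E * kullback lambda f g))).
Proof.
have mllr := measurable_llr hf hg.
have mZ i (Di : honest_index N i) := honest_measurable hPinf Di.
have hL : (0 < L <= #|[set: 'I_K]%SET|)%N.
  by rewrite cardsT card_ord hLK andbT (leq_ltn_trans _ hML).
have m0 : (0 < L - M)%N by rewrite subn_gt0.
have hm : (0 < L - M <= #|N|)%N by rewrite m0 hN leq_sub2r.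
split => [gamma /hGam[_ _ eg]|LB].
  split; first exact: voting_time_stopping.
  apply: le_ereal_inf_tmp => _ [pi hpi <-]; rewrite -eg.
  apply: ge0_le_integral => //.
  - by move=> w _; exact: voting_time_ge0.
  - by apply: measurable_voting_time => // s k s0 kN; exact: (mZ (s, k)).
  - by apply: measurable_voting_time => // s k s0 _; exact: (measurable_observed mZ hpi).
  - by move=> w _; exact: voting_time_observed.
set kl := fine (kullback lambda f g).
have kl0 : (0 < kl)%R := kullback_gt0 hI.
set m : R := (L - M)%N%:R.
have mR : (0 < m)%R by rewrite ltr0n.
have mB : (0 < L - M <= #|B|)%N by rewrite m0 (leq_trans (leq_subr _ _)).
have -> : (fun gamma => (ln gamma)%:E / ((L - M)%N%:R%:E * kullback lambda f g)) =
    (fun gamma => (ln gamma / (m * kl))%:E).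
  apply/funext => gamma; rewrite -[kullback _ _ _](fineK (kullback_fin hI)) -/kl -EFinM inver.
  by rewrite gt_eqF// mulr_gt0.
apply: asymp_equiv_log => [|gamma /hGam[]//|e e0 e1]; first by rewrite mulr_gt0.
have e'0 : (0 < e / (2 + e))%R by rewrite divr_gt0//; lra.
have e'1 : (e / (2 + e) < 1)%R by rewrite ltr_pdivrMr; lra.
have [C1 dup] := delay_upper hf hg hI mZ hB (leq_ltn_trans (leq0n _) hML) LB hP e'0.
have [C2 dlo] := delay_lower hf hg hI mZ hB hN hML hLK hP e'0 e'1.
have [C3 tup] := threshold_upper hf hg hI hPinf m0 (proj2 (andP hm)) e'0 e'1.
have [C4 tlo] := threshold_lower hf hg hI hPinf hB (hP 0%N) mB e'0.
exists (Num.max ((1 + e) * (C3 / (m * kl)) + C1) (`|C4| / (m * kl) + C2))%R.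
move=> gamma /hGam[g1 h0 eg]; apply/andP; split.
  apply: le_trans (dlo _ h0); rewrite lee_fin.
  apply: le_trans (delay_rate_lower C2 kl0 mR e0 (ln_ge0 (ltW g1)) (tlo _ _ h0 g1 eg)).
  by rewrite lerD2l lerN2 le_max lexx orbT.
apply: le_trans (dup _ h0) _; rewrite lee_fin.
apply: le_trans (delay_rate_upper C1 kl0 mR e0 (tup _ _ h0 g1 eg)) _.
by rewrite lerD2l le_max lexx.
Qed.
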